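(* For every $M>0$ there is a constant $C_M>0$ depending only on $M$ such that the following holds. Let $G_\star\in\mathcal P(M)$, let $\mu_1,\dots,\mu_n$ be i.i.d. from $G_\star$ and, conditionally on these, let $Z_i\mid\mu_i\sim \mathrm N(\mu_i,1)$ independently for $i=1,\dots,n$. Let $\widehat G$ be the minimizer of $\mathrm{SURE}(G)$ (equivalently, of $\mathrm{SM}(G)$) over all $G\in\mathcal P(M)$. Then, with probability at least $1-n^{-2}$, $$\mathrm{Regret}(G_\star,\widehat G)= D_{\mathrm F}(f_{G_\star}\,\|\,f_{\widehat G})\le C_M\frac{\log^6 n}{n}.$$
   Context: $\mathcal P(M)$ is the class of all probability distributions on $\mathbb R$ supported on $[-M,M]$. Let $\varphi$ be the standard normal density. For a probability distribution $G$ on $\mathbb R$ put $f_G(z)=\int\varphi(z-\mu)\,G(d\mu)$ and $s_G(z)=\frac{\partial}{\partial z}\log f_G(z)$. One has $\mathbb E_G[\mu\mid Z=z]=z+s_G(z)$ when $\mu\sim G$, $Z\mid\mu\sim\mathrm N(\mu,1)$. Define $$\mathrm{SURE}(G)=1+\frac1n\sum_{i=1}^n\Big\{s_G(Z_i)^2+2\frac{\partial}{\partial z}s_G(Z_i)\Big\},\qquad \mathrm{SM}(G)=\frac1n\sum_{i=1}^n\Big\{s_G(Z_i)^2+2\frac{\partial}{\partial z}s_G(Z_i)\Big\}.$$ The Fisher divergence is $D_{\mathrm F}(f_{G_\star}\|f_G)=\int\{s_{G_\star}(z)-s_G(z)\}^2f_{G_\star}(z)\,dz$. The empirical Bayes regret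 is $\mathrm{Regret}(G_\star,G)=\mathbb E_{G_\star}[(\mu-\mathbb E_G[\mu\mid Z])^2]-\mathbb E_{G_\star}[(\mu-\mathbb E_{G_\star}[\mu\mid Z])^2]$, where under $\mathbb E_{G_\star}$ the pair $(\mu,Z)$ is a fresh draw with $\mu\sim G_\star$, $Z\mid\mu\sim\mathrm N(\mu,1)$; in this setting it equals $D_{\mathrm F}(f_{G_\star}\|f_G)$. For the data-dependent $\widehat G$ these functionals are evaluated at the realized $\widehat G$ (the fresh draw is independent of the data). *)

(* Defs.v *)
From HB Require Import structures.
From mathcomp Require Export all_boot all_order all_algebra.
From mathcomp Require Export all_classical all_reals all_analysis.

Set Implicit Arguments.
Unset Strict Implicit.
Unset Printing Implicit Defensive.
Import Order.TTheory GRing.Theory Num.Theory.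
Import numFieldNormedType.Exports.

Local Open Scope classical_set_scope.
Local Open Scope ring_scope.

Definition law (R : realType) := probability (measurableTypeR R) R.

(* The class P(M). *)
Definition supported_in (R : realType) (M : R) (G : law R) : Prop :=
  G [set` `[- M, M]] = 1%E.

Definition std_normal_pdf (R : realType) (x : R) : R := normal_pdf 0 1 x.

Definition mixture_pdf (R : realType) (G : law R) (z : R) : R :=
  \int[G]_m std_normal_pdf (z - m).

Definition score (R : realType) (G : law R) : R -> R :=
  derive1 (fun z : R => ln (mixture_pdf G z)).

(* E_G[mu | Z = z], as the mean of the posterior law of mu given Z = z, whose
   density with respect to G is m |-> phi(z - m) / f_G(z) by Bayes' rule. *)
Definition posterior_mean (R : realType) (G : law R) (z : R) : R :=
  (\int[G]_m (m * std_normal_pdf (z - m))) / mixture_pdf G z.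

Definition SURE (R : realType) (n : nat) (z : 'I_n -> R) (G : law R) : R :=
  1 + n%:R^-1 * \sum_(i < n) (score G (z i) ^+ 2 + 2 * derive1 (score G) (z i)).

Definition SM (R : realType) (n : nat) (z : 'I_n -> R) (G : law R) : R :=
  n%:R^-1 * \sum_(i < n) (score G (z i) ^+ 2 + 2 * derive1 (score G) (z i)).

Definition minimizes_over (R : realType) (M : R) (L : law R -> R) (G : law R)
    : Prop :=
  supported_in M G /\ forall H : law R, supported_in M H -> L G <= L H.

(* E[h(mu, Z)] for mu ~ G and Z | mu ~ N(mu, 1); h is meant to be measurable
   and nonnegative. *)
Definition joint_expectation (R : realType) (G : law R) (h : R -> R -> R)
    : \bar R :=
  (\int[G]_m \int[normal_prob m 1]_z (h m z)%:E)%E.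

(* Extended-real valued, like [fisher_divergence], so that divergent integrals
   are not silently replaced by 0. *)
Definition regret (R : realType) (Gstar G : law R) : \bar R :=
  (joint_expectation Gstar (fun m z => ((m - posterior_mean G z) ^+ 2)%R)
   - joint_expectation Gstar
       (fun m z => ((m - posterior_mean Gstar z) ^+ 2)%R))%E.

(* D_F(f_Gstar || f_G). *)
Definition fisher_divergence (R : realType) (Gstar G : law R) : \bar R :=
  (\int[lebesgue_measure]_z
     ((score Gstar z - score G z) ^+ 2 * mixture_pdf Gstar z)%:E)%E.

Definition mutually_independent (d : measure_display) (T : measurableType d)
    (R : realType) (P : probability T R) (n : nat) (X : 'I_n -> {RV P >-> R})
    : Prop :=
  forall (J : {set 'I_n}) (B : 'I_n -> set (measurableTypeR R)),
    (forall i, measurable (B i)) ->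
    P [set w | forall i, i \in J -> B i (X i w)] =
      (\prod_(i in J) P (X i @^-1` B i))%E.

Definition iid_from (d : measure_display) (T : measurableType d)
    (R : realType) (P : probability T R) (G : law R) (n : nat)
    (X : 'I_n -> {RV P >-> R}) : Prop :=
  mutually_independent X /\
  forall (i : 'I_n) (B : set (measurableTypeR R)),
    measurable B -> distribution P (X i) B = G B.

(* Conditionally on sigma(mu_1, ..., mu_n), the Z_i are independent with
   Z_i ~ N(mu_i, 1): the product of the N(mu_i, 1)(B i) is a version of the
   conditional probability of { Z_i in B i for all i }. *)
Definition normal_given (d : measure_display) (T : measurableType d)
    (R : realType) (P : probability T R) (n : nat)
    (mu Z : 'I_n -> {RV P >-> R}) : Prop :=
  forall (A : set T) (B : 'I_n -> set (measurableTypeR R)),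
    g_sigma_preimage (fun i => mu i : T -> measurableTypeR R) A ->
    (forall i, measurable (B i)) ->
    P (A `&` [set w | forall i, B i (Z i w)]) =
      (\int[P]_(w in A) \prod_(i < n) normal_prob (mu i w) 1 (B i))%E.

(* Main.v *)
Require Import Defs.
From mathcomp Require Import measurable_realfun ring lra zify.

Set Implicit Arguments.
Unset Strict Implicit.
Unset Printing Implicit Defensive.
Import Order.TTheory GRing.Theory Num.Theory.
Import numFieldNormedType.Exports.
Local Open Scope classical_set_scope.
Local Open Scope ring_scope.

(** Write u for the posterior mean under a law G of the class and v for the one
under the true law. Since the score of G is u(z) - z, the Fisher divergence is
the mean square, under the true law of the observation Z, of the gap
delta = u - v, and it is the regret because v(Z) is the orthogonal projection
of the signal on functions of Z ([fisher_divergenceE], [regretE]). Call D this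
number. The score matching losses of G and of the true law differ by the excess
loss
  X = delta^2 + 2 delta (v - z) + 2 delta'.
Writing z as signal plus noise, the signal part of the cross term has mean zero
by orthogonality, and the noise part cancels 2 delta' by Stein's identity; hence
X has mean D ([joint_excess_loss]). The empirical minimizer has a nonpositive
sum of excess losses, so it remains to show that, uniformly in G, this is
unlikely unless D is small.

The mean D is of the same order as the square of delta, whereas X contains
delta' at first order. A fast rate needs the second moment of X to be controlled
by D itself, hence a bound for the mean square of delta' in terms of that of
delta: a reverse Poincare inequality. It fails in general, but the derivatives
of a posterior mean are cumulants of a law on [-M, M], so that the j-th
derivative of delta is at most 2 M j! (4M+1)^j, uniformly in G
([norm_post_cumulant_le]). Let B_j be the Gaussian mean square of the j-th
derivative. Stein's identity gives B_(j+1)^2 <= B_j (B_(j+1) + B_(j+2)): if B_1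
exceeded K B_0 then B_j would grow like (K/2)^j, which the a priori bound
forbids up to an error exponentially small in k once K is of order k^2 and
j reaches k ([gauss_derivative_interpolation]). Truncating to |z| <= L with L of
order k, the second moment of X is thus at most a multiple of k^2 D plus a
negligible error ([truncated_excess_sq]), and Chernoff's bound with a parameter
l of order k^-2 gives, for one law G,
  P(sum of X(Z_i) <= c) <= exp(l c - n l D / 2 + O(1))
([excess_loss_deviation]).

For uniformity, the same derivative bounds say that u is determined on the
window, up to 4^-k, by O(k) Taylor coefficients at O(k) points, each rounded to
a multiple of 4^-k. This yields exp(O(k^3)) classes of laws ([net_code],
[code_count]), within which n times the excess loss varies by O(1) when
n <= 2^k ([excess_loss_close]). If D exceeds a large multiple of k^5 / n, then
n l D / 2 is a large multiple of k^3 and beats the number of classes; the union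
bound fails with probability at most 4^-k <= n^-2 ([uniform_deviation]). Taking
k of the order of log n gives a regret of order log^5 n / n, within the
announced rate. *)

(** * Change of variables, independence, union bound *)

Section weighted_transfer.
Context d d' (T : measurableType d) (T' : measurableType d') (R : realType).
Variables (mu : {measure set T -> \bar R}) (nu : {measure set T' -> \bar R}).
Variables (X : T -> T') (W : T -> R).
Hypotheses (mX : measurable_fun [set: T] X) (mW : measurable_fun [set: T] W).
Hypothesis W0 : forall t, 0 <= W t.
Hypothesis nuE : forall B, measurable B ->
  (\int[mu]_t (\1_B (X t) * W t)%:E = nu B)%E.

Import HBNNSimple.

(** A change of variables known for indicators extends to nonnegative
measurable functions, by approximation with simple functions. With [X] the
identity this integrates against a density; with [W] constant it is an image
measure; both occur together in [independent_prod]. *)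
Lemma ge0_integral_weighted (f : T' -> \bar R) :
  measurable_fun [set: T'] f -> (forall x, (0 <= f x)%E) ->
  (\int[nu]_x f x = \int[mu]_t (f (X t) * (W t)%:E))%E.
Proof.
move=> mf f0.
have mp : measurable_fun [set: T] (EFin \o W) by exact/measurable_EFinP.
have p0 t : (0 <= (W t)%:E)%E by rewrite lee_fin.
pose f_ := nnsfun_approx measurableT mf.
have f_nd x : {homo (fun n => (f_ n x)%:E) : a b / (a <= b)%N >-> (a <= b)%E}.
  by move=> a b ab; rewrite lee_fin; exact/lefP/nd_nnsfun_approx.
transitivity (limn (fun n => \int[nu]_x (f_ n x)%:E)%E).
  rewrite -monotone_convergence//.
  - apply: eq_integral => y _; apply/esym/cvg_lim => //.
    exact: cvg_nnsfun_approx.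
  - by move=> n; exact/measurable_EFinP/measurable_funP.
  - by move=> n y _; rewrite lee_fin.
rewrite [X in limn X](_ : _ =
    (fun n => \int[mu]_t ((f_ n (X t))%:E * (W t)%:E))%E).
  rewrite -monotone_convergence//.
  - apply: eq_integral => y _; apply/cvg_lim => //.
    apply: cvgeZr => //.
    exact: cvg_nnsfun_approx.
  - move=> n; apply: emeasurable_funM => //.
    by apply/measurable_EFinP; exact: measurableT_comp.
  - by move=> n y _; rewrite mule_ge0// lee_fin.
  - by move=> y _ a b ab; rewrite lee_wpmul2r//; exact: f_nd.
apply/funext => n.
have mI r : measurable (f_ n @^-1` [set r]) by exact: measurable_funPTI.
have mk r : measurable_fun [set: T] (fun t => r * \1_(f_ n @^-1` [set r]) (X t)).
  apply: measurable_funM => //.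
  by apply: (measurableT_comp _ mX); exact: measurable_indic.
under eq_integral do rewrite fimfunE -fsumEFin//.
rewrite ge0_integral_fsum//; last 2 first.
- by move=> y; exact/measurable_EFinP/measurable_funM.
- by move=> y x _; rewrite nnfun_muleindic_ge0.
transitivity (\int[mu]_t (\sum_(k \in range (f_ n))
    (k * \1_(f_ n @^-1` [set k]) (X t))%:E * (W t)%:E))%E; last first.
  under eq_integral => t _.
    rewrite -ge0_mule_fsuml => [|y]; last exact: nnfun_muleindic_ge0.
    rewrite fsumEFin // -(fimfunE _ (X t)); over.
  by [].
rewrite ge0_integral_fsum//; last 2 first.
- by move=> y; apply: emeasurable_funM => //; exact/measurable_EFinP.
- by move=> y x _; rewrite mule_ge0// nnfun_muleindic_ge0.
apply: eq_fsbigr => r; rewrite inE => -[x _ <-].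
have r0 : 0 <= f_ n x by [].
rewrite integralZl_indic_nnsfun// integral_indic// setIT.
under [RHS]eq_integral => y _ do rewrite -EFinM -mulrA EFinM.
rewrite ge0_integralZl//; last 2 first.
- apply/measurable_EFinP; apply: measurable_funM => //.
  by apply: (measurableT_comp _ mX); exact: measurable_indic.
- by move=> y _; rewrite lee_fin mulr_ge0.
by rewrite nuE.
Qed.

End weighted_transfer.

Section independent_product.
Context d d' (T : measurableType d) (T' : measurableType d') (R : realType).
Variables (P : probability T R) (n : nat) (X : 'I_n -> T -> T').
Hypothesis mX : forall i, measurable_fun [set: T] (X i).
Variable nu : probability T' R.
Hypothesis XP : forall B : 'I_n -> set T', (forall i, measurable (B i)) ->
  P [set w | forall i, B i (X i w)] = (\prod_(i < n) fine (nu (B i)))%:E.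

(** The first [k] coordinates carry their function, the others an indicator. *)
Let mixed (k : nat) (g : 'I_n -> T' -> R) (B : 'I_n -> set T') (i : 'I_n) (x : T') : R :=
  if (i < k)%N then g i x else \1_(B i) x.

Lemma measurable_prod_comp (p : pred 'I_n) (h : 'I_n -> T' -> R) :
  (forall i, measurable_fun [set: T'] (h i)) ->
  measurable_fun [set: T] (fun w => \prod_(i < n | p i) h i (X i w)).
Proof.
move=> mh.
have -> : (fun w => \prod_(i < n | p i) h i (X i w)) = fun w => \prod_(i <- enum 'I_n | p i) h i (X i w).
  by apply/funext => w; rewrite big_enum_cond.
elim: (enum 'I_n) => [|i s IH].
  by under eq_fun do rewrite big_nil; exact: measurable_cst.
under eq_fun do rewrite big_cons.
case: (p i) => //; apply: measurable_funM => //.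
exact: (measurableT_comp (mh i) (mX i)).
Qed.

(** Induction on the number of coordinates that carry their function instead of
an indicator: the product over the other coordinates is the weight in
[ge0_integral_weighted], which turns the indicator of the next coordinate into
a function. *)
Lemma independent_prod (g : 'I_n -> T' -> R) :
  (forall i, measurable_fun [set: T'] (g i)) -> (forall i x, 0 <= g i x) ->
  (forall i, nu.-integrable setT (EFin \o g i)) ->
  (\int[P]_w (\prod_(i < n) g i (X i w))%:E)%E = (\prod_(i < n) \int[nu]_x g i x)%:E.
Proof.
move=> mg g0 ig.
have mmix k B i : measurable (B i) -> measurable_fun [set: T'] (mixed k g B i).
  by move=> mB; rewrite /mixed; case: (i < k)%N => //; exact: measurable_indic.
have mix0 k B i x : 0 <= mixed k g B i x by rewrite /mixed; case: ifPn.
suff H k : (k <= n)%N -> forall B, (forall i, measurable (B i)) ->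
  (\int[P]_w (\prod_(i < n) mixed k g B i (X i w))%:E)%E =
   (\prod_(i < n) (if (i < k)%N then \int[nu]_x g i x else fine (nu (B i))))%:E.
  have := H n (leqnn n) (fun=> setT) (fun=> measurableT).
  under [in RHS]eq_bigr do rewrite ltn_ord.
  move=> <-; apply: eq_integral => w _; congr EFin; apply: eq_bigr => i _.
  by rewrite /mixed ltn_ord.
elim: k => [|k IH] kn B mB.
  transitivity (P [set w | forall i, B i (X i w)]); last by rewrite XP.
  set E := [set w | _].
  have mE : measurable E.
    rewrite (_ : E = \bigcap_(i in [set: 'I_n]) (X i @^-1` B i)).
      apply: fin_bigcap_measurable => // i _.
      by rewrite -[X in measurable X]setTI; exact: mX.
    by apply/seteqP; split => w /= H i => [_|]; apply: H.
  rewrite -[E in RHS]setIT -integral_indic//.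
  apply: eq_integral => w _; congr EFin; rewrite indicE.
  case: (boolP (w \in E)) => [|wE].
    rewrite inE => wE; apply: big1 => i _.
    by rewrite /mixed ltn0 indicE mem_set//; exact: wE.
  have /existsNP[i Bi] : ~ (forall i, B i (X i w)) by move=> H; move: wE; rewrite notin_setE; apply.
  by rewrite (bigD1 i)//= /mixed ltn0 indicE memNset// mul0r.
pose i0 := Ordinal kn.
have ltS (i : 'I_n) : i != i0 -> (i < k.+1)%N = (i < k)%N.
  move=> ii0; rewrite ltnS leq_eqVlt; case: eqP => //= ik.
  by move: ii0; rewrite -val_eqE/= ik eqxx.
pose W w := \prod_(i < n | i != i0) mixed k g B i (X i w).
pose c := \prod_(i < n | i != i0) (if (i < k)%N then \int[nu]_x g i x else fine (nu (B i))).
have c0 : 0 <= c.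
  apply: prodr_ge0 => i _; case: ifPn => _; last exact: fine_ge0.
  by apply: Rintegral_ge0.
have W0 w : 0 <= W w by apply: prodr_ge0.
have mW : measurable_fun [set: T] W by apply: measurable_prod_comp => i; exact: mmix.
have nuE C : measurable C ->
    (\int[P]_t (\1_C (X i0 t) * W t)%:E)%E = mscale (NngNum c0) nu C.
  move=> mC; pose B' i := if i == i0 then C else B i.
  have mB' i : measurable (B' i) by rewrite /B'; case: ifPn.
  transitivity (\int[P]_w (\prod_(i < n) mixed k g B' i (X i w))%:E)%E.
    apply: eq_integral => w _; congr EFin.
    rewrite [RHS](bigD1 i0)//= /mixed ltnn /B' eqxx; congr (_ * _).
    by apply: eq_bigr => i ii0; rewrite (negbTE ii0).
  rewrite IH//; last exact: ltnW.
  rewrite (bigD1 i0)//= ltnn /B' eqxx mulrC EFinM fineK ?fin_num_measure//.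
  rewrite /mscale/=; congr (_%:E * _)%E.
  by apply: eq_bigr => i ii0; rewrite (negbTE ii0).
have mg0 : measurable_fun [set: T'] (EFin \o g i0) by exact/measurable_EFinP.
have := ge0_integral_weighted (mX i0) mW W0 nuE mg0.
rewrite ge0_integral_mscale//=; last by move=> x _; rewrite lee_fin.
move=> H.
transitivity (\int[P]_t ((g i0 (X i0 t))%:E * (W t)%:E))%E.
  apply: eq_integral => w _; rewrite -EFinM; congr EFin.
  rewrite (bigD1 i0)//= /mixed ltnSn; congr (_ * _).
  by apply: eq_bigr => i ii0; rewrite /mixed ltS.
rewrite -H; last by move=> x; rewrite lee_fin.
rewrite (bigD1 i0)//= ltnSn mulrC EFinM; congr (_%:E * _)%E.
  by apply: eq_bigr => i ii0; rewrite ltS.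
by rewrite /Rintegral fineK//; exact: (integrable_fin_num measurableT (ig i0)).
Qed.

End independent_product.

Lemma finite_union_bound (R : realType) d (T : measurableType d) (P : probability T R)
    (F : finType) (B : F -> set T) (p : R) :
  (forall c, measurable (B c)) -> (forall c, (P (B c) <= p%:E)%E) ->
  measurable (\bigcup_(c in [set: F]) B c) /\
  (P (\bigcup_(c in [set: F]) B c) <= (#|F|%:R * p)%:E)%E.
Proof.
move=> mB PB.
have -> : \bigcup_(c in [set: F]) B c = \big[setU/set0]_(c <- enum F) B c.
  rewrite -bigcup_seq; apply: eq_bigcupl; split => c //= _.
  by rewrite mem_enum.
rewrite cardE; elim: (enum F) => [|c s [IHm IH]].
  by rewrite big_nil mul0r measure0; split.
rewrite big_cons; split; first exact: measurableU.
apply: (le_trans (measureU2 _ _ _)) => //.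
by rewrite /= -natr1 mulrDl mul1r addrC EFinD; exact: leeD.
Qed.

(** * Elementary inequalities *)

Lemma bernoulli_inequality (R : realType) (x : R) n : 0 <= x -> x <= 1 -> 1 - n%:R * x <= (1 - x) ^+ n.
Proof.
move=> x0 x1; elim: n => [|n IH]; first by rewrite mul0r subr0 expr0.
rewrite exprS; apply: (@le_trans _ _ ((1 - x) * (1 - n%:R * x))); last first.
  by rewrite ler_wpM2l// subr_ge0.
rewrite -natr1 -subr_ge0 (_ : _ - _ = n%:R * x ^+ 2); last by ring.
by rewrite mulr_ge0 ?sqr_ge0.
Qed.

(** From [1 + y / 2 <= expR (y / 2)], squared: what remains is a polynomial
inequality, true as long as [1 + 3 y + y^2] is nonnegative. *)
Lemma expRN_le_quadratic (R : realType) (y : R) : `|y| <= 3^-1 ->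
  expR (- y) <= 1 - y + y ^+ 2.
Proof.
rewrite ler_norml => /andP[y1 y2].
have h : 0 < 1 + y / 2 by lra.
have e1 : (1 + y / 2) ^+ 2 <= expR y.
  rewrite (_ : expR y = expR (y / 2) ^+ 2); last by rewrite -expRM_natl; congr expR; field.
  by rewrite lerXn2r ?nnegrE ?expR_ge0 ?(ltW h)// expR_ge1Dx.
rewrite expRN; apply: (@le_trans _ _ ((1 + y / 2) ^- 2)).
  by rewrite lef_pV2 ?posrE ?expR_gt0 ?exprn_gt0.
rewrite invf_ple ?posrE ?exprn_gt0//; last by nra.
rewrite -[_^-1]mul1r ler_pdivrMr; last by nra.
have -> : (1 + y / 2) ^+ 2 * (1 - y + y ^+ 2) = 1 + y ^+ 2 / 4 * (1 + 3 * y + y ^+ 2) by field.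
rewrite lerDl mulr_ge0 ?divr_ge0 ?sqr_ge0//; nra.
Qed.

(** * Jets and Taylor comparison *)

Section taylor_comparison.
Context {R : realType}.
Implicit Types (f : nat -> R -> R) (t z c : R).

(** A function together with all its derivatives, so that statements about
derivatives of every order need no derivability side conditions. *)
Definition jet f := forall j t, is_derive t 1 (f j) (f j.+1 t).

Lemma jet_shift f : jet f -> jet (fun j => f j.+1).
Proof. by move=> fJ j t; exact: fJ. Qed.

Lemma jetB f g : jet f -> jet g -> jet (fun j => f j - g j).
Proof. by move=> fJ gJ j t; have := fJ j t; have := gJ j t => H1 H2; exact: is_deriveB. Qed.

Lemma jet_translate f c : jet f -> jet (fun j t => f j (c + t)).
Proof.
move=> fJ j t.
have H1 : is_derive t 1 (fun t => c + t) 1.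
  by have := is_deriveD (is_derive_cst c t (1 : R)) (is_derive_id t (1 : R)); rewrite add0r.
have H2 := @is_derive1_comp R (f j) (fun t => c + t) t _ _ (fJ j (c + t)) H1.
have : is_derive t 1 (fun t => f j (c + t)) (f j.+1 (c + t) * 1) by exact: H2.
by rewrite mulr1.
Qed.

Lemma jet_continuous f j : jet f -> continuous (f j).
Proof.
move=> fJ t; apply: differentiable_continuous; apply/derivable1_diffP.
by have [] := fJ j t.
Qed.

Lemma jet_measurable f j : jet f -> measurable_fun [set: R] (f j).
Proof. by move=> fJ; apply: continuous_measurable_fun; exact: jet_continuous. Qed.

Let mono n t : R := t ^+ n / n`!%:R.

Let is_derive_mono n t : is_derive t 1 (mono n.+1) (mono n t).
Proof.
rewrite (_ : mono n.+1 = (n.+1)`!%:R^-1 *: ((@id R) ^+ n.+1)); last first.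
  by apply/funext => s; rewrite /mono !fctE/= /GRing.scale/= mulrC.
apply: is_derive_eq.
rewrite /GRing.scale/= mulr1 factS natrM /mono.
by field; rewrite addrC natr1 !pnatr_eq0 -lt0n fact_gt0.
Qed.

(** Taylor polynomial with coefficients [a] and a remainder term of order [N]. *)
Let major (a : nat -> R) (S : R) N t := \sum_(j < N) a j * mono j t + S * mono N t.

Let is_derive_major (a : nat -> R) (S : R) N t :
  is_derive t 1 (major a S N.+1) (major (fun j => a j.+1) S N t).
Proof.
rewrite (_ : major a S N.+1 = cst (a 0%N) + \sum_(j < N) (a j.+1 *: mono j.+1) + S *: mono N.+1).
  have Z a' n := is_deriveZ a' (is_derive_mono n t).
  have H := is_deriveD (is_deriveD (is_derive_cst (a 0%N) t (1 : R))
    (is_derive_sum (fun j : 'I_N => Z (a j.+1) j))) (Z S N).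
  apply: is_derive_eq H _.
  by rewrite add0r.
apply/funext => s; rewrite /major big_ord_recl/= /mono expr0 fact0 divr1 mulr1.
by rewrite !fctE; congr (_ + _ + _); rewrite fct_sumE.
Qed.

(** A bound on the jet at [0] and on the derivative of order [N] propagates by
integrating [N] times: [f] and its majorant are compared through the sign of the
derivative of their sum and difference. *)
Let jet_major f (a : nat -> R) (S : R) N : jet f -> 0 <= S -> (forall j, (j < N)%N -> `|f j 0| <= a j) ->
  (forall t, 0 <= t -> `|f N t| <= S) ->
  forall t, 0 <= t -> `|f 0%N t| <= major a S N t.
Proof.
elim: N f a => [|N IH] f a fJ S0 f0 fN t t0.
  by rewrite /major big_ord0 add0r /mono expr0 fact0 divr1 mulr1 fN.
have IH1 (s : R) : 0 <= s -> `|f 1%N s| <= major (fun j => a j.+1) S N s.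
  by move=> s0; apply: (IH (fun j => f j.+1)) => // j jN; exact: f0.
have major0 : major a S N.+1 0 = a 0%N.
  rewrite /major big_ord_recl /mono expr0 fact0 divr1 mulr1 expr0n mul0r mulr0 addr0.
  by rewrite big1 ?addr0// => i _; rewrite expr0n mul0r mulr0.
have incr (g g' : R -> R) : (forall s : R, is_derive s (1 : R) g (g' s)) ->
    (forall s, 0 <= s -> 0 <= g' s) -> g 0 <= g t.
  move=> dg g'0.
  have cg : {within `[0, t], continuous g}.
    apply: continuous_subspaceT => x; apply: differentiable_continuous.
    by apply/derivable1_diffP; have [] := dg x.
  have [s + gE] := MVT_segment t0 (fun x _ => dg x) cg.
  rewrite in_itv/= => /andP[s0 _].
  by rewrite -subr_ge0 gE subr0 mulr_ge0// g'0.
have D (s : R) := is_derive_major a S N s.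
have := f0 0%N isT; rewrite ler_norml => /andP[f01 f02].
rewrite ler_norml; apply/andP; split.
- have := incr (major a S N.+1 + f 0%N) _ (fun s => is_deriveD (D s) (fJ 0%N s)).
  rewrite !fctE major0 => H; rewrite -subr_ge0 opprK addrC.
  apply: le_trans (H _); first by lra.
  by move=> s /IH1; rewrite ler_norml; lra.
- have := incr (major a S N.+1 - f 0%N) _ (fun s => is_deriveB (D s) (fJ 0%N s)).
  rewrite !fctE major0 => H; rewrite -subr_ge0.
  apply: le_trans (H _); first by lra.
  by move=> s /IH1; rewrite ler_norml; lra.
Qed.

Lemma sum_half_pow N : \sum_(j < N) (2^-1 : R) ^+ j = 2 - 2 * 2^-1 ^+ N.
Proof.
elim: N => [|N IH]; first by rewrite big_ord0 expr0; ring.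
by rewrite big_ord_recr/= IH exprS; field.
Qed.

(** Within half the radius of convergence the Taylor series is dominated by a
geometric series of ratio [1 / 2], which both sums the errors [e] at the centre
and makes the remainder exponentially small in [N]. *)
Lemma jet_bound f (B e S : R) N c z : jet f -> 0 < B -> 0 <= e -> 0 <= S ->
  (forall j, (j < N)%N -> `|f j c| <= e * j`!%:R * B ^+ j) ->
  (forall t, `|f N t| <= S * N`!%:R * B ^+ N) ->
  `|z - c| <= (2 * B)^-1 ->
  `|f 0%N z| <= 2 * e + S * 2^-1 ^+ N.
Proof.
move=> fJ B0 e0 S0 fc fN zc.
(* Points on the left of [c] are reached by reversing the time direction. *)
pose s : R := if c <= z then 1 else -1.
have s1 : `|s| = 1 by rewrite /s; case: ifP; rewrite ?normrN normr1.
have zE : z = c + s * `|z - c|.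
  rewrite /s; case: ifPn => [cz|]; first by rewrite ger0_norm ?subr_ge0//; ring.
  by rewrite -ltNge => zc'; rewrite ltr0_norm ?subr_lt0//; ring.
pose g j t := s ^+ j * f j (c + s * t).
have gJ : jet g.
  move=> j t; rewrite /g.
  have H1 : is_derive t 1 (fun t => c + s * t) s.
    have := is_deriveD (is_derive_cst c t (1 : R)) (is_deriveZ s (is_derive_id t (1 : R))).
    by rewrite add0r [s *: 1]mulr1.
  have H2 := @is_derive1_comp R (f j) (fun t => c + s * t) t _ _ (fJ j (c + s * t)) H1.
  have H3 : is_derive t 1 (fun t => f j (c + s * t)) (f j.+1 (c + s * t) * s).
    exact: H2.
  apply: is_derive_eq.
  by rewrite /GRing.scale/= exprS; ring.
have gN t j : `|g j t| = `|f j (c + s * t)|.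
  by rewrite /g normrM normrX s1 expr1n mul1r.
have := @jet_major g (fun j => e * j`!%:R * B ^+ j) (S * N`!%:R * B ^+ N) N gJ _ _ _ `|z - c| (normr_ge0 _).
rewrite gN -zE => H.
apply: le_trans (H _ _ _) _.
- by rewrite !mulr_ge0 ?exprn_ge0// ltW.
- by move=> j jN; rewrite gN mulr0 addr0; exact: fc.
- by move=> t _; rewrite gN.
rewrite /major.
have monoB j : j`!%:R * B ^+ j * mono j `|z - c| <= 2^-1 ^+ j.
  rewrite /mono (_ : _ * _ * _ = (B * `|z - c|) ^+ j); last first.
    by rewrite exprMn; field; rewrite pnatr_eq0 -lt0n fact_gt0.
  rewrite lerXn2r// ?nnegrE ?mulr_ge0 ?(ltW B0)//.
  by rewrite mulrC -ler_pdivlMr// -invfM.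
apply: lerD.
  apply: (@le_trans _ _ (\sum_(j < N) e * 2^-1 ^+ j)).
    by apply: ler_sum => j _; rewrite -!mulrA ler_wpM2l// mulrA monoB.
  rewrite -mulr_sumr sum_half_pow.
  have : 0 <= (2^-1 : R) ^+ N by rewrite exprn_ge0.
  nra.
by rewrite -!mulrA ler_wpM2l// mulrA monoB.
Qed.

End taylor_comparison.

(** * Gaussian integrals *)

Section gaussian_density.
Context {R : realType}.
Implicit Types x m z : R.
Local Notation phi := (@std_normal_pdf R).

Lemma std_normal_pdfE x : phi x = normal_peak 1 * expR (- x ^+ 2 / 2).
Proof.
rewrite /std_normal_pdf normal_pdfE ?oner_neq0// /normal_fun subr0.
by rewrite expr1n.
Qed.

Lemma std_normal_pdf_gt0 x : 0 < phi x.
Proof. by rewrite std_normal_pdfE mulr_gt0 ?expR_gt0 ?normal_peak_gt0 ?oner_neq0. Qed.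

Lemma std_normal_pdf_le x : phi x <= normal_peak 1.
Proof. by apply: normal_pdf_ub; rewrite oner_neq0. Qed.

(** Dominates the derivative of the Gaussian density when differentiating
under the integral sign. *)
Lemma norm_mul_std_normal_pdf_le x : `|x| * phi x <= normal_peak 1.
Proof.
rewrite std_normal_pdfE mulrCA ger_pMr ?normal_peak_gt0 ?oner_neq0//.
rewrite mulNr expRN ler_pdivrMr ?expR_gt0// mul1r.
apply: le_trans (expR_ge1Dx _).
rewrite -(real_normK (num_real x)).
nra.
Qed.

Lemma normal_pdf_shift m z : normal_pdf m 1 z = phi (z - m).
Proof.
by rewrite /std_normal_pdf !normal_pdfE ?oner_neq0// /normal_fun subr0.
Qed.

Lemma measurable_std_normal_pdf : measurable_fun [set: R] phi.
Proof. exact: measurable_normal_pdf. Qed.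

Lemma is_derive_std_normal_pdf m z :
  is_derive z 1 (fun z => phi (z - m)) (- (z - m) * phi (z - m)).
Proof.
rewrite (_ : (fun z => _) = (fun z => normal_peak 1 * expR (- (z - m) ^+ 2 / 2))); last first.
  by apply/funext => t; rewrite std_normal_pdfE.
apply: is_derive_eq.
rewrite std_normal_pdfE /GRing.scale/=.
by field.
Qed.

End gaussian_density.

Section normal_integral.
Context {R : realType}.
Local Notation leb := (@lebesgue_measure R).
Local Notation phi := (@std_normal_pdf R).
Implicit Types m : R.

Lemma ge0_integral_normal_prob m (f : measurableTypeR R -> \bar R) :
  measurable_fun [set: measurableTypeR R] f -> (forall x, (0 <= f x)%E) ->
  (\int[normal_prob m 1]_x f x = \int[leb]_x (f x * (normal_pdf m 1 x)%:E))%E.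
Proof.
move=> mf f0.
have mp : measurable_fun [set: measurableTypeR R] (normal_pdf m 1 : measurableTypeR R -> R).
  exact: measurable_normal_pdf.
rewrite (@ge0_integral_weighted _ _ _ _ _ leb (normal_prob m 1) id (normal_pdf m 1))//.
  by move=> x; exact: normal_pdf_ge0.
move=> B mB; rewrite [RHS]integral_mkcond; apply: eq_integral => y _.
by rewrite patchE indicE; case: ifPn => _; rewrite ?mul1r ?mul0r.
Qed.

Lemma integral_normal_prob m (f : measurableTypeR R -> R) :
  measurable_fun [set: measurableTypeR R] f ->
  (\int[normal_prob m 1]_x (f x)%:E = \int[leb]_x (f x * normal_pdf m 1 x)%:E)%E.
Proof.
move=> mf; have mf' : measurable_fun [set: measurableTypeR R] (EFin \o f).
  exact/measurable_EFinP.
rewrite [LHS]integralE [RHS]integralE.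
rewrite ge0_integral_normal_prob//; last exact: measurable_funepos.
rewrite ge0_integral_normal_prob//; last exact: measurable_funeneg.
have p0 x : 0 <= normal_pdf m 1 x by rewrite normal_pdf_ge0.
congr (_ - _)%E; apply: eq_integral => x _.
  by rewrite !funeposE/= -!EFin_max -EFinM maxr_pMl// mul0r.
by rewrite !funenegE/= -!EFin_max -EFinM maxr_pMl// mul0r mulNr.
Qed.

Lemma ge0_integral_lebesgue_shift m (f : measurableTypeR R -> \bar R) :
  measurable_fun [set: measurableTypeR R] f -> (forall x, (0 <= f x)%E) ->
  (\int[leb]_x f (x + m)%R = \int[leb]_x f x)%E.
Proof.
move=> mf f0.
pose sh (x : measurableTypeR R) : measurableTypeR R := x + m.
have mS : measurable_fun [set: measurableTypeR R] sh.
  exact: measurable_funD.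
transitivity (\int[pushforward leb sh]_x f x)%E.
  by rewrite ge0_integral_pushforward.
apply: eq_measure_integral => A mA _; apply/esym.
apply: lebesgue_measure_unique => // _ [[a b]] _ <-.
have E : sh @^-1` `]a, b] = `]a - m, b - m]%classic.
  by apply/seteqP; split => x /=; rewrite !in_itv/= ltrBlDr lerBrDr.
transitivity (leb (sh @^-1` `]a, b])); last by [].
rewrite E !lebesgue_measure_itv/= !lte_fin ltrD2r.
by rewrite -!EFinB (_ : b - m - (a - m) = b - a)//; ring.
Qed.

Lemma ge0_integral_normal_prob_shift m (f : measurableTypeR R -> \bar R) :
  measurable_fun [set: measurableTypeR R] f -> (forall x, (0 <= f x)%E) ->
  (\int[normal_prob m 1]_z f z = \int[normal_prob 0 1]_x f (m + x)%R)%E.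
Proof.
move=> mf f0.
have mS : measurable_fun [set: measurableTypeR R] (fun x : measurableTypeR R => m + x : measurableTypeR R).
  exact: measurable_funD.
have mp : measurable_fun [set: measurableTypeR R] (EFin \o normal_pdf m 1).
  by apply/measurable_EFinP; exact: measurable_normal_pdf.
rewrite (ge0_integral_normal_prob m mf f0).
rewrite (@ge0_integral_normal_prob 0 (f \o +%R m)); [|exact: (measurableT_comp mf)|by move=> x; exact: f0].
rewrite -(ge0_integral_lebesgue_shift m).
- apply: eq_integral => x _; rewrite (addrC x); congr (_ * _%:E)%E.
  by rewrite !normal_pdf_shift addrAC subrr add0r subr0.
- exact: emeasurable_funM.
- by move=> x; rewrite mule_ge0// lee_fin normal_pdf_ge0.
Qed.

End normal_integral.

Section exponential_growth.
Context {R : realType}.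
Implicit Types (f g : R -> R).

(** A class of integrands that is closed under sums and products and that every
Gaussian integrates; the integer rate makes the closure properties immediate. *)
Definition exp_growth f := exists C : R, exists2 k : nat, 0 <= C &
  forall x, `|f x| <= C * expR (k%:R * `|x|).

Lemma exp_growth_bounded f C : (forall x, `|f x| <= C) -> exp_growth f.
Proof.
move=> fC; exists C, 0%N; first by apply: le_trans (fC 0).
by move=> x; rewrite mul0r expR0 mulr1.
Qed.

Lemma exp_growth_id : exp_growth id.
Proof.
exists 1, 1%N => // x; rewrite !mul1r; apply: le_trans (expR_ge1Dx _).
by rewrite lerDr.
Qed.

Lemma exp_growth_le f g : (forall x, `|f x| <= `|g x|) -> exp_growth g -> exp_growth f.
Proof. by move=> fg [C [k C0 gC]]; exists C, k => // x; apply: le_trans (gC x). Qed.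

Lemma exp_growthM f g : exp_growth f -> exp_growth g -> exp_growth (fun x => f x * g x).
Proof.
move=> [C [k C0 fC]] [D [l D0 gD]]; exists (C * D), (k + l)%N; first exact: mulr_ge0.
by move=> x; rewrite normrM natrD mulrDl expRD mulrACA ler_pM.
Qed.

Lemma exp_growthD f g : exp_growth f -> exp_growth g -> exp_growth (fun x => f x + g x).
Proof.
move=> [C [k C0 fC]] [D [l D0 gD]]; exists (C + D), (k + l)%N; first exact: addr_ge0.
move=> x; apply: le_trans (ler_normD _ _) _; rewrite mulrDl.
apply: lerD; first apply: le_trans (fC x) _; last apply: le_trans (gD x) _;
  by rewrite ler_wpM2l// ler_expR ler_wpM2r// ler_nat ?leq_addr ?leq_addl.
Qed.

Lemma exp_growthN f : exp_growth f -> exp_growth (fun x => - f x).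
Proof. by apply: exp_growth_le => x; rewrite normrN. Qed.

Lemma exp_growthB f g : exp_growth f -> exp_growth g -> exp_growth (fun x => f x - g x).
Proof. by move=> fg gg; apply: exp_growthD => //; exact: exp_growthN. Qed.

End exponential_growth.

Section standard_gaussian.
Context {R : realType}.
Local Notation leb := (@lebesgue_measure R).
Local Notation phi := (@std_normal_pdf R).
Local Notation gam := (normal_prob (0 : R) 1).

Lemma integral_gaussian_expR (t : R) :
  (\int[gam]_x (expR (t * x))%:E = (expR (t ^+ 2 / 2))%:E)%E.
Proof.
have mt : measurable_fun [set: measurableTypeR R] (fun x => (expR (t * x))%:E).
  apply/measurable_EFinP; apply: measurableT_comp => //; exact: measurable_funM.
rewrite ge0_integral_normal_prob//.
transitivity (\int[leb]_x ((expR (t ^+ 2 / 2))%:E * (normal_pdf t 1 x)%:E))%E.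
  apply: eq_integral => x _; rewrite -!EFinM !normal_pdf_shift subr0 !std_normal_pdfE.
  rewrite !(mulrCA _ (normal_peak 1)) -!expRD; congr (_ * expR _)%:E.
  by field.
rewrite ge0_integralZl//.
- by rewrite integral_normal_pdf mule1.
- by apply/measurable_EFinP; exact: measurable_normal_pdf.
- by move=> x _; rewrite lee_fin normal_pdf_ge0.
Qed.

Lemma integral_gaussian_expR_norm (t : R) : 0 <= t ->
  (\int[gam]_x (expR (t * `|x|))%:E <= (2 * expR (t ^+ 2 / 2))%:E)%E.
Proof.
move=> t0.
have me (s : R) : measurable_fun [set: measurableTypeR R] (fun x => (expR (s * x))%:E).
  apply/measurable_EFinP; apply: measurableT_comp => //; exact: measurable_funM.
apply: (@le_trans _ _ (\int[gam]_x ((expR (t * x))%:E + (expR (- t * x))%:E))%E).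
  apply: ge0_le_integral => //.
  - apply/measurable_EFinP; apply: measurableT_comp => //; apply: measurable_funM => //.
  - by apply: emeasurable_funD; exact: me.
  move=> x _; rewrite -EFinD lee_fin.
  have [x0|x0] := leP 0 x; first by rewrite ger0_norm// lerDl expR_ge0.
  by rewrite ltr0_norm// mulrN mulNr lerDr expR_ge0.
rewrite ge0_integralD//.
- by rewrite !integral_gaussian_expR sqrrN -EFinD lee_fin mulr_natl mulr2n.
Qed.

Lemma gaussian_integrable (f : measurableTypeR R -> R) :
  measurable_fun [set: measurableTypeR R] f -> exp_growth f ->
  gam.-integrable setT (EFin \o f).
Proof.
move=> mf [C [k C0 fC]]; apply/integrableP; split; first exact/measurable_EFinP.
have me : measurable_fun [set: measurableTypeR R] (fun x => (expR (k%:R * `|x|))%:E).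
  by apply/measurable_EFinP; apply: measurableT_comp => //; exact: measurable_funM.
apply: (@le_lt_trans _ _ (\int[gam]_x (C%:E * (expR (k%:R * `|x|))%:E))%E).
  apply: ge0_le_integral => //.
  - by apply: measurableT_comp => //; exact/measurable_EFinP.
  - exact: emeasurable_funM.
  - by move=> x _; rewrite -EFinM lee_fin.
rewrite ge0_integralZl//.
apply: (@le_lt_trans _ _ (C%:E * (2 * expR (k%:R ^+ 2 / 2))%:E)%E); last by rewrite -EFinM ltry.
by rewrite lee_wpmul2l// integral_gaussian_expR_norm.
Qed.

End standard_gaussian.

(** * Stein's identity *)

Section stein.
Context {R : realType}.
Local Notation leb := (@lebesgue_measure R).
Local Notation phi := (@std_normal_pdf R).
Local Notation gam := (normal_prob (0 : R) 1).

Variables f f' : R -> R.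
Hypothesis df : forall x : R, is_derive x (1 : R) f (f' x).
Hypothesis cf' : continuous f'.
Hypotheses (gf : exp_growth f) (gf' : exp_growth f').

Let cf : continuous f.
Proof.
move=> t; apply: differentiable_continuous; apply/derivable1_diffP.
by have [] := df t.
Qed.

Let dphi (x : R) : is_derive x (1 : R) phi (- x * phi x).
Proof.
have := is_derive_std_normal_pdf (0 : R) x; rewrite subr0.
by under [X in is_derive _ _ X _]eq_fun do rewrite subr0.
Qed.

Let cphi : continuous phi.
Proof.
move=> t; apply: differentiable_continuous; apply/derivable1_diffP.
by have [] := dphi t.
Qed.

Let F x := f x * phi x.
Let g x := f' x - x * f x.
Let h x := g x * phi x.

Let dF (x : R) : is_derive x (1 : R) F (h x).
Proof.
have H1 := df x; have H2 := dphi x.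
have H := is_deriveM H1 H2.
apply: is_derive_eq H _.
rewrite /h /g /GRing.scale/=; ring.
Qed.

Let cF : continuous F.
Proof.
move=> t; apply: differentiable_continuous; apply/derivable1_diffP.
by have [] := dF t.
Qed.

Let cg : continuous g.
Proof.
move=> x; apply: cvgB; first exact: cf'.
by apply: cvgM; [exact: cvg_id|exact: cf].
Qed.

Let gg : exp_growth g.
Proof. by apply: exp_growthB => //; apply: exp_growthM => //; exact: exp_growth_id. Qed.

Let mg : measurable_fun [set: measurableTypeR R] g.
Proof. exact: continuous_measurable_fun. Qed.

Let ch : continuous h.
Proof. by move=> x; apply: cvgM; [exact: cg|exact: cphi]. Qed.

Let mh : measurable_fun [set: measurableTypeR R] h.
Proof. exact: continuous_measurable_fun ch. Qed.

Let ih : leb.-integrable setT (EFin \o h).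
Proof.
have /integrableP[_ H] := gaussian_integrable mg gg.
apply/integrableP; split; first exact/measurable_EFinP.
move: H; rewrite ge0_integral_normal_prob//; last first.
  by apply: measurableT_comp => //; exact/measurable_EFinP.
apply: le_lt_trans; rewrite le_eqVlt; apply/orP; left; apply/eqP.
apply: eq_integral => x _; rewrite /= normal_pdf_shift subr0 -EFinM.
by rewrite /h normrM (ger0_norm (ltW (std_normal_pdf_gt0 _))).
Qed.

Let I n : set (measurableTypeR R) := `[(- n.+1%:R), n.+1%:R]%classic.

Let ftc n : (\int[leb]_(x in I n) (h x)%:E)%E = (F n.+1%:R - F (- n.+1%:R))%:E.
Proof.
rewrite /I EFinB; apply: continuous_FTC2.
- by rewrite gtrN.
- exact: continuous_subspaceT.
- split.
  + by move=> x _; have [] := dF x.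
  + by apply: cvg_at_right_filter; exact: cF.
  + by apply: cvg_at_left_filter; exact: cF.
- by move=> x _; rewrite derive1E; have ? := dF x; rewrite derive_val.
Qed.

(** The boundary terms of the integration by parts; any rate of decay would do,
and [1 / |x|] at the integers is the harmonic sequence. *)
Let F_decay : exists C : R, forall x : R, 0 < `|x| -> `|F x| <= C / `|x|.
Proof.
have [C [k C0 fC]] := gf.
(* Completing the square: k|x| - x^2/2 <= K - |x|. *)
pose K : R := (k%:R + 1) ^+ 2 / 2.
exists (C * normal_peak 1 * expR K) => x x0.
rewrite /F normrM (ger0_norm (ltW (std_normal_pdf_gt0 _))) std_normal_pdfE.
apply: (@le_trans _ _ (C * normal_peak 1 * (expR (k%:R * `|x|) * expR (- x ^+ 2 / 2)))).
  rewrite (_ : C * _ * _ = C * expR (k%:R * `|x|) * (normal_peak 1 * expR (- x ^+ 2 / 2))); last by ring.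
  by rewrite ler_wpM2r// mulr_ge0 ?normal_peak_ge0 ?expR_ge0.
rewrite -!mulrA ler_wpM2l// ler_wpM2l ?normal_peak_ge0// -expRD.
apply: (@le_trans _ _ (expR (K - `|x|))).
  rewrite ler_expR -(real_normK (num_real x)) /K.
  have := sqr_ge0 (`|x| - (k%:R + 1)); nra.
rewrite expRD ler_wpM2l ?expR_ge0// expRN lef_pV2 ?posrE ?expR_gt0//.
by apply: le_trans (expR_ge1Dx _); rewrite lerDr.
Qed.

Let F_cvg : (F n.+1%:R - F (- n.+1%:R)) @[n --> \oo] --> (0 : R).
Proof.
have [C FC] := F_decay.
apply: (@norm_cvg0 R R^o).
apply: (@squeeze_cvgr _ _ _ _ (cst 0) (fun n => 2 * C * harmonic n)).
- apply: nearW => n; rewrite normr_ge0/=.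
  apply: le_trans (ler_normB _ _) _.
  have H (x : R) : `|x| = n.+1%:R -> `|F x| <= C * harmonic n.
    by move=> xn; have := FC x; rewrite xn; apply.
  by rewrite -mulrA mulr_natl mulr2n lerD// H ?normrN ?normr_nat.
- exact: cvg_cst.
- rewrite -(mulr0 (2 * C)); apply: cvgM; [exact: cvg_cst|exact: cvg_harmonic].
Qed.

(** The fundamental theorem of calculus on growing intervals. *)
Let stein0 : (\int[leb]_x (h x)%:E = 0)%E.
Proof.
pose h_ n : measurableTypeR R -> \bar R := (EFin \o h) \_ (I n).
have mI n : measurable (I n) by exact: measurable_itv.
have H : (\int[leb]_x h_ n x @[n --> \oo] --> \int[leb]_x (h x)%:E)%E.
  have [] // := @dominated_convergence _ _ _ leb setT measurableT h_ (EFin \o h) (abse \o (EFin \o h)) _ _ _ _ _.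
  - move=> n; apply/(measurable_restrictT _ _).1 => //.
    by apply: measurable_funTS; exact/measurable_EFinP.
  - exact/measurable_EFinP.
  - apply: aeW => x _.
    apply: cvg_near_cst; near=> n.
    rewrite /h_ patchE mem_set//= /I/= in_itv/= -ler_norml.
    apply: le_trans (ltW (truncnS_gt _)) _.
    rewrite ler_nat ltnS; near: n; exact: nbhs_infty_ge.
  - exact: integrable_abse.
  - apply: aeW => x n _; rewrite /h_ patchE; case: ifPn => // _.
    by rewrite /= normr0 lee_fin.
have H0 : (\int[leb]_x h_ n x @[n --> \oo] --> (0 : R)%:E)%E.
  rewrite (_ : (fun n => _) = EFin \o (fun n => F n.+1%:R - F (- n.+1%:R))).
    by apply: cvg_EFin; [exact: nearW|exact: F_cvg].
  by apply/funext => n; rewrite -integral_mkcond ftc.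
exact: cvg_unique H H0.
Unshelve. all: end_near. Qed.

(** Integration by parts: [f' - x f] times the Gaussian density is the
derivative of [f] times this density, which vanishes at infinity. *)
Lemma stein : \int[gam]_x (x * f x) = \int[gam]_x f' x.
Proof.
have mf : measurable_fun [set: measurableTypeR R] f by exact: continuous_measurable_fun.
have mf' : measurable_fun [set: measurableTypeR R] f' by exact: continuous_measurable_fun.
have i1 : gam.-integrable setT (EFin \o f') by exact: gaussian_integrable.
have i2 : gam.-integrable setT (EFin \o (fun x => x * f x)).
  apply: gaussian_integrable; first exact: measurable_funM.
  by apply: exp_growthM => //; exact: exp_growth_id.
apply/esym/eqP; rewrite -subr_eq0 -RintegralB//; apply/eqP.
rewrite /Rintegral integral_normal_prob//.
by rewrite (_ : (\int[_]_x _)%E = \int[leb]_x (h x)%:E)%E ?stein0//; apply: eq_integral => x _; rewrite normal_pdf_shift subr0.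
Qed.

End stein.

(** * Derivatives in Gaussian mean square *)

Section gaussian_interpolation.
Context {R : realType}.
Local Notation gam := (normal_prob (0 : R) 1).
Implicit Types (f g : R -> R).

(** The discriminant argument behind the Cauchy-Schwarz inequality. *)
Lemma sqr_le_of_quadratic (a b c : R) : 0 <= c ->
  (forall t : R, 0 <= a - 2 * t * b + t ^+ 2 * c) -> b ^+ 2 <= a * c.
Proof.
move=> c0 H; have [c00|cpos] := eqVneq c 0.
  have [-> |b0] := eqVneq b 0; first by rewrite c00 expr0n/= mulr0.
  have := H ((a + 1) / (2 * b)); rewrite c00 mulr0 addr0.
  have -> : 2 * ((a + 1) / (2 * b)) * b = a + 1 by field.
  lra.
have {c0 cpos}cp : 0 < c by rewrite lt_def cpos.
have := H (b / c).
have -> : a - 2 * (b / c) * b + (b / c) ^+ 2 * c = (a * c - b ^+ 2) / c.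
  by field; rewrite gt_eqF.
by rewrite pmulr_lge0 ?invr_gt0// subr_ge0.
Qed.

Definition tame f := measurable_fun [set: R] f /\ exp_growth f.

Lemma tame_integrable f : tame f -> gam.-integrable setT (EFin \o f).
Proof. by case=> mf gf; exact: gaussian_integrable. Qed.

Lemma tameM f g : tame f -> tame g -> tame (fun x => f x * g x).
Proof. by move=> [mf gf] [mg gg]; split; [exact: measurable_funM|exact: exp_growthM]. Qed.

Lemma tameD f g : tame f -> tame g -> tame (fun x => f x + g x).
Proof. by move=> [mf gf] [mg gg]; split; [exact: measurable_funD|exact: exp_growthD]. Qed.

Lemma tameB f g : tame f -> tame g -> tame (fun x => f x - g x).
Proof. by move=> [mf gf] [mg gg]; split; [exact: measurable_funB|exact: exp_growthB]. Qed.

Lemma tame_cst (c : R) : tame (fun=> c).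
Proof. by split; [exact: measurable_cst|exact: (@exp_growth_bounded _ _ `|c|)]. Qed.

Lemma tame_id : tame id.
Proof. by split; [exact: measurable_id|exact: exp_growth_id]. Qed.

Lemma gaussD f g : tame f -> tame g ->
  \int[gam]_x (f x + g x) = \int[gam]_x f x + \int[gam]_x g x.
Proof. by move=> /tame_integrable ? /tame_integrable ?; rewrite RintegralD. Qed.

Lemma gaussB f g : tame f -> tame g ->
  \int[gam]_x (f x - g x) = \int[gam]_x f x - \int[gam]_x g x.
Proof. by move=> /tame_integrable ? /tame_integrable ?; rewrite RintegralB. Qed.

Lemma gaussZ (c : R) f : tame f -> \int[gam]_x (c * f x) = c * \int[gam]_x f x.
Proof. by move=> /tame_integrable ?; rewrite RintegralZl. Qed.

Lemma gauss_cauchy_schwarz f g : tame f -> tame g ->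
  (\int[gam]_x (f x * g x)) ^+ 2 <= (\int[gam]_x (f x * f x)) * (\int[gam]_x (g x * g x)).
Proof.
move=> tf tg; apply: sqr_le_of_quadratic => [|t].
  by apply: Rintegral_ge0 => x _; rewrite -expr2 sqr_ge0.
have tfg := tameM tf tg; have tff := tameM tf tf; have tgg := tameM tg tg.
rewrite -!gaussZ// -gaussB//; last by apply: tameM => //; exact: tame_cst.
rewrite -gaussD//; last 2 first.
- by apply: tameB => //; apply: tameM => //; exact: tame_cst.
- by apply: tameM => //; exact: tame_cst.
apply: Rintegral_ge0 => x _.
rewrite (_ : _ + _ = (f x - t * g x) ^+ 2) ?sqr_ge0//; ring.
Qed.

Variables (g : nat -> R -> R) (S : nat -> R).
Hypothesis gJ : jet g.
Hypothesis gS : forall j x, `|g j x| <= S j.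

Let tg j : tame (g j).
Proof.
split; first exact: jet_measurable.
exact: exp_growth_bounded (gS j).
Qed.

Let B j := \int[gam]_x (g j x * g j x).

Let B_ge0 j : 0 <= B j.
Proof. by apply: Rintegral_ge0 => x _; rewrite -expr2 sqr_ge0. Qed.

Let B_le j : B j <= S j ^+ 2.
Proof.
have S0 : 0 <= S j by apply: le_trans (gS j 0).
rewrite (_ : S j ^+ 2 = \int[gam]_x (S j ^+ 2)); last first.
  by rewrite Rintegral_cst//= probability_setT/= mulr1.
apply: le_Rintegral => //.
- by apply: tame_integrable; exact: tameM.
- by apply: tame_integrable; exact: tame_cst.
- by move=> x _; rewrite -expr2 -real_normK ?num_real// lerXn2r.
Qed.

(** With [N f = x f' - f''], the Ornstein-Uhlenbeck operator, Stein's identity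
says that the mean of [f * N f] is that of [f'^2] and that the mean of
[(N f)^2] is that of [f'^2 + f''^2]. The inequality is then Cauchy-Schwarz for
[f] and [N f], with [f] the derivative of order [j]. *)
Let B_logconvex j : B j.+1 ^+ 2 <= B j * (B j.+1 + B j.+2).
Proof.
have c_ i : continuous (g i) by exact: jet_continuous.
pose N x := x * g j.+1 x - g j.+2 x.
have tN : tame N by apply: tameB => //; apply: tameM => //; exact: tame_id.
have t_ a b := tameM (tg a) (tg b).
have tx a b : tame (fun x => x * (g a x * g b x)) by apply: tameM => //; exact: tame_id.
have E1 : \int[gam]_x (g j x * N x) = B j.+1.
  have d (x : R) : is_derive x (1 : R) (fun x => g j x * g j.+1 x) (g j.+1 x * g j.+1 x + g j x * g j.+2 x).
    have H := is_deriveM (gJ j x) (gJ j.+1 x).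
    apply: is_derive_eq H _; rewrite /GRing.scale/=; ring.
  have cd : continuous (fun x => g j.+1 x * g j.+1 x + g j x * g j.+2 x).
    by move=> x; apply: cvgD; apply: cvgM; exact: c_.
  have := stein d cd (t_ _ _).2 (tameD (t_ _ _) (t_ _ _)).2.
  rewrite gaussD// => H.
  transitivity (\int[gam]_x (x * (g j x * g j.+1 x) - g j x * g j.+2 x)).
    by apply: eq_Rintegral => x _; rewrite /N; ring.
  by rewrite gaussB// H addrK.
have E2 : \int[gam]_x (N x * N x) = B j.+1 + B j.+2.
  have d (x : R) : is_derive x (1 : R) (fun x => x * (g j.+1 x * g j.+1 x))
      (g j.+1 x * g j.+1 x + 2 * (x * (g j.+1 x * g j.+2 x))).
    have H := is_deriveM (is_derive_id x (1 : R)) (is_deriveM (gJ j.+1 x) (gJ j.+1 x)).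
    apply: is_derive_eq H _; rewrite /GRing.scale/= !fctE; ring.
  have cd : continuous (fun x => g j.+1 x * g j.+1 x + 2 * (x * (g j.+1 x * g j.+2 x))).
    move=> x; apply: cvgD; first by apply: cvgM; exact: c_.
    by apply: cvgM; [exact: cvg_cst|apply: cvgM; [exact: cvg_id|apply: cvgM; exact: c_]].
  have t2 : tame (fun x => 2 * (x * (g j.+1 x * g j.+2 x))) by apply: tameM => //; exact: tame_cst.
  have := stein d cd (tx _ _).2 (tameD (t_ _ _) t2).2.
  rewrite gaussD// => H.
  transitivity (\int[gam]_x (x * (x * (g j.+1 x * g j.+1 x)) - 2 * (x * (g j.+1 x * g j.+2 x))
      + g j.+2 x * g j.+2 x)).
    by apply: eq_Rintegral => x _; rewrite /N; ring.
  rewrite gaussD//; last first.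
    by apply: tameB => //; apply: tameM => //; exact: tame_id.
  rewrite gaussB//; last by apply: tameM => //; exact: tame_id.
  by rewrite H addrK.
by have := gauss_cauchy_schwarz (tg j) tN; rewrite E1 E2.
Qed.

(** If [B 1] exceeded [K * B 0] then log-convexity would force each [B j.+1] to
exceed [(K - j) * B j], hence [(K / 2) * B j] for [j <= J], so that [B 1] would
be at most [B J.+1 * (2 / K)^J]; the factor shrinks by one at each step because
of the extra term [B j.+1] in [B_logconvex]. *)
Lemma gauss_derivative_interpolation (J : nat) (K : R) : 0 < K -> 2 * J.+1%:R <= K ->
  B 1 <= K * B 0 + S J.+1 ^+ 2 * (2 / K) ^+ J.
Proof.
move=> K0 JK.
have r0 j : 0 <= S J.+1 ^+ 2 * (2 / K) ^+ j by rewrite mulr_ge0 ?sqr_ge0 ?exprn_ge0 ?divr_ge0 ?ltW.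
have [//|KB] := leP (B 1) (K * B 0); first by move/le_trans; apply; rewrite lerDl.
apply: (@le_trans _ _ (S J.+1 ^+ 2 * (2 / K) ^+ J)); last first.
  by rewrite lerDr mulr_ge0 ?(ltW K0).
have step j : (j <= J)%N -> (K - j%:R) * B j < B j.+1.
  elim: j => [|j IH] jJ; first by rewrite subr0.
  have {}IH := IH (ltnW jJ).
  have KJ : K / 2 <= K - j.+1%:R.
    have : (j.+1%:R : R) <= J.+1%:R by rewrite ler_nat ltnW.
    lra.
  have KJ' : K - j%:R = K - j.+1%:R + 1 by rewrite -(natr1 j); ring.
  have Bj := B_ge0 j; have B1 : 0 < B j.+1.
    apply: le_lt_trans IH; rewrite mulr_ge0//; lra.
  have := B_logconvex j; have B2 := B_ge0 j.+2.
  nra.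
have down j : (j <= J)%N -> B 1 * (K / 2) ^+ j <= B j.+1.
  elim: j => [|j IH] jJ; first by rewrite expr0 mulr1.
  apply: le_trans (ltW (step j.+1 jJ)).
  have {}IH := IH (ltnW jJ).
  rewrite exprS mulrCA ler_pM//; [lra|by rewrite mulr_ge0 ?exprn_ge0//; lra|].
  have : (j.+1%:R : R) <= J.+1%:R by rewrite ler_nat ltnW.
  lra.
rewrite -ler_pdivrMr ?exprn_gt0 ?divr_gt0// -exprVn invf_div.
by apply: le_trans (down J (leqnn J)) (B_le _).
Qed.

End gaussian_interpolation.

(** * Posterior moments and cumulants *)

Section supported.
Context {R : realType} (M : R) (G : law R).
Hypothesis GM : supported_in M G.
Local Notation I := [set` `[- M, M]].

Lemma supported_setC : G (~` I) = 0%E.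
Proof.
rewrite probability_setC; last exact: measurable_itv.
by rewrite GM subee.
Qed.

Lemma supported_integrable (g : R -> R) (C : R) :
  measurable_fun [set: R] g -> (forall x, `|x| <= M -> `|g x| <= C) ->
  G.-integrable setT (EFin \o g).
Proof.
move=> mg gC.
have mI : measurable (I : set (measurableTypeR R)) by exact: measurable_itv.
apply/(negligible_integrable (measurableC mI) measurableT _ supported_setC).
  exact/measurable_EFinP.
rewrite setDE setTI setCK.
apply: (@le_integrable _ _ _ G _ mI _ (EFin \o cst C)) => //.
- exact/measurable_EFinP/measurable_funTS.
- move=> x /=; rewrite in_itv/= => xM.
  rewrite lee_fin; apply: le_trans (ler_norm _); apply: gC.
  by rewrite ler_norml.
- exact: finite_measure_integrable_cst.
Qed.

Lemma supported_Rintegral (g : R -> R) (C : R) :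
  measurable_fun [set: R] g -> (forall x, `|x| <= M -> `|g x| <= C) ->
  \int[G]_x g x = \int[G]_(x in I) g x.
Proof.
move=> mg gC.
have mI : measurable (I : set (measurableTypeR R)) by exact: measurable_itv.
rewrite /Rintegral (negligible_integral (measurableC mI) measurableT _ supported_setC).
  by rewrite setDE setTI setCK.
exact: supported_integrable gC.
Qed.

Lemma supported_le_Rintegral (f g : R -> R) (C : R) :
  measurable_fun [set: R] f -> measurable_fun [set: R] g ->
  (forall x, `|x| <= M -> `|f x| <= C) -> (forall x, `|x| <= M -> `|g x| <= C) ->
  (forall x, `|x| <= M -> f x <= g x) ->
  \int[G]_x f x <= \int[G]_x g x.
Proof.
move=> mf mg fC gC fg.
have mI : measurable (I : set (measurableTypeR R)) by exact: measurable_itv.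
rewrite (supported_Rintegral mf fC) (supported_Rintegral mg gC).
apply: le_Rintegral => //.
- by apply: integrableS (supported_integrable mf fC).
- by apply: integrableS (supported_integrable mg gC).
- by move=> x; rewrite /= in_itv/= -ler_norml => /fg.
Qed.

Lemma supported_norm_Rintegral_le (f g : R -> R) (C : R) :
  measurable_fun [set: R] f -> measurable_fun [set: R] g ->
  (forall x, `|x| <= M -> `|f x| <= g x) -> (forall x, `|x| <= M -> g x <= C) ->
  `|\int[G]_x f x| <= \int[G]_x g x.
Proof.
move=> mf mg fg gC.
have fC x : `|x| <= M -> `|f x| <= C by move=> xM; apply: le_trans (fg _ xM) (gC _ xM).
have g0 x : `|x| <= M -> `|g x| <= C.
  by move=> xM; rewrite ger0_norm ?gC// (le_trans _ (fg _ xM)).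
apply: le_trans (le_normr_Rintegral measurableT (supported_integrable mf fC)) _.
apply: supported_le_Rintegral (C) _ _ _ _ _ => //.
- exact: measurableT_comp.
- by move=> x xM; rewrite normr_id fC.
Qed.

End supported.

Section posterior_moments.
Context {R : realType} (M : R) (G : law R).
Hypothesis GM : supported_in M G.
Local Notation phi := (@std_normal_pdf R).
Implicit Types (k : nat) (z m : R).

(** The numerator of the posterior moment of order [k] in Bayes' rule; for
[k = 0] it is the mixture density. *)
Definition moment_pdf (H : law R) k z : R := \int[H]_m (m ^+ k * phi (z - m)).

Lemma measurable_moment_integrand k z :
  measurable_fun [set: R] (fun m => m ^+ k * phi (z - m)).
Proof.
apply: measurable_funM; first exact: measurable_funX.
apply: measurableT_comp; first exact: measurable_std_normal_pdf.
exact: measurable_funB.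
Qed.

Lemma moment_integrand_bound k z m : `|m| <= M ->
  `|m ^+ k * phi (z - m)| <= M ^+ k * phi (z - m).
Proof.
move=> mM; rewrite normrM normrX (ger0_norm (ltW (std_normal_pdf_gt0 _))).
by rewrite ler_wpM2r ?(ltW (std_normal_pdf_gt0 _))// lerXn2r// nnegrE (le_trans _ mM).
Qed.

Lemma pow_mul_pdf_le_peak k z m : 0 <= M ->
  M ^+ k * phi (z - m) <= M ^+ k * normal_peak 1.
Proof. by move=> M0; rewrite ler_wpM2l ?exprn_ge0// std_normal_pdf_le. Qed.

Lemma mixture_pdfE z : mixture_pdf G z = moment_pdf G 0 z.
Proof. by apply: eq_Rintegral => m _; rewrite expr0 mul1r. Qed.

Hypothesis M_ge0 : 0 <= M.

Lemma moment_pdf_integrable k z :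
  G.-integrable setT (EFin \o (fun m => m ^+ k * phi (z - m))).
Proof.
apply: (supported_integrable GM (C := M ^+ k * normal_peak 1)).
  exact: measurable_moment_integrand.
move=> m mM; apply: le_trans (moment_integrand_bound _ _ mM) _.
exact: pow_mul_pdf_le_peak.
Qed.

Lemma norm_moment_pdf_le k z : `|moment_pdf G k z| <= M ^+ k * moment_pdf G 0 z.
Proof.
rewrite /moment_pdf -RintegralZl//; last exact: moment_pdf_integrable.
apply: (supported_norm_Rintegral_le GM (C := M ^+ k * normal_peak 1)).
- exact: measurable_moment_integrand.
- apply: measurable_funM => //; exact: measurable_moment_integrand.
- by move=> m mM; rewrite expr0 mul1r moment_integrand_bound.
- by move=> m mM; rewrite expr0 mul1r pow_mul_pdf_le_peak.
Qed.

(** On the support the integrand is at least its value at the point farthest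
from [z], at distance at most [|z| + M]. *)
Lemma moment_pdf0_gt0 z : 0 < moment_pdf G 0 z.
Proof.
pose b := normal_peak 1 * expR (- ((`|z| + M) ^+ 2) / 2) : R.
have b0 : 0 < b by rewrite mulr_gt0 ?expR_gt0// normal_peak_gt0 ?oner_neq0.
apply: lt_le_trans b0 _.
have -> : b = \int[G]_m b.
  by rewrite Rintegral_cst//= probability_setT /= mulr1.
apply: (supported_le_Rintegral GM (C := normal_peak 1)) => //.
- exact: measurable_moment_integrand.
- move=> m mM; rewrite ger0_norm; last by rewrite mulr_ge0 ?expR_ge0 ?normal_peak_ge0.
  rewrite ler_piMr ?normal_peak_ge0// -expR0 ler_expR.
  by rewrite mulNr oppr_le0 divr_ge0// sqr_ge0.
- move=> m mM; apply: le_trans (moment_integrand_bound 0 _ mM) _.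
  by rewrite expr0 mul1r std_normal_pdf_le.
- move=> m mM; rewrite expr0 mul1r std_normal_pdfE ler_wpM2l ?normal_peak_ge0//.
  rewrite ler_expR !mulNr lerN2 ler_wpM2r// -real_normK ?num_real//.
  rewrite lerXn2r// ?nnegrE//; first by rewrite addr_ge0.
  by apply: le_trans (ler_normB _ _) _; rewrite lerD2l.
Qed.

(** The Gaussian density satisfies [phi' x = - x * phi x]; differentiation under
the integral is licit because [|x| * phi x] is bounded. *)
Lemma is_derive_moment_pdf k z :
  is_derive z 1 (moment_pdf G k) (moment_pdf G k.+1 z - z * moment_pdf G k z).
Proof.
set I := [set` `[- M, M]].
have mI : measurable (I : set (measurableTypeR R)) by exact: measurable_itv.
have bnd k' z' m : `|m| <= M -> `|m ^+ k' * phi (z' - m)| <= M ^+ k' * normal_peak 1.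
  by move=> mM; apply: le_trans (moment_integrand_bound _ _ mM) _; exact: pow_mul_pdf_le_peak.
have momE k' : moment_pdf G k' = fun z => \int[G]_(m in I) (m ^+ k' * phi (z - m)).
  apply/funext => t; apply: (supported_Rintegral GM (measurable_moment_integrand _ _)) => m; exact: bnd.
have dphi (t m : R) : is_derive t (1:R) (fun t => m ^+ k * phi (t - m)) (m ^+ k * (- (t - m) * phi (t - m))).
  have := is_derive_std_normal_pdf m t => H.
  apply: is_derive_eq.
  by [].
have zI : `]z - 1, z + 1[%classic z by rewrite /= in_itv/= ltrBlDr ltrDl ltr01.
have intF : forall t, `]z - 1, z + 1[%classic t -> G.-integrable I (EFin \o (fun m => m ^+ k * phi (t - m))).
  by move=> t _; apply: integrableS (moment_pdf_integrable k t).
have derF : forall t m, `]z - 1, z + 1[%classic t -> I m -> derivable (fun t => m ^+ k * phi (t - m)) t 1.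
  by move=> t m _ _; have [] := dphi t m.
have d1E t m : partial1of2 (fun t m => m ^+ k * phi (t - m)) t m = m ^+ k * (- (t - m) * phi (t - m)).
  by rewrite partial1of2E; have ? := dphi t m; exact: derive_val.
have Gub : forall t m, `]z - 1, z + 1[%classic t -> I m -> `|partial1of2 (fun t m => m ^+ k * phi (t - m)) t m| <= M ^+ k * normal_peak 1.
  move=> t m _; rewrite /I/= in_itv/= -ler_norml => mM.
  rewrite d1E !normrM normrX normrN ler_pM// ?exprn_ge0//.
    by rewrite lerXn2r// nnegrE (le_trans _ mM).
  by rewrite (ger0_norm (ltW (std_normal_pdf_gt0 _))) norm_mul_std_normal_pdf_le.
have intC : G.-integrable I (EFin \o (fun _ : R => M ^+ k * normal_peak 1)).
  exact: finite_measure_integrable_cst.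
have Gge0 : forall m : R, 0 <= M ^+ k * normal_peak 1.
  by move=> _; rewrite mulr_ge0 ?exprn_ge0 ?normal_peak_ge0.
have D1 := derivable_under_integral mI zI intF derF Gge0 intC Gub.
have D2 := differentiation_under_integral mI zI intF derF Gge0 intC Gub.
rewrite momE; apply: DeriveDef; first exact: D1.
rewrite -derive1E D2.
transitivity (\int[G]_(m in I) (m ^+ k.+1 * phi (z - m) - z * (m ^+ k * phi (z - m)))).
  apply: eq_Rintegral => m _; rewrite d1E exprS; ring.
rewrite RintegralB//.
- rewrite RintegralZl//.
    by rewrite !momE.
  by apply: integrableS (moment_pdf_integrable k z).
- by apply: integrableS (moment_pdf_integrable k.+1 z).
- rewrite (_ : EFin \o _ = fun m => (z%:E * (m ^+ k * phi (z - m))%:E)%E)//.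
  apply: integrableZl => //.
  by apply: integrableS (moment_pdf_integrable k z).
Qed.

End posterior_moments.

Section posterior_cumulants.
Context {R : realType} (M : R) (G : law R).
Hypotheses (GM : supported_in M G) (M_ge0 : 0 <= M).
Implicit Types (j k : nat) (z : R).

Definition post_moment (H : law R) k z : R := moment_pdf H k z / moment_pdf H 0 z.

(** The posterior laws form an exponential family with natural parameter [z], so
the derivatives of the posterior mean are the posterior cumulants:
[post_cumulant H j] is the cumulant of order [j + 1]. *)
Definition post_cumulant (H : law R) j : R -> R := derive1n j (post_moment H 1).
Arguments post_cumulant : simpl never.

Local Notation m_ := (post_moment G).
Local Notation U_ := (post_cumulant G).

Lemma norm_post_moment_le k z : `|m_ k z| <= M ^+ k.
Proof.
have F0 := moment_pdf0_gt0 GM M_ge0 z.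
rewrite normrM normfV (gtr0_norm F0) ler_pdivrMr//.
exact: norm_moment_pdf_le.
Qed.

Lemma is_derive_post_moment k z :
  is_derive z 1 (m_ k) (m_ k.+1 z - m_ 1 z * m_ k z).
Proof.
have F0 := moment_pdf0_gt0 GM M_ge0 z.
have H0 := is_derive_moment_pdf GM M_ge0 0 z.
have Hk := is_derive_moment_pdf GM M_ge0 k z.
have HV := is_deriveV (lt0r_neq0 F0) H0.
rewrite [X in is_derive _ _ X _](_ : _ = moment_pdf G k * (fun t => (moment_pdf G 0 t)^-1)); last exact/funext.
apply: is_derive_eq.
rewrite /post_moment /GRing.scale/=.
by field; rewrite lt0r_neq0.
Qed.

Lemma post_cumulantS j : U_ j.+1 = derive1 (U_ j).
Proof. exact: derive1nS. Qed.

(** The recursion between moments and cumulants. Derivability of the cumulant of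
order [j] is read off from it, so the two are proved together. *)
Let cumulE j := forall z,
  U_ j z = m_ j.+1 z - \sum_(i < j) ('C(j, i))%:R * U_ i z * m_ (j - i) z.

Let cumul_derivable j : (forall i, (i < j)%N -> forall z, derivable (U_ i) z 1) ->
  cumulE j -> forall z,
  is_derive z 1 (U_ j) (m_ j.+2 z - m_ 1 z * m_ j.+1 z -
    \sum_(i < j) ('C(j, i))%:R * (U_ i.+1 z * m_ (j - i) z +
        U_ i z * (m_ (j - i).+1 z - m_ 1 z * m_ (j - i) z))).
Proof.
move=> dU Ej z.
have -> : U_ j = m_ j.+1 - \sum_(i < j) (fun t => ('C(j, i))%:R * U_ i t * m_ (j - i) t).
  by apply/funext => t; rewrite Ej; congr (_ - _); rewrite fct_sumE.
apply: is_deriveB; first exact: is_derive_post_moment.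
apply: is_derive_sum => i.
have Hm := is_derive_post_moment (j - i) z.
have HU : is_derive z 1 (U_ i) (U_ i.+1 z).
  by apply: DeriveDef; [exact: dU|rewrite post_cumulantS derive1E].
apply: is_derive_eq; rewrite /GRing.scale/=; ring.
Qed.

(** Differentiating the recursion gives the next one, by Pascal's rule. *)
Let pascal_sum j z : cumulE j ->
  m_ j.+2 z - m_ 1 z * m_ j.+1 z -
    \sum_(i < j) ('C(j, i))%:R * (U_ i.+1 z * m_ (j - i) z +
        U_ i z * (m_ (j - i).+1 z - m_ 1 z * m_ (j - i) z)) =
  m_ j.+2 z - \sum_(i < j.+1) ('C(j.+1, i))%:R * U_ i z * m_ (j.+1 - i) z.
Proof.
move=> Ej.
have -> : m_ 1 z * m_ j.+1 z = m_ 1 z * U_ j z +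
    m_ 1 z * \sum_(i < j) ('C(j, i))%:R * U_ i z * m_ (j - i) z.
  by rewrite -mulrDr Ej subrK.
rewrite mulr_sumr -[LHS]addrA; congr (_ + _).
rewrite -opprD; congr (- _).
rewrite -addrA -big_split/=.
transitivity (m_ 1 z * U_ j z + \sum_(i < j) ('C(j, i)%:R * U_ i.+1 z * m_ (j - i) z
     + 'C(j, i)%:R * U_ i z * m_ (j - i).+1 z)).
  by congr (_ + _); apply: eq_bigr => i _; ring.
rewrite big_split/= addrCA.
have -> : \sum_(i < j.+1) ('C(j.+1, i))%:R * U_ i z * m_ (j.+1 - i) z =
  \sum_(i < j) ('C(j, i))%:R * U_ i.+1 z * m_ (j - i) z +
  \sum_(i < j.+1) ('C(j, i))%:R * U_ i z * m_ (j.+1 - i) z.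
  rewrite big_ord_recl [X in _ = _ + X]big_ord_recl !bin0 addrCA; congr (_ + _).
  rewrite -big_split/=; apply: eq_bigr => i _.
  by rewrite /bump/= add1n binS natrD subSS; ring.
congr (_ + _).
rewrite big_ord_recr/= binn mul1r subSnn mulrC addrC; congr (_ + _).
by apply: eq_bigr => i _; rewrite subSn// ltnW.
Qed.

Let cumul_all j : (forall z, derivable (U_ j) z 1) /\ cumulE j.
Proof.
elim/ltn_ind: j => j IH.
suff Ej : cumulE j.
  split => // z.
  have [] // := @cumul_derivable j _ Ej z.
  by move=> i ij; have [] := IH _ ij.
case: j IH => [|j] IH z.
  by rewrite big_ord0 subr0.
have [dj Ej] := IH j (ltnSn j).
rewrite -pascal_sum// post_cumulantS derive1E.
have H : forall i, (i < j)%N -> forall z, derivable (U_ i) z 1.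
  by move=> i ij; have [] := IH _ (ltnW ij : (i < j.+1)%N).
have K := cumul_derivable H Ej z.
exact: derive_val.
Qed.

Lemma is_derive_post_cumulant j z : is_derive z 1 (U_ j) (U_ j.+1 z).
Proof.
apply: DeriveDef; first by have [] := cumul_all j.
by rewrite post_cumulantS derive1E.
Qed.

Lemma post_cumulantE j z :
  U_ j z = m_ j.+1 z - \sum_(i < j) ('C(j, i))%:R * U_ i z * m_ (j - i) z.
Proof. by have [_] := cumul_all j. Qed.

(** Induction along the recursion: relative to the target, the moment
contributes at most [4^-j] and the sum at most the geometric series
[\sum_(i < j) 4^-(j - i)], which is [(1 - 4^-j) / 3]. The posterior mean is
therefore analytic with a radius of convergence that depends on [M] only. *)
Lemma norm_post_cumulant_le (A : R) j z : 4 * M <= A ->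
  `|U_ j z| <= M * j`!%:R * A ^+ j.
Proof.
move=> MA; elim/ltn_ind: j => j IH.
have A0 : 0 <= A by apply: le_trans MA; rewrite mulr_ge0.
have MA4 : M <= A / 4 by rewrite ler_pdivlMr// mulrC.
rewrite post_cumulantE; apply: le_trans (ler_normB _ _) _.
have geom : \sum_(i < j) (4^-1 : R) ^+ (j - i) = (1 - 4^-1 ^+ j) / 3.
  elim: j {IH} => [|j IHj]; first by rewrite big_ord0 expr0 subrr mul0r.
  rewrite big_ord_recr/= subSnn.
  under eq_bigr => i _ do rewrite subSn ?(ltnW (ltn_ord i))// exprS.
  by rewrite -mulr_sumr IHj [in RHS]exprS expr1; field.
have Mpow k : M ^+ k <= A ^+ k * 4^-1 ^+ k.
  by rewrite -exprMn lerXn2r// nnegrE// divr_ge0.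
have le1 : `|m_ j.+1 z| <= M * j`!%:R * A ^+ j * 4^-1 ^+ j.
  apply: le_trans (norm_post_moment_le _ _) _.
  rewrite exprS -!mulrA ler_wpM2l//.
  apply: le_trans (Mpow j) _.
  by rewrite ler_peMl ?mulr_ge0 ?exprn_ge0// ler1n fact_gt0.
have le2 : `|\sum_(i < j) ('C(j, i))%:R * U_ i z * m_ (j - i) z| <=
   M * j`!%:R * A ^+ j * \sum_(i < j) (4^-1 : R) ^+ (j - i).
  rewrite mulr_sumr; apply: le_trans (ler_norm_sum _ _ _) _.
  apply: ler_sum => i _; rewrite normrM [X in X * _]normrM (ger0_norm (ler0n _ _)).
  apply: (@le_trans _ _ ('C(j, i)%:R * (M * i`!%:R * A ^+ i) * (A ^+ (j - i) * 4^-1 ^+ (j - i)))).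
    rewrite ler_pM ?mulr_ge0//; first by rewrite ler_wpM2l ?IH.
    by apply: le_trans (norm_post_moment_le _ _) (Mpow _).
  have -> : 'C(j, i)%:R * (M * i`!%:R * A ^+ i) * (A ^+ (j - i) * 4^-1 ^+ (j - i)) =
     M * ('C(j, i) * i`!)%:R * A ^+ j * 4^-1 ^+ (j - i).
    have -> : A ^+ j = A ^+ i * A ^+ (j - i) by rewrite -exprD subnKC// ltnW.
    by rewrite natrM; ring.
  rewrite ler_wpM2r ?exprn_ge0// ler_wpM2r ?exprn_ge0// ler_wpM2l//.
  by rewrite ler_nat -(bin_fact (ltnW (ltn_ord i))) mulnA leq_pmulr// fact_gt0.
apply: le_trans (lerD le1 le2) _.
rewrite geom -mulrDr ler_piMr ?mulr_ge0 ?exprn_ge0//.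
have : (4^-1 : R) ^+ j <= 1 by rewrite exprn_ile1//; lra.
lra.
Qed.

Lemma scoreE z : score G z = U_ 0 z - z.
Proof.
rewrite /score derive1E.
have F0 := moment_pdf0_gt0 GM M_ge0 z.
have H0 := is_derive_moment_pdf GM M_ge0 0 z.
have H1 := is_derive1_ln F0.
rewrite (_ : (fun _ => _) = @ln R \o moment_pdf G 0); last first.
  by apply/funext => t /=; rewrite mixture_pdfE.
have H := is_derive1_comp H1 H0.
rewrite derive_val /GRing.scale/= /post_cumulant derive1n0 /post_moment.
by field; rewrite lt0r_neq0.
Qed.

Lemma derive1_scoreE z : derive1 (score G) z = U_ 1 z - 1.
Proof.
rewrite (_ : score G = U_ 0 - id); last by apply/funext => t; exact: scoreE.
have H := is_derive_post_cumulant 0 z.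
by rewrite derive1E derive_val.
Qed.

Lemma posterior_meanE z : posterior_mean G z = U_ 0 z.
Proof.
by rewrite /posterior_mean mixture_pdfE.
Qed.

End posterior_cumulants.

(** * The joint law of signal and noise *)

Section joint_law.
Context {R : realType} (M : R) (G : law R).
Hypotheses (GM : supported_in M G) (M_ge0 : 0 <= M).
Local Notation RT := (measurableTypeR R).
Local Notation gam := (normal_prob (0 : R) 1).
Local Notation I := [set` `[- M, M]].

(** The observation is the sum of the two coordinates, which are independent.
This form keeps the noise available as a variable, for Stein's identity. *)
Definition joint_law : {measure set (RT * RT) -> \bar R} := (G \x gam)%E.
Local Notation jl := joint_law.

(** Growth is restricted to signals in the support, since the signal itself is
an unbounded function of the pair. *)
Definition jtame (h : RT * RT -> R) := measurable_fun [set: RT * RT] h /\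
  exists C : R, exists2 k : nat, 0 <= C &
  forall m x, `|m| <= M -> `|h (m, x)| <= C * expR (k%:R * `|x|).

Lemma jtame_tame h m : jtame h -> `|m| <= M -> tame (fun x => h (m, x)).
Proof.
move=> [mh [C [k C0 hC]]] mM; split; last by exists C, k => // x; exact: hC.
by apply: (measurableT_comp mh); exact: measurable_pair1.
Qed.

Lemma jtameM f g : jtame f -> jtame g -> jtame (fun w => f w * g w).
Proof.
move=> [mf [C [k C0 fC]]] [mg [D [l D0 gD]]]; split; first exact: measurable_funM.
exists (C * D), (k + l)%N; first exact: mulr_ge0.
by move=> m x mM; rewrite normrM natrD mulrDl expRD mulrACA ler_pM ?fC ?gD.
Qed.

Lemma jtameD f g : jtame f -> jtame g -> jtame (fun w => f w + g w).
Proof.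
move=> [mf [C [k C0 fC]]] [mg [D [l D0 gD]]]; split; first exact: measurable_funD.
exists (C + D), (k + l)%N; first exact: addr_ge0.
move=> m x mM; apply: le_trans (ler_normD _ _) _; rewrite mulrDl.
apply: lerD; first apply: le_trans (fC m x mM) _; last apply: le_trans (gD m x mM) _;
  by rewrite ler_wpM2l// ler_expR ler_wpM2r// ler_nat ?leq_addr ?leq_addl.
Qed.

Lemma jtame_bounded (h : RT * RT -> R) C : measurable_fun [set: RT * RT] h ->
  (forall w, `|h w| <= C) -> jtame h.
Proof.
move=> mh hC; split => //; exists C, 0%N; first by apply: le_trans (hC (0, 0)).
by move=> m x _; rewrite mul0r expR0 mulr1.
Qed.

Lemma jtame_cst (c : R) : jtame (fun=> c).
Proof. by apply: (@jtame_bounded _ `|c|) => //; exact: measurable_cst. Qed.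

Lemma jtame_snd : jtame snd.
Proof.
split; first exact: measurable_snd.
exists 1, 1%N => // m x _; rewrite !mul1r; apply: le_trans (expR_ge1Dx _).
by rewrite lerDr.
Qed.

Lemma jtame_fst : jtame fst.
Proof.
split; first exact: measurable_fst.
by exists M, 0%N => // m x mM; rewrite mul0r expR0 mulr1.
Qed.

Lemma jtameN f : jtame f -> jtame (fun w => - f w).
Proof.
move=> [mf [C [k C0 fC]]]; split; first exact: measurable_funN.
by exists C, k => // m x mM; rewrite normrN fC.
Qed.

Lemma jtameB f g : jtame f -> jtame g -> jtame (fun w => f w - g w).
Proof. by move=> tf tg; apply: jtameD => //; exact: jtameN. Qed.

Let mI : measurable (I : set RT). Proof. exact: measurable_itv. Qed.

Let jtame_bound h : jtame h -> exists C : R, 0 <= C /\ forall m, `|m| <= M ->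
  (\int[gam]_x `|(h (m, x))%:E| <= C%:E)%E.
Proof.
move=> [mh [C [k C0 hC]]]; exists (C * (2 * expR (k%:R ^+ 2 / 2))).
split; first by rewrite !mulr_ge0 ?expR_ge0.
move=> m mM.
have me : measurable_fun [set: RT] (fun x => (expR (k%:R * `|x|))%:E).
  by apply/measurable_EFinP; apply: measurableT_comp => //; exact: measurable_funM.
apply: (@le_trans _ _ (\int[gam]_x (C%:E * (expR (k%:R * `|x|))%:E))%E).
  apply: ge0_le_integral => //.
  - apply: measurableT_comp => //; apply/measurable_EFinP.
    by apply: (measurableT_comp mh); exact: measurable_pair1.
  - exact: emeasurable_funM.
  - by move=> x _; rewrite -EFinM lee_fin hC.
rewrite ge0_integralZl// EFinM.
by rewrite lee_wpmul2l// integral_gaussian_expR_norm.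
Qed.

Lemma jtame_integrable h : jtame h -> jl.-integrable setT (EFin \o h).
Proof.
move=> th; have [mh _] := th; have [C [C0 hC]] := jtame_bound th.
have meh : measurable_fun [set: RT * RT] (EFin \o h) by exact/measurable_EFinP.
apply/(@integrable12ltyP _ _ _ _ _ G gam) => //.
rewrite (ge0_negligible_integral (measurableC mI) measurableT _ _ (supported_setC GM))//; last 2 first.
- apply: (measurable_fun_fubini_tonelli_F (abse \o (EFin \o h))) => //=.
  exact: measurableT_comp.
- by move=> m _; apply: integral_ge0.
rewrite setDE setTI setCK.
apply: (@le_lt_trans _ _ (\int[G]_(m in I) C%:E)%E).
  apply: ge0_le_integral => //.
  - by move=> m _; apply: integral_ge0.
  - apply: measurable_funTS.
    apply: (measurable_fun_fubini_tonelli_F (abse \o (EFin \o h))) => //=.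
    exact: measurableT_comp.
  - by move=> m; rewrite /= in_itv/= -ler_norml => /hC.
by rewrite integral_cst//= GM mule1 ltry.
Qed.

Let fineE h m : jtame h -> `|m| <= M ->
  (\int[gam]_x (h (m, x))%:E)%E = (\int[gam]_x h (m, x))%:E.
Proof.
move=> th mM; rewrite /Rintegral fineK//.
by apply: integrable_fin_num => //; apply: tame_integrable; exact: jtame_tame.
Qed.

Lemma measurable_gauss_section h : jtame h ->
  measurable_fun [set: RT] (fun m => \int[gam]_x h (m, x)).
Proof.
move=> th; have ih := jtame_integrable th.
exact: (measurableT_comp (@fine_measurable R setT measurableT) (measurable_fubini_F ih)).
Qed.

Lemma gauss_section_bound h : jtame h ->
  exists C : R, forall m, `|m| <= M -> `|\int[gam]_x h (m, x)| <= C.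
Proof.
move=> th; have [C [C0 hC]] := jtame_bound th; exists C => m mM.
have ih : gam.-integrable setT (EFin \o (fun x => h (m, x))).
  by apply: tame_integrable; exact: jtame_tame.
rewrite -lee_fin; apply: le_trans (hC _ mM).
by rewrite EFin_normr_Rintegral//; apply: le_abse_integral => //; exact: (measurable_int gam).
Qed.

Lemma joint_iterated h : jtame h ->
  \int[jl]_w h w = \int[G]_m \int[gam]_x h (m, x).
Proof.
move=> th; have ih := jtame_integrable th.
rewrite {1}/Rintegral.
have -> : (\int[jl]_w (h w)%:E = \int[G]_m (\int[gam]_x (h (m, x))%:E))%E.
  by rewrite -(integral12_prod_meas1 ih).
rewrite /Rintegral; congr fine.
apply: ae_eq_integral => //.
- exact: (measurable_fubini_F ih).
- by apply/measurable_EFinP; exact: measurable_gauss_section.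
exists (~` I); split; [exact: measurableC|exact: (supported_setC GM)|].
apply: subsetC => m; rewrite /= in_itv/= -ler_norml => mM _.
exact: fineE.
Qed.

(** Gaussian inequalities such as [gauss_derivative_interpolation] hold for
every fixed signal, and pass to the joint law through this comparison. *)
Lemma joint_le f g : jtame f -> jtame g ->
  (forall m, `|m| <= M -> \int[gam]_x f (m, x) <= \int[gam]_x g (m, x)) ->
  \int[jl]_w f w <= \int[jl]_w g w.
Proof.
move=> tf tg fg; rewrite !joint_iterated//.
have [C fC] := gauss_section_bound tf; have [D gD] := gauss_section_bound tg.
apply: (supported_le_Rintegral GM (C := Num.max C D)) => //.
- exact: measurable_gauss_section.
- exact: measurable_gauss_section.
- by move=> m /fC H; rewrite le_max H.
- by move=> m /gD H; rewrite le_max H orbT.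
Qed.

Lemma joint_eq f g : jtame f -> jtame g ->
  (forall m, `|m| <= M -> \int[gam]_x f (m, x) = \int[gam]_x g (m, x)) ->
  \int[jl]_w f w = \int[jl]_w g w.
Proof.
by move=> tf tg fg; apply/eqP; rewrite eq_le !joint_le// => m mM; rewrite fg.
Qed.

Lemma joint_le_pointwise f g : jtame f -> jtame g ->
  (forall m x, `|m| <= M -> f (m, x) <= g (m, x)) ->
  \int[jl]_w f w <= \int[jl]_w g w.
Proof.
move=> tf tg fg; apply: joint_le => // m mM; apply: le_Rintegral => //.
- by apply: tame_integrable; exact: jtame_tame.
- by apply: tame_integrable; exact: jtame_tame.
- by move=> x _; exact: fg.
Qed.

Lemma jointD f g : jtame f -> jtame g ->
  \int[jl]_w (f w + g w) = \int[jl]_w f w + \int[jl]_w g w.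
Proof. by move=> /jtame_integrable ? /jtame_integrable ?; rewrite RintegralD. Qed.

Lemma jointB f g : jtame f -> jtame g ->
  \int[jl]_w (f w - g w) = \int[jl]_w f w - \int[jl]_w g w.
Proof. by move=> /jtame_integrable ? /jtame_integrable ?; rewrite RintegralB. Qed.

Lemma jointZ (c : R) f : jtame f -> \int[jl]_w (c * f w) = c * \int[jl]_w f w.
Proof. by move=> /jtame_integrable ?; rewrite RintegralZl. Qed.

Lemma joint_cst (c : R) : \int[jl]_w c = c.
Proof.
rewrite joint_iterated; last exact: jtame_cst.
by rewrite !Rintegral_cst//= !probability_setT/= !mulr1.
Qed.

Lemma joint_ge0 f : (forall w, 0 <= f w) -> 0 <= \int[jl]_w f w.
Proof. by move=> f0; apply: Rintegral_ge0. Qed.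

End joint_law.

Section signal_plus_noise.
Context {R : realType} (M : R) (Gs : law R).
Hypotheses (GsM : supported_in M Gs) (M_ge0 : 0 <= M).
Local Notation RT := (measurableTypeR R).
Local Notation leb := (@lebesgue_measure R).
Local Notation phi := (@std_normal_pdf R).
Local Notation gam := (normal_prob (0 : R) 1).
Local Notation jl := (joint_law Gs).
Local Notation I := [set` `[- M, M]].

Lemma integral_normal_prob_shift m (f : RT -> R) : measurable_fun [set: RT] f ->
  (\int[normal_prob m 1]_z (f z)%:E = \int[gam]_x (f (m + x)%R)%:E)%E.
Proof.
move=> mf; have mf' : measurable_fun [set: RT] (EFin \o f) by exact/measurable_EFinP.
have mp : measurable_fun [set: RT] (EFin \o f)^\+%E by exact: measurable_funepos.
have mn : measurable_fun [set: RT] (EFin \o f)^\-%E by exact: measurable_funeneg.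
have p0 (x : RT) : (0 <= (EFin \o f)^\+ x)%E by [].
have n0 (x : RT) : (0 <= (EFin \o f)^\- x)%E by [].
have Ep := ge0_integral_normal_prob_shift m mp p0.
have En := ge0_integral_normal_prob_shift m mn n0.
apply: (eq_trans (integralE _ _ _)).
apply: (eq_trans (f_equal2 (fun a b => a - b)%E Ep En)).
rewrite [RHS]integralE; congr (_ - _)%E; apply: eq_integral => x _.
  by rewrite !funeposE.
by rewrite !funenegE.
Qed.

Lemma measurable_signal_plus_noise :
  measurable_fun [set: RT * RT] (fun w : RT * RT => w.1 + w.2 : RT).
Proof. exact: measurable_funD. Qed.

Lemma jtame_obs (M' : R) (f : R -> R) (C : R) : measurable_fun [set: R] f -> (forall z, `|f z| <= C) ->
  jtame M' (fun w : RT * RT => f (w.1 + w.2)).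
Proof.
move=> mf fC; apply: (@jtame_bounded _ _ _ C) => //.
exact: (measurableT_comp mf measurable_signal_plus_noise).
Qed.

Lemma joint_iteratedE h : jtame M h ->
  (\int[Gs]_m \int[gam]_x (h (m, x))%:E = (\int[jl]_w h w)%:E)%E.
Proof.
move=> th; have ih := jtame_integrable GsM th.
rewrite /Rintegral fineK; last exact: integrable_fin_num.
by rewrite -(integral12_prod_meas1 ih).
Qed.

Lemma joint_expectationE (h : R -> R -> R) :
  (forall m, measurable_fun [set: R] (h m)) ->
  jtame M (fun w : RT * RT => h w.1 (w.1 + w.2)) ->
  joint_expectation Gs h = (\int[jl]_w h w.1 (w.1 + w.2))%:E.
Proof.
move=> mh th; rewrite -(joint_iteratedE th).
by apply: eq_integral => m _; exact: (integral_normal_prob_shift m (mh m)).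
Qed.

Let mI : measurable (I : set RT). Proof. exact: measurable_itv. Qed.

Local Notation v := (post_cumulant Gs 0).

(** The posterior mean is the orthogonal projection of the signal: integrating
first over the signal at a fixed observation [z], the integrand is [g z] times
[v z * f z] minus the first unnormalised moment, which vanishes by the
definition of [v]. *)
Lemma posterior_orthogonality (g : R -> R) (C : R) :
  measurable_fun [set: R] g -> (forall z, `|g z| <= C) ->
  \int[jl]_w (g (w.1 + w.2) * (v (w.1 + w.2) - w.1)) = 0.
Proof.
move=> mg gC; have C0 : 0 <= C by apply: le_trans (gC 0).
have jv : jet (post_cumulant Gs) by move=> j t; exact: (is_derive_post_cumulant GsM M_ge0).
have mv : measurable_fun [set: R] v by exact: jet_measurable.
have vM z : `|v z| <= M.
  have := @norm_post_cumulant_le _ _ _ GsM M_ge0 (4 * M) 0 z (lexx _).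
  by rewrite expr0 !mulr1.
pose q (w : RT * RT) := g w.2 * (v w.2 - w.1) * phi (w.2 - w.1).
have mq : measurable_fun [set: RT * RT] q.
  apply: measurable_funM; last first.
    apply: (measurableT_comp measurable_std_normal_pdf).
    by apply: measurable_funB; [exact: measurable_snd|exact: measurable_fst].
  apply: measurable_funM.
    by apply: (measurableT_comp mg); exact: measurable_snd.
  apply: (measurable_funB _ measurable_fst).
  by apply: (measurableT_comp mv); exact: measurable_snd.
have mq1 m : measurable_fun [set: RT] (fun z => q (m, z)).
  by apply: (measurableT_comp mq); exact: measurable_pair1.
have meq : measurable_fun [set: RT * RT] (EFin \o q) by exact/measurable_EFinP.
have mphi m : measurable_fun [set: RT] (fun z => (phi (z - m))%:E).
  apply/measurable_EFinP; apply: (measurableT_comp measurable_std_normal_pdf).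
  exact: measurable_funB.
have iphi m : (\int[leb]_z (phi (z - m))%:E = 1)%E.
  rewrite -(integral_normal_pdf m 1).
  by apply: eq_integral => z _; rewrite normal_pdf_shift.
have iq : (Gs \x leb)%E.-integrable setT (EFin \o q).
  apply/(@integrable12ltyP _ _ _ _ _ Gs leb) => //.
  rewrite (ge0_negligible_integral (measurableC mI) measurableT _ _ (supported_setC GsM))//; last 2 first.
  - apply: (measurable_fun_fubini_tonelli_F (abse \o (EFin \o q))) => //=.
    exact: measurableT_comp.
  - by move=> m _; apply: integral_ge0.
  rewrite setDE setTI setCK.
  apply: (@le_lt_trans _ _ (\int[Gs]_(m in I) (C * (M + M))%:E)%E); last first.
    by rewrite integral_cst//= GsM mule1 ltry.
  apply: ge0_le_integral => //.
  - by move=> m _; apply: integral_ge0.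
  - apply: measurable_funTS.
    apply: (measurable_fun_fubini_tonelli_F (abse \o (EFin \o q))) => //=.
    exact: measurableT_comp.
  - move=> m; rewrite /= in_itv/= -ler_norml => mM.
    apply: (@le_trans _ _ (\int[leb]_z ((C * (M + M))%:E * (phi (z - m))%:E))%E).
      apply: ge0_le_integral => //.
      + by apply/measurable_EFinP; apply: (measurableT_comp _ (mq1 m)).
      + exact: emeasurable_funM.
      + move=> z _; rewrite -EFinM lee_fin /q/= normrM (ger0_norm (ltW (std_normal_pdf_gt0 _))).
        rewrite ler_wpM2r ?(ltW (std_normal_pdf_gt0 _))// normrM ler_pM//.
        by apply: le_trans (ler_normB _ _) _; exact: (lerD (vM z) mM).
    rewrite ge0_integralZl//= ?iphi ?mule1//.
      by move=> z _; rewrite lee_fin ltW// std_normal_pdf_gt0.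
    by rewrite lee_fin mulr_ge0 ?addr_ge0.
have th : jtame M (fun w : RT * RT => g (w.1 + w.2) * (v (w.1 + w.2) - w.1)).
  apply: jtameM; first exact: jtame_obs gC.
  by apply: jtameB; [exact: jtame_obs vM|exact: jtame_fst].
(* From signal plus noise to signal and observation, to exchange integrals. *)
apply/EFin_inj; apply: (eq_trans (esym (joint_iteratedE th))).
transitivity (\int[Gs]_m \int[leb]_z (q (m, z))%:E)%E.
  apply: eq_integral => m _.
  rewrite -(@integral_normal_prob_shift m (fun z => g z * (v z - m))); last first.
    by apply: measurable_funM => //; exact: measurable_funB.
  rewrite integral_normal_prob; last by apply: measurable_funM => //; exact: measurable_funB.
  by apply: eq_integral => z _; rewrite normal_pdf_shift.
rewrite (Fubini iq) /=.
rewrite integral0_eq// => z _.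
have i0 := moment_pdf_integrable GsM M_ge0 0 z.
have i1 := moment_pdf_integrable GsM M_ge0 1 z.
have iz : Gs.-integrable setT (EFin \o (fun m => v z * (m ^+ 0 * phi (z - m)))).
  exact: (integrableZl measurableT (v z) i0).
have iB : Gs.-integrable setT (EFin \o (fun m => v z * (m ^+ 0 * phi (z - m)) - m ^+ 1 * phi (z - m))).
  exact: (integrableB measurableT iz i1).
have ig : Gs.-integrable setT (EFin \o (fun m => g z * (v z * (m ^+ 0 * phi (z - m)) - m ^+ 1 * phi (z - m)))).
  exact: (integrableZl measurableT (g z) iB).
transitivity ((\int[Gs]_m (g z * (v z * (m ^+ 0 * phi (z - m)) - m ^+ 1 * phi (z - m))))%:E).
  rewrite /Rintegral fineK; last exact: (integrable_fin_num measurableT ig).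
  by apply: eq_integral => m _; rewrite /q/=; congr EFin; ring.
rewrite RintegralZl// RintegralB// RintegralZl//.
rewrite -/(moment_pdf Gs 0 z) -/(moment_pdf Gs 1 z).
have F0 := moment_pdf0_gt0 GsM M_ge0 z.
rewrite /post_cumulant derive1n0 /post_moment divfK ?gt_eqF//.
by rewrite subrr mulr0.
Qed.

End signal_plus_noise.

(** * Fisher divergence, regret and excess loss *)

Section excess_loss.
Context {R : realType} (M : R) (Gs G : law R).
Hypotheses (GsM : supported_in M Gs) (GM : supported_in M G) (M_ge0 : 0 <= M).
Local Notation RT := (measurableTypeR R).
Local Notation leb := (@lebesgue_measure R).
Local Notation phi := (@std_normal_pdf R).
Local Notation gam := (normal_prob (0 : R) 1).
Local Notation jl := (joint_law Gs).
Local Notation u := (post_cumulant G).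
Local Notation v := (post_cumulant Gs).
Local Notation A := (4 * M + 1).

Definition cumulant_gap (H0 H : law R) j : R -> R := post_cumulant H j - post_cumulant H0 j.
Local Notation du := (cumulant_gap Gs G).

Lemma jet_post_cumulant (H : law R) : supported_in M H -> jet (post_cumulant H).
Proof. by move=> HM j t; exact: (is_derive_post_cumulant HM M_ge0). Qed.

Lemma post_cumulant0_le (H : law R) z : supported_in M H -> `|post_cumulant H 0 z| <= M.
Proof.
move=> HM; have := norm_post_cumulant_le HM M_ge0 0 z (lexx (4 * M)).
by rewrite expr0 !mulr1.
Qed.

Lemma jet_cumulant_gap : jet du.
Proof. by apply: jetB; exact: jet_post_cumulant. Qed.

Let A4 : 4 * M <= A. Proof. by rewrite lerDl. Qed.

Lemma cumulant_gap_le j z : `|du j z| <= 2 * M * j`!%:R * A ^+ j.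
Proof.
rewrite /cumulant_gap !fctE; apply: le_trans (ler_normB _ _) _.
have := norm_post_cumulant_le GM M_ge0 j z A4.
have := norm_post_cumulant_le GsM M_ge0 j z A4.
lra.
Qed.

Lemma measurable_cumulant_gap j : measurable_fun [set: R] (du j).
Proof. exact: (jet_measurable j jet_cumulant_gap). Qed.

Lemma cumulant_gap0_le z : `|du 0 z| <= 2 * M.
Proof. by have := cumulant_gap_le 0 z; rewrite expr0 !mulr1. Qed.

(** The finite value of the Fisher divergence, see [fisher_divergenceE]. *)
Definition mean_sq_gap (H0 H : law R) : R := \int[joint_law H0]_w (cumulant_gap H0 H 0 (w.1 + w.2)) ^+ 2.
Local Notation D := (mean_sq_gap Gs G).

Lemma jtame_gap j : jtame M (fun w : RT * RT => du j (w.1 + w.2)).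
Proof.
apply: (@jtame_obs _ _ _ (2 * M * j`!%:R * A ^+ j)); first exact: measurable_cumulant_gap.
exact: cumulant_gap_le.
Qed.

Lemma jtame_gap2 j : jtame M (fun w : RT * RT => (du j (w.1 + w.2)) ^+ 2).
Proof. exact: (jtameM (jtame_gap j) (jtame_gap j)). Qed.

(** A score is the posterior mean minus the observation, so a difference of
scores is a difference of posterior means; the mixture density is then absorbed
in the joint law. *)
Lemma fisher_divergenceE : fisher_divergence Gs G = D%:E.
Proof.
pose q (w : RT * RT) := (du 0 w.2) ^+ 2 * phi (w.2 - w.1).
have mq : measurable_fun [set: RT * RT] q.
  apply: measurable_funM.
    apply: measurable_funX.
    by apply: (measurableT_comp (measurable_cumulant_gap 0)); exact: measurable_snd.
  apply: (measurableT_comp measurable_std_normal_pdf).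
  by apply: measurable_funB; [exact: measurable_snd|exact: measurable_fst].
have q0 w : (0 <= (EFin \o q) w)%E.
  by rewrite lee_fin mulr_ge0 ?sqr_ge0// ltW// std_normal_pdf_gt0.
have meq : measurable_fun [set: RT * RT] (EFin \o q) by exact/measurable_EFinP.
transitivity (\int[leb]_z \int[Gs]_m (EFin \o q) (m, z))%E.
  apply: eq_integral => z _.
  rewrite (scoreE GsM M_ge0) (scoreE GM M_ge0).
  have i0 := moment_pdf_integrable GsM M_ge0 0 z.
  have ig : Gs.-integrable setT (EFin \o (fun m => (du 0 z) ^+ 2 * (m ^+ 0 * phi (z - m)))).
    exact: (integrableZl measurableT _ i0).
  rewrite (mixture_pdfE Gs z) /moment_pdf.
  have -> : v 0 z - z - (u 0 z - z) = - du 0 z by rewrite /cumulant_gap !fctE; ring.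
  rewrite sqrrN -RintegralZl// /Rintegral fineK; last exact: (integrable_fin_num measurableT ig).
  by apply: eq_integral => m _; rewrite expr0 mul1r.
rewrite -(@fubini_tonelli _ _ _ _ _ Gs leb _ meq q0).
apply: (eq_trans _ (joint_iteratedE GsM (jtame_gap2 0))).
apply: eq_integral => m _.
have md2 : measurable_fun [set: RT] (fun z => du 0 z ^+ 2).
  by apply: measurable_funX; exact: measurable_cumulant_gap.
apply: (eq_trans _ (integral_normal_prob_shift m md2)).
apply: (eq_trans _ (esym (integral_normal_prob m md2))).
by apply: eq_integral => z _; rewrite normal_pdf_shift.
Qed.

(** Pythagoras: the cross term between the gap of posterior means and the error
of the true one vanishes by orthogonality. *)
Lemma regretE : regret Gs G = fisher_divergence Gs G.
Proof.
rewrite fisher_divergenceE /regret.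
have t1 := jtame_fst M_ge0.
have tH (H : law R) : supported_in M H -> jtame M (fun w : RT * RT => post_cumulant H 0 (w.1 + w.2)).
  move=> HM; apply: (@jtame_obs _ _ _ M); first exact: (jet_measurable 0 (jet_post_cumulant HM)).
  by move=> z; exact: post_cumulant0_le.
have tsq (H : law R) : supported_in M H -> jtame M (fun w : RT * RT => (w.1 - post_cumulant H 0 (w.1 + w.2)) ^+ 2).
  by move=> HM; have := jtameB t1 (tH H HM) => t; exact: (jtameM t t).
have jE (H : law R) : supported_in M H ->
    joint_expectation Gs (fun m z => ((m - posterior_mean H z) ^+ 2)%R) =
    (\int[jl]_w (w.1 - post_cumulant H 0 (w.1 + w.2)) ^+ 2)%:E.
  move=> HM.
  have -> : posterior_mean H = post_cumulant H 0.
    by apply/funext => z; exact: (posterior_meanE).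
  apply: (joint_expectationE GsM (h := fun m z => (m - post_cumulant H 0 z) ^+ 2)).
    move=> m; apply: measurable_funX; apply: measurable_funB => //.
    exact: (jet_measurable 0 (jet_post_cumulant HM)).
  exact: tsq.
rewrite !jE// -EFinB; congr EFin.
rewrite -(jointB GsM (tsq G GM) (tsq Gs GsM)).
have tx : jtame M (fun w : RT * RT => du 0 (w.1 + w.2) * (v 0 (w.1 + w.2) - w.1)).
  by apply: jtameM; [exact: jtame_gap|apply: jtameB => //; exact: tH].
have tx2 : jtame M (fun w : RT * RT => 2 * (du 0 (w.1 + w.2) * (v 0 (w.1 + w.2) - w.1))).
  by apply: jtameM => //; exact: jtame_cst.
transitivity (\int[jl]_w (du 0 (w.1 + w.2) ^+ 2 + 2 * (du 0 (w.1 + w.2) * (v 0 (w.1 + w.2) - w.1)))).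
  by apply: eq_Rintegral => w _; rewrite /cumulant_gap !fctE; ring.
rewrite (jointD GsM (jtame_gap2 0) tx2) (jointZ GsM 2 tx).
rewrite (posterior_orthogonality GsM M_ge0 (measurable_cumulant_gap 0) cumulant_gap0_le).
by rewrite mulr0 addr0.
Qed.

(** The difference of the pointwise score matching losses of [H] and [H0], see
[excess_lossE], expanded around [H0]: the square of the gap is isolated from the
terms of first order. *)
Definition excess_loss (H0 H : law R) z : R :=
  cumulant_gap H0 H 0 z ^+ 2 + 2 * (cumulant_gap H0 H 0 z * (post_cumulant H0 0 z - z)) +
  2 * cumulant_gap H0 H 1 z.
Local Notation X := (excess_loss Gs G).

Lemma excess_lossE z : X z = (score G z ^+ 2 + 2 * derive1 (score G) z) -
   (score Gs z ^+ 2 + 2 * derive1 (score Gs) z).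
Proof.
rewrite (scoreE GsM M_ge0) (scoreE GM M_ge0).
rewrite (derive1_scoreE GsM M_ge0) (derive1_scoreE GM M_ge0).
rewrite /excess_loss /cumulant_gap !fctE; ring.
Qed.

Lemma measurable_excess_loss : measurable_fun [set: R] X.
Proof.
have m0 := measurable_cumulant_gap 0; have m1 := measurable_cumulant_gap 1.
apply: measurable_funD; last exact: measurable_funM.
apply: measurable_funD; first exact: measurable_funX.
apply: measurable_funM => //; apply: measurable_funM => //; apply: measurable_funB => //.
exact: (jet_measurable 0 (jet_post_cumulant GsM)).
Qed.

Lemma norm_excess_loss_le z :
  `|X z| <= 4 * M ^+ 2 + 4 * M * (M + `|z|) + 4 * M * A.
Proof.
have d0 := cumulant_gap0_le z; have := cumulant_gap_le 1 z.
rewrite (_ : 1`! = 1%N)// mulr1 expr1 => d1.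
have v0 := post_cumulant0_le z GsM.
rewrite /excess_loss; apply: le_trans (ler_normD _ _) _; apply: lerD; last first.
  by rewrite normrM ger0_norm//; lra.
apply: le_trans (ler_normD _ _) _; apply: lerD.
  rewrite normrX (_ : 4 * M ^+ 2 = (2 * M) ^+ 2); last by ring.
  by rewrite lerXn2r// nnegrE mulr_ge0.
rewrite !normrM ger0_norm// (_ : 4 * M * _ = 2 * (2 * M * (M + `|z|))); last by ring.
rewrite ler_wpM2l// ler_pM//.
by apply: le_trans (ler_normB _ _) _; rewrite lerD2r.
Qed.

Lemma jtame_excess_loss : jtame M (fun w : RT * RT => X (w.1 + w.2)).
Proof.
have t1 := jtame_fst M_ge0; have t2 := jtame_snd M.
have tv : jtame M (fun w : RT * RT => v 0 (w.1 + w.2)).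
  apply: (@jtame_obs _ _ _ M); first exact: (jet_measurable 0 (jet_post_cumulant GsM)).
  by move=> z; exact: post_cumulant0_le.
have tc := jtame_cst M (2 : R).
apply: jtameD; last by apply: jtameM => //; exact: jtame_gap.
apply: jtameD; first exact: jtame_gap2.
apply: jtameM => //; apply: jtameM; first exact: jtame_gap.
by apply: jtameB => //; apply: jtameD.
Qed.

(** With [z] the sum of the signal [w.1] and the noise [w.2], the cross term
splits into a gap times [v - w.1], of mean zero by orthogonality, and a gap
times [- w.2], which cancels the derivative term by Stein's identity applied to
the noise. The square of the gap is all that remains. *)
Lemma joint_excess_loss : \int[jl]_w X (w.1 + w.2) = D.
Proof.
have t1 := jtame_fst M_ge0; have t2 := jtame_snd M.
have tv : jtame M (fun w : RT * RT => v 0 (w.1 + w.2)).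
  apply: (@jtame_obs _ _ _ M); first exact: (jet_measurable 0 (jet_post_cumulant GsM)).
  by move=> z; exact: post_cumulant0_le.
have tc := jtame_cst M (2 : R).
have ta : jtame M (fun w : RT * RT => du 0 (w.1 + w.2) * (v 0 (w.1 + w.2) - w.1)).
  by apply: jtameM; [exact: jtame_gap|apply: jtameB].
have tb : jtame M (fun w : RT * RT => w.2 * du 0 (w.1 + w.2)).
  by apply: jtameM => //; exact: jtame_gap.
have t2a := jtameM tc ta; have t2b := jtameM tc tb; have t2c := jtameM tc (jtame_gap 1).
transitivity (\int[jl]_w ((du 0 (w.1 + w.2) ^+ 2 + 2 * (du 0 (w.1 + w.2) * (v 0 (w.1 + w.2) - w.1)))
   + (2 * du 1 (w.1 + w.2) - 2 * (w.2 * du 0 (w.1 + w.2))))).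
  by apply: eq_Rintegral => w _; rewrite /excess_loss; ring.
rewrite (jointD GsM (jtameD (jtame_gap2 0) t2a) (jtameB t2c t2b)).
rewrite (jointD GsM (jtame_gap2 0) t2a) (jointB GsM t2c t2b).
rewrite (jointZ GsM 2 ta) (jointZ GsM 2 tb) (jointZ GsM 2 (jtame_gap 1)).
rewrite (posterior_orthogonality GsM M_ge0 (measurable_cumulant_gap 0) cumulant_gap0_le).
suff -> : \int[jl]_w (w.2 * du 0 (w.1 + w.2)) = \int[jl]_w du 1 (w.1 + w.2).
  by rewrite subrr mulr0 !addr0.
apply: (joint_eq GsM tb (jtame_gap 1)) => m mM.
have dJ := jet_translate m jet_cumulant_gap.
have g0 := (jtame_tame (jtame_gap 0) mM).2.
have g1 := (jtame_tame (jtame_gap 1) mM).2.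
exact: (stein (dJ 0%N) (@jet_continuous R _ 1 dJ) g0 g1).
Qed.

Lemma mean_sq_gap_ge0 : 0 <= D.
Proof. by apply: joint_ge0 => w; exact: sqr_ge0. Qed.

(** A reverse Poincare inequality, valid because the derivatives of the gap
satisfy analytic bounds; the remainder is made negligible by the choice of [J]
and [K]. *)
Lemma joint_gap1_le (J : nat) (K : R) : 0 < K -> 2 * J.+1%:R <= K ->
  \int[jl]_w (du 1 (w.1 + w.2)) ^+ 2 <=
  K * D + (2 * M * (J.+1)`!%:R * A ^+ J.+1) ^+ 2 * (2 / K) ^+ J.
Proof.
move=> K0 JK; set e := (_ * _ ^+ J).
have tK := jtameM (jtame_cst M K) (jtame_gap2 0).
have te := jtame_cst M e.
rewrite /mean_sq_gap -(jointZ GsM K (jtame_gap2 0)) -[X in _ <= _ + X](joint_cst GsM).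
rewrite -(jointD GsM tK te).
apply: (joint_le GsM (jtame_gap2 1) (jtameD tK te)) => m mM /=.
have t0 := jtame_tame (jtame_gap2 0) mM.
rewrite (gaussD (jtame_tame tK mM) (tame_cst e)) (gaussZ K t0).
rewrite [X in _ <= _ + X]Rintegral_cst//= probability_setT/= mulr1.
have dJ := jet_translate m jet_cumulant_gap.
exact: (gauss_derivative_interpolation dJ (fun j x => cumulant_gap_le j (m + x)) K0 JK).
Qed.

End excess_loss.

(** * The truncated excess loss *)

Section truncated_excess_loss.
Context {R : realType} (M : R) (Gs : law R).
Hypotheses (GsM : supported_in M Gs) (M_ge0 : 0 <= M).
Local Notation RT := (measurableTypeR R).
Local Notation gam := (normal_prob (0 : R) 1).
Local Notation jl := (joint_law Gs).

(** The excess loss grows linearly in the observation. Exponential moments and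
nets are taken on a window, which contains all observations with high
probability. *)
Definition window (L : R) : set RT := [set` `[- L, L]].

Definition truncated (L : R) (f : R -> R) z : R := f z * \1_(window L) z.

Let mwin L : measurable (window L). Proof. exact: measurable_itv. Qed.

Lemma in_window L z : (z \in window L) = (`|z| <= L).
Proof. by apply/idP/idP; rewrite inE /window/= in_itv/= ler_norml. Qed.

Lemma truncated_in L f z : `|z| <= L -> truncated L f z = f z.
Proof. by move=> zL; rewrite /truncated indicE in_window zL mulr1. Qed.

Lemma truncated_out L f z : L < `|z| -> truncated L f z = 0.
Proof. by move=> zL; rewrite /truncated indicE in_window leNgt zL mulr0. Qed.

Lemma measurable_truncated L f : measurable_fun [set: R] f ->
  measurable_fun [set: R] (truncated L f).
Proof. by move=> mf; apply: measurable_funM => //; exact: (measurable_indic (mwin L)). Qed.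

Lemma norm_truncated_le L f z : `|truncated L f z| <= `|f z|.
Proof.
rewrite /truncated indicE; case: (_ \in _); first by rewrite mulr1.
by rewrite mulr0 normr0.
Qed.

(** Outside the window, [expR |z|] dominates both [1] and [1 + |z|]: its mean
bounds the probability of leaving the window and the part of the excess loss
lost by truncation. *)
Definition tail_weight L z : R := expR `|z| * \1_(~` window L) z.

Lemma tail_weight_in L z : `|z| <= L -> tail_weight L z = 0.
Proof. by move=> zL; rewrite /tail_weight indicE in_setC in_window zL mulr0. Qed.

Lemma tail_weight_out L z : L < `|z| -> tail_weight L z = expR `|z|.
Proof. by move=> zL; rewrite /tail_weight indicE in_setC in_window leNgt zL mulr1. Qed.

Lemma tail_weight_ge0 L z : 0 <= tail_weight L z.
Proof. by rewrite mulr_ge0 ?expR_ge0// indicE; case: (_ \in _). Qed.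

Let mtail L : measurable_fun [set: R] (tail_weight L).
Proof.
apply: measurable_funM; last exact: (measurable_indic (measurableC (mwin L))).
apply: (measurableT_comp (@measurable_expR R)); exact: normr_measurable.
Qed.

(** Outside the window [|z|] is at most [2 |z| - L]. *)
Let tail_bound L m x : `|m| <= M ->
  tail_weight L (m + x) <= expR (2 * M - L) * expR (2 * `|x|).
Proof.
move=> mM; have [xL|Lx] := leP `|m + x| L.
  by rewrite tail_weight_in// mulr_ge0 ?expR_ge0.
rewrite tail_weight_out// -expRD ler_expR.
have := ler_normD m x; lra.
Qed.

Lemma jtame_tail_weight L : jtame M (fun w : RT * RT => tail_weight L (w.1 + w.2)).
Proof.
split; first exact: (measurableT_comp (mtail L) (@measurable_signal_plus_noise R)).
exists (expR (2 * M - L)), 2%N; first exact: expR_ge0.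
by move=> m x mM /=; rewrite ger0_norm ?tail_weight_ge0// tail_bound.
Qed.

Definition tail_const : R := 2 * expR (2 * M + 2).

Lemma tail_const_ge0 : 0 <= tail_const.
Proof. by rewrite mulr_ge0 ?expR_ge0. Qed.

Lemma joint_tail_weight L :
  \int[jl]_w tail_weight L (w.1 + w.2) <= tail_const * expR (- L).
Proof.
have te : tame (fun x : R => expR (2 * `|x|)).
  split; last first.
    by exists 1, 2%N => // x; rewrite ger0_norm ?expR_ge0// mul1r.
  by apply: (measurableT_comp (@measurable_expR R)); apply: measurable_funM.
rewrite (joint_iterated GsM (jtame_tail_weight L)).
have [C HC] := gauss_section_bound (jtame_tail_weight L).
apply: (@le_trans _ _ (\int[Gs]_m (tail_const * expR (- L)))); last first.
  by rewrite Rintegral_cst//= probability_setT/= mulr1.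
apply: (supported_le_Rintegral GsM (C := Num.max C (tail_const * expR (- L)))).
- exact: (measurable_gauss_section GsM (jtame_tail_weight L)).
- exact: measurable_cst.
- by move=> m /HC H; rewrite le_max H.
- by move=> m _; rewrite le_max ger0_norm ?lexx ?orbT// mulr_ge0 ?tail_const_ge0 ?expR_ge0.
move=> m mM; apply: (@le_trans _ _ (\int[gam]_x (expR (2 * M - L) * expR (2 * `|x|)))).
  apply: le_Rintegral => //.
  - by apply: tame_integrable; exact: (jtame_tame (jtame_tail_weight L) mM).
  - by apply: tame_integrable; apply: tameM => //; exact: tame_cst.
  - by move=> x _; exact: tail_bound.
rewrite (gaussZ _ te).
have -> : tail_const * expR (- L) = expR (2 * M - L) * (2 * expR 2).
  by rewrite /tail_const !expRD; ring.
rewrite ler_wpM2l ?expR_ge0//.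
have := @integral_gaussian_expR_norm R 2 (ler0n _ 2).
rewrite (_ : 2 ^+ 2 / 2 = 2); last by field.
rewrite -lee_fin /Rintegral fineK//.
exact: (integrable_fin_num measurableT (tame_integrable te)).
Qed.

Variables (G : law R).
Hypothesis GM : supported_in M G.
Local Notation A := (4 * M + 1).
Local Notation D := (mean_sq_gap Gs G).
Local Notation X := (excess_loss Gs G).
Local Notation du := (cumulant_gap Gs G).

Definition loss_const : R := 8 * M ^+ 2 + 4 * M * A + 4 * M.

Lemma loss_const_ge0 : 0 <= loss_const.
Proof.
have := sqr_ge0 M; rewrite /loss_const; have := M_ge0; nra.
Qed.

Lemma norm_excess_loss_linear z : `|X z| <= loss_const * (1 + `|z|).
Proof.
apply: le_trans (norm_excess_loss_le GsM GM M_ge0 z) _.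
rewrite /loss_const; have := normr_ge0 z; set y := `|z|; move=> y0.
rewrite -subr_ge0 (_ : _ - _ = (8 * M ^+ 2 + 4 * M * A) * y + 4 * M); last by ring.
have h : 0 <= 8 * M ^+ 2 + 4 * M * A by have := sqr_ge0 M; have := M_ge0; nra.
by rewrite addr_ge0 ?mulr_ge0.
Qed.

Let mX : measurable_fun [set: R] X := measurable_excess_loss GsM GM M_ge0.

Let jtame_trunc L : jtame M (fun w : RT * RT => truncated L X (w.1 + w.2)).
Proof.
have [mX' [C [k C0 HC]]] := jtame_excess_loss GsM GM M_ge0.
split; first exact: (measurableT_comp (measurable_truncated L mX) (@measurable_signal_plus_noise R)).
by exists C, k => // m x mM; apply: le_trans (norm_truncated_le _ _ _) (HC m x mM).
Qed.

Lemma truncated_excess_mean L :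
  D - loss_const * tail_const * expR (- L) <= \int[jl]_w truncated L X (w.1 + w.2).
Proof.
have tX := jtame_excess_loss GsM GM M_ge0.
have tt := jtameM (jtame_cst M loss_const) (jtame_tail_weight L).
rewrite -(joint_excess_loss GsM GM M_ge0) lerBlDr.
apply: (@le_trans _ _ (\int[jl]_w (truncated L X (w.1 + w.2) + loss_const * tail_weight L (w.1 + w.2)))).
  apply: (joint_le_pointwise GsM tX (jtameD (jtame_trunc L) tt)) => m x mM /=.
  have [zL|Lz] := leP `|m + x| L.
    by rewrite truncated_in// tail_weight_in// mulr0 addr0.
  rewrite truncated_out// tail_weight_out// add0r; apply: le_trans (ler_norm _) _.
  apply: le_trans (norm_excess_loss_linear _) _.
  by rewrite ler_wpM2l ?loss_const_ge0// expR_ge1Dx.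
rewrite (jointD GsM (jtame_trunc L) tt) (jointZ GsM _ (jtame_tail_weight L)).
by rewrite lerD2l -mulrA ler_wpM2l ?loss_const_ge0// joint_tail_weight.
Qed.

Definition gap_remainder (J : nat) (K : R) : R :=
  (2 * M * (J.+1)`!%:R * A ^+ J.+1) ^+ 2 * (2 / K) ^+ J.

(** The constant is [12 M^2 + 12 (M + L)^2] from the terms in the gap and [12 K]
from its derivative, whose mean square is at most [K] times that of the gap. *)
Definition loss_var (L K : R) : R := 12 * M ^+ 2 + 12 * (M + L) ^+ 2 + 12 * K.

(** The Bernstein condition: the second moment of the truncated excess loss is
controlled by its mean, which makes the rate [1 / n] rather than
[1 / sqrt n]. *)
Lemma truncated_excess_sq (L K : R) (J : nat) : 0 <= L -> 0 < K -> 2 * J.+1%:R <= K ->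
  \int[jl]_w (truncated L X (w.1 + w.2)) ^+ 2 <=
  loss_var L K * D + 12 * gap_remainder J K.
Proof.
move=> L0 K0 JK.
set c := 12 * M ^+ 2 + 12 * (M + L) ^+ 2.
have c0 : 0 <= c by have := sqr_ge0 M; have := sqr_ge0 (M + L); rewrite /c; lra.
have t0 := jtame_gap2 GsM GM M_ge0 0; have t1 := jtame_gap2 GsM GM M_ge0 1.
have ct0 := jtameM (jtame_cst M c) t0; have ct1 := jtameM (jtame_cst M 12) t1.
have tt2 : jtame M (fun w : RT * RT => truncated L X (w.1 + w.2) ^+ 2).
  exact: (jtameM (jtame_trunc L) (jtame_trunc L)).
apply: (@le_trans _ _ (\int[jl]_w (c * du 0 (w.1 + w.2) ^+ 2 + 12 * du 1 (w.1 + w.2) ^+ 2))).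
  apply: (joint_le_pointwise GsM tt2 (jtameD ct0 ct1)) => m x mM /=.
  set z := m + x; have [zL|Lz] := leP `|z| L; last first.
    by rewrite truncated_out// expr0n/= addr_ge0// mulr_ge0// sqr_ge0.
  rewrite truncated_in// /excess_loss.
  have d0 := cumulant_gap0_le GsM GM M_ge0 z.
  have v0 := post_cumulant0_le M_ge0 z GsM.
  set a := du 0 z; set b := du 1 z; set s := post_cumulant Gs 0 z - z.
  have sL : s ^+ 2 <= (M + L) ^+ 2.
    rewrite -(real_normK (num_real s)) lerXn2r// ?nnegrE ?addr_ge0//.
    by apply: le_trans (ler_normB _ _) _; exact: lerD.
  have aM : a ^+ 2 <= 4 * M ^+ 2.
    rewrite -(real_normK (num_real a)) (_ : 4 * M ^+ 2 = (2 * M) ^+ 2); last by ring.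
    by rewrite lerXn2r// nnegrE mulr_ge0.
  have h1 : (a ^+ 2 + 2 * (a * s) + 2 * b) ^+ 2 <=
      3 * (a ^+ 2 * a ^+ 2) + 12 * (a ^+ 2 * s ^+ 2) + 12 * b ^+ 2.
    rewrite -subr_ge0 (_ : _ - _ = (a ^+ 2 - 2 * (a * s)) ^+ 2 + (a ^+ 2 - 2 * b) ^+ 2 +
      (2 * (a * s) - 2 * b) ^+ 2); last by ring.
    by rewrite !addr_ge0 ?sqr_ge0.
  apply: le_trans h1 _; rewrite lerD2r /c mulrDl.
  have a20 := sqr_ge0 a.
  have h2 : a ^+ 2 * a ^+ 2 <= a ^+ 2 * (4 * M ^+ 2) by rewrite ler_wpM2l.
  have h3 : a ^+ 2 * s ^+ 2 <= a ^+ 2 * (M + L) ^+ 2 by rewrite ler_wpM2l.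
  lra.
rewrite (jointD GsM ct0 ct1) (jointZ GsM c t0) (jointZ GsM 12 t1) -/(mean_sq_gap Gs G).
have := joint_gap1_le GsM GM M_ge0 K0 JK.
rewrite -/(gap_remainder J K) /loss_var -/c; lra.
Qed.

Lemma norm_scaled_truncated_le (L l : R) z : 0 <= L -> 0 < l ->
  l * (loss_const * (1 + L)) <= 3^-1 -> `|l * truncated L X z| <= 3^-1.
Proof.
move=> L0 l0 lX.
apply: le_trans lX; rewrite normrM (gtr0_norm l0) ler_wpM2l ?(ltW l0)//.
have [zL|Lz] := leP `|z| L; last first.
  by rewrite truncated_out// normr0 mulr_ge0 ?loss_const_ge0 ?addr_ge0.
rewrite truncated_in//; apply: le_trans (norm_excess_loss_linear _) _.
by rewrite ler_wpM2l ?loss_const_ge0// lerD2l.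
Qed.

(** Expanding the exponential to second order, the Bernstein condition and the
smallness of [l] make the quadratic term at most half of the linear one, up to remainders. *)
Lemma truncated_excess_mgf (L K l : R) (J : nat) : 0 <= L -> 0 < K -> 2 * J.+1%:R <= K ->
  0 < l -> l * loss_var L K <= 2^-1 -> l * (loss_const * (1 + L)) <= 3^-1 ->
  \int[jl]_w expR (- (l * truncated L X (w.1 + w.2))) <=
  expR (- (l * D / 2) + l * (loss_const * tail_const * expR (- L)) +
        12 * l ^+ 2 * gap_remainder J K).
Proof.
move=> L0 K0 JK l0 lV lX.
have bX z := norm_scaled_truncated_le z L0 l0 lX.
have tt := jtame_trunc L.
have ttl := jtameM (jtame_cst M l) tt.
have tt2 : jtame M (fun w : RT * RT => truncated L X (w.1 + w.2) ^+ 2) by exact: (jtameM tt tt).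
have ttl2 := jtameM (jtame_cst M (l ^+ 2)) tt2.
have te : jtame M (fun w : RT * RT => expR (- (l * truncated L X (w.1 + w.2)))).
  apply: (@jtame_bounded _ _ _ (expR 1)).
    apply: (measurableT_comp (@measurable_expR R)); apply: measurable_funN.
    by have [] := ttl.
  move=> w; rewrite ger0_norm ?expR_ge0// ler_expR.
  have := bX (w.1 + w.2); rewrite ler_norml => /andP[]; lra.
have t1 := jtame_cst M (1 : R).
apply: (@le_trans _ _ (\int[jl]_w (1 - l * truncated L X (w.1 + w.2) + l ^+ 2 * truncated L X (w.1 + w.2) ^+ 2))).
  apply: (joint_le_pointwise GsM te (jtameD (jtameB t1 ttl) ttl2)) => m x mM /=.
  by have := expRN_le_quadratic (bX (m + x)); rewrite exprMn.
rewrite (jointD GsM (jtameB t1 ttl) ttl2) (jointB GsM t1 ttl) (joint_cst GsM).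
rewrite (jointZ GsM l tt) (jointZ GsM (l ^+ 2) tt2).
have h1 := truncated_excess_mean L.
have h2 := truncated_excess_sq L0 K0 JK.
have D0 := mean_sq_gap_ge0 Gs G.
apply: le_trans (expR_ge1Dx _).
set E1 := \int[jl]_w _ in h1 *; set E2 := \int[jl]_w _ in h2 *.
set e := loss_const * tail_const * expR (- L) in h1 *; set r := gap_remainder J K in h2 *.
have h3 : l * (D - e) <= l * E1 by rewrite ler_wpM2l ?(ltW l0).
have h4 : l ^+ 2 * E2 <= l ^+ 2 * (loss_var L K * D + 12 * r) by rewrite ler_wpM2l ?sqr_ge0.
have h5 : l * loss_var L K * (l * D) <= 2^-1 * (l * D).
  by rewrite ler_wpM2r// mulr_ge0// ltW.
have h6 : l ^+ 2 * (loss_var L K * D + 12 * r) = l * loss_var L K * (l * D) + 12 * l ^+ 2 * r by ring.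
lra.
Qed.

End truncated_excess_loss.

(** * Independent observations *)

Section observations.
Context {R : realType} (M : R) (Gs : law R) d (T : measurableType d) (P : probability T R).
Hypotheses (GsM : supported_in M Gs) (M_ge0 : 0 <= M).
Local Notation RT := (measurableTypeR R).
Local Notation gam := (normal_prob (0 : R) 1).
Local Notation jl := (joint_law Gs).
Variables (n : nat) (mu Z : 'I_n -> {RV P >-> R}).
Hypotheses (mu_iid : iid_from Gs mu) (Z_normal : normal_given mu Z).

Let mRV (X : {RV P >-> R}) : measurable_fun [set: T] (X : T -> RT).
Proof. have H := measurable_funP X. exact: H. Qed.

Let jtame_indic (B : set RT) : measurable B ->
  jtame M (fun w : RT * RT => \1_B (w.1 + w.2)).
Proof.
move=> mB; apply: (@jtame_obs _ _ (\1_B) 1); first exact: measurable_indic.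
by move=> z; rewrite indicE; case: (_ \in _); rewrite ?normr1 ?normr0.
Qed.

Definition obs_prob (B : set RT) : R := \int[jl]_w \1_B (w.1 + w.2).

Let normal_prob_indic m (B : set RT) : measurable B ->
  normal_prob m 1 B = (\int[gam]_x (\1_B (m + x)%R)%:E)%E.
Proof.
move=> mB.
have m1 : measurable_fun [set: RT] (\1_B : RT -> R) by exact: measurable_indic.
apply: (eq_trans _ (integral_normal_prob_shift m m1)).
by rewrite integral_indic// setIT.
Qed.

Let fine_normal_prob m (B : set RT) : measurable B ->
  fine (normal_prob m 1 B) = \int[gam]_x \1_B (m + x).
Proof. by move=> mB; rewrite normal_prob_indic. Qed.

Let mu_product (B : 'I_n -> set RT) : (forall i, measurable (B i)) ->
  P [set w | forall i, B i (mu i w)] = (\prod_(i < n) fine (Gs (B i)))%:E.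
Proof.
move=> mB; have [mu_ind mu_law] := mu_iid.
have := mu_ind [set: 'I_n]%SET B mB.
rewrite (_ : [set w | forall i, i \in [set: 'I_n]%SET -> B i (mu i w)] = [set w | forall i, B i (mu i w)]); last first.
  by apply/seteqP; split => w /= H i; [apply: H; rewrite inE|move=> _; apply: H].
move=> ->; rewrite (eq_bigl predT); last by move=> i; rewrite inE.
rewrite -prodEFin; apply: eq_bigr => i _.
by rewrite fineK ?fin_num_measure//; exact: mu_law.
Qed.

(** Given the signals the observations are independent; averaging the product of
Gaussian probabilities over independent signals factorizes once more, so the
observations are independent with the law of signal plus noise. *)
Lemma obs_product (B : 'I_n -> set RT) : (forall i, measurable (B i)) ->
  P [set w | forall i, B i (Z i w)] = (\prod_(i < n) obs_prob (B i))%:E.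
Proof.
move=> mB.
have sT : g_sigma_preimage (fun i => mu i : T -> RT) setT.
  by rewrite -setC0; apply: sigma_algebraC; exact: sigma_algebra0.
have := Z_normal sT mB; rewrite setTI => ->.
transitivity (\int[P]_w (\prod_(i < n) fine (normal_prob (mu i w) 1 (B i)))%:E)%E.
  apply: eq_integral => w _; rewrite -prodEFin; apply: eq_bigr => i _.
  by rewrite fineK ?fin_num_measure.
have mg i : measurable_fun [set: RT] (fun m => \int[gam]_x \1_(B i) (m + x)).
  exact: (measurable_gauss_section GsM (jtame_indic (mB i))).
have := @independent_prod _ _ _ _ _ P n (fun i => mu i : T -> RT) (fun i => mRV (mu i)) Gs mu_product
  (fun i m => \int[gam]_x \1_(B i) (m + x)) mg _ _.
have g0 (i : 'I_n) (m : RT) : 0 <= \int[gam]_x \1_(B i) (m + x).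
  by apply: Rintegral_ge0.
move=> /(_ g0) H.
transitivity (\prod_(i < n) \int[Gs]_m \int[gam]_x \1_(B i) (m + x))%:E.
  rewrite -H.
    apply: eq_integral => w _; congr EFin; apply: eq_bigr => i _; exact: fine_normal_prob.
  move=> i; have [C HC] := gauss_section_bound (jtame_indic (mB i)).
  exact: (supported_integrable GsM (mg i) HC).
congr EFin; apply: eq_bigr => i _.
by rewrite /obs_prob (joint_iterated GsM (jtame_indic (mB i))).
Qed.

Lemma obs_marginal i (B : set RT) : measurable B -> P (Z i @^-1` B) = (obs_prob B)%:E.
Proof.
move=> mB.
pose B' j := if j == i then B else setT.
have mB' j : measurable (B' j) by rewrite /B'; case: ifP.
have := obs_product mB'.
rewrite (_ : [set w | _] = Z i @^-1` B); last first.
  apply/seteqP; split => w /= => [/(_ i)|H j]; rewrite /B'; first by rewrite eqxx.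
  by case: ifPn => // /eqP ->.
move=> ->; congr EFin; rewrite (bigD1 i)//= /B' eqxx big1 ?mulr1// => j ji.
rewrite (negbTE ji) /obs_prob.
by under eq_Rintegral do rewrite indicT; rewrite (joint_cst GsM).
Qed.

Let mjl : measurable_fun [set: RT * RT] (fun w : RT * RT => w.1 + w.2 : RT).
Proof. exact: measurable_signal_plus_noise. Qed.

Lemma integral_obs i (g : RT -> R) (C : R) : measurable_fun [set: RT] g ->
  (forall z, 0 <= g z <= C) ->
  \int[distribution P (Z i)]_z g z = \int[jl]_w g (w.1 + w.2).
Proof.
move=> mg gC.
have g0 z : 0 <= g z by have /andP[] := gC z.
rewrite /Rintegral; congr fine.
have nuE B : measurable B -> (\int[jl]_t (\1_B (t.1 + t.2)%R * cst 1%R t)%:E)%E = distribution P (Z i) B.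
  move=> mB; apply: (eq_trans _ (esym (obs_marginal i mB))).
  rewrite /obs_prob /Rintegral fineK; last first.
    exact: (integrable_fin_num measurableT (jtame_integrable GsM (jtame_indic mB))).
  by apply: eq_integral => w _; rewrite mulr1.
have mg' : measurable_fun [set: RT] (EFin \o g) by exact/measurable_EFinP.
have -> := @ge0_integral_weighted _ _ _ _ _ _ (distribution P (Z i)) _ _ mjl (measurable_cst (1 : R)) (fun=> ler01) nuE _ mg' _.
  by apply: eq_integral => w _; rewrite mule1.
by move=> z; rewrite lee_fin.
Qed.

Lemma obs_prod_integral (g : R -> R) (C : R) : (0 < n)%N -> measurable_fun [set: R] g ->
  (forall z, 0 <= g z <= C) ->
  (\int[P]_w (\prod_(i < n) g (Z i w))%:E)%E = ((\int[jl]_w g (w.1 + w.2)) ^+ n)%:E.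
Proof.
move=> n_gt0 mg gC.
have g0 z : 0 <= g z by have /andP[] := gC z.
pose i0 := Ordinal n_gt0.
have ZP (B : 'I_n -> set RT) : (forall i, measurable (B i)) ->
    P [set w | forall i, B i (Z i w)] = (\prod_(i < n) fine (distribution P (Z i0) (B i)))%:E.
  move=> mB; rewrite obs_product//; congr EFin; apply: eq_bigr => i _.
  by have -> : distribution P (Z i0) (B i) = (obs_prob (B i))%:E by exact: obs_marginal.
have := @independent_prod _ _ _ _ _ P n (fun i => Z i : T -> R) (fun i => measurable_funP (Z i))
  (distribution P (Z i0)) ZP (fun=> g) (fun=> mg) (fun=> g0) _.
move=> ->.
  by rewrite prodr_const card_ord (integral_obs i0 mg gC).
move=> _; apply: (@le_integrable _ _ _ _ _ measurableT _ (EFin \o cst C)) => //.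
- exact/measurable_EFinP.
- move=> z _ /=; rewrite lee_fin ger0_norm//; apply: le_trans (ler_norm _).
  by have /andP[] := gC z.
- exact: finite_measure_integrable_cst.
Qed.

End observations.

Section deviations.
Context {R : realType} (M : R) (Gs : law R) d (T : measurableType d) (P : probability T R).
Hypotheses (GsM : supported_in M Gs) (M_ge0 : 0 <= M).
Local Notation RT := (measurableTypeR R).
Local Notation jl := (joint_law Gs).
Variables (n : nat) (mu Z : 'I_n -> {RV P >-> R}).
Hypotheses (mu_iid : iid_from Gs mu) (Z_normal : normal_given mu Z).

Lemma measurable_obs_sum (h : R -> R) : measurable_fun [set: R] h ->
  measurable_fun [set: T] (fun w => \sum_(i < n) h (Z i w)).
Proof.
move=> mh.
have -> : (fun w => \sum_(i < n) h (Z i w)) = fun w => \sum_(i <- enum 'I_n) h (Z i w).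
  by apply/funext => w; rewrite big_enum.
elim: (enum 'I_n) => [|i s IH].
  by under eq_fun do rewrite big_nil; exact: measurable_cst.
under eq_fun do rewrite big_cons.
by apply: measurable_funD => //; apply: (measurableT_comp mh); exact: measurable_funP.
Qed.

Lemma measurable_obs_sum_le (h : R -> R) c : measurable_fun [set: R] h ->
  measurable [set w | \sum_(i < n) h (Z i w) <= c].
Proof.
move=> mh; have := measurable_obs_sum mh => ms.
rewrite (_ : [set w | _] = (fun w => \sum_(i < n) h (Z i w)) @^-1` `]-oo, c]).
  by rewrite -[X in measurable X]setTI; exact: ms.
by apply/seteqP; split => w /=; rewrite in_itv.
Qed.

(** Markov's inequality for the exponential of the sum, which is a product of
independent factors. *)
Lemma obs_chernoff (h : R -> R) (C c : R) : (0 < n)%N -> measurable_fun [set: R] h ->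
  (forall z, `|h z| <= C) ->
  (P [set w | (\sum_(i < n) h (Z i w) <= c)%R] <=
    (expR c * (\int[jl]_w expR (- h (w.1 + w.2))) ^+ n)%:E)%E.
Proof.
move=> n0 mh hC; set E := [set w | _].
have mE : measurable E by exact: measurable_obs_sum_le.
have me : measurable_fun [set: R] (fun z => expR (- h z)).
  by apply: (measurableT_comp (@measurable_expR R)); exact: measurable_funN.
have eC z : 0 <= expR (- h z) <= expR C.
  rewrite expR_ge0 ler_expR; have := hC z; rewrite ler_norml => /andP[]; lra.
have H := obs_prod_integral GsM mu_iid Z_normal n0 me eC.
rewrite EFinM -H -[E]setIT -integral_indic//.
have mprod : measurable_fun [set: T] (fun w => \prod_(i < n) expR (- h (Z i w))).
  apply: (@measurable_prod_comp _ _ _ R R n (fun i => Z i : T -> R) _ predT (fun=> fun z => expR (- h z))) => //.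
rewrite -ge0_integralZl//; last 2 first.
- exact/measurable_EFinP.
- by move=> w _; rewrite lee_fin prodr_ge0// => i _; exact: expR_ge0.
apply: ge0_le_integral => //.
- by apply/measurable_EFinP; exact: measurable_indic.
- by apply: emeasurable_funM => //; exact/measurable_EFinP.
move=> w _; rewrite -EFinM lee_fin -expR_sum -expRD indicE.
case: (boolP (w \in E)) => [|_]; last exact: expR_ge0.
rewrite inE /E/= => wE; rewrite -expR0 ler_expR sumrN; lra.
Qed.

Lemma obs_window_prob L :
  ((1 - n%:R * (tail_const M * expR (- L)))%:E <= P [set w | forall i, window L (Z i w)])%E.
Proof.
have mw : measurable (window L : set RT) by exact: measurable_itv.
rewrite (obs_product GsM mu_iid Z_normal (B := fun=> window L))//.
rewrite lee_fin prodr_const card_ord.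
have tI : jtame M (fun w : RT * RT => \1_(window L) (w.1 + w.2)).
  apply: (@jtame_obs _ _ (\1_(window L)) 1); first exact: measurable_indic.
  by move=> z; rewrite indicE; case: (_ \in _); rewrite ?normr1 ?normr0.
have tt := jtame_tail_weight M L.
set q := obs_prob Gs (window L); set x := tail_const M * expR (- L).
have q0 : 0 <= q by apply: joint_ge0 => w; rewrite indicE; case: (_ \in _).
have q1 : q <= 1.
  rewrite -(joint_cst GsM 1); apply: (joint_le_pointwise GsM tI (jtame_cst M 1)) => m y _ /=.
  by rewrite indicE; case: (_ \in _).
have qx : 1 - x <= q.
  rewrite lerBlDr -(joint_cst GsM 1).
  apply: (@le_trans _ _ (\int[jl]_w (\1_(window L) (w.1 + w.2) + tail_weight L (w.1 + w.2)))).
    apply: (joint_le_pointwise GsM (jtame_cst M 1) (jtameD tI tt)) => m y _ /=.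
    have [zL|Lz] := leP `|m + y| L.
      by rewrite indicE in_window zL lerDl tail_weight_ge0.
    have -> : \1_(window L) (m + y) = 0 :> R.
      by rewrite indicE in_window leNgt Lz.
    rewrite add0r tail_weight_out//.
    by rewrite -expR0 ler_expR.
  rewrite (jointD GsM tI tt) lerD2l; exact: joint_tail_weight.
apply: (@le_trans _ _ (1 - n%:R * (1 - q))).
  by rewrite lerD2l lerN2 ler_wpM2l//; lra.
have := @bernoulli_inequality R (1 - q) n _ _.
by rewrite subKr; apply; lra.
Qed.

End deviations.

Section single_deviation.
Context {R : realType} (M : R) (Gs G : law R) d (T : measurableType d) (P : probability T R).
Hypotheses (GsM : supported_in M Gs) (GM : supported_in M G) (M_ge0 : 0 <= M).
Variables (n : nat) (mu Z : 'I_n -> {RV P >-> R}).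
Hypotheses (mu_iid : iid_from Gs mu) (Z_normal : normal_given mu Z).
Local Notation D := (mean_sq_gap Gs G).
Local Notation X := (excess_loss Gs G).

(** When [mean_sq_gap Gs G] is large compared with [1 / (n * l)], the empirical
excess loss of [G] is unlikely to be small. *)
Lemma excess_loss_deviation (L K l c : R) (J : nat) : (0 < n)%N ->
  0 <= L -> 0 < K -> 2 * J.+1%:R <= K ->
  0 < l -> l * loss_var M L K <= 2^-1 -> l * (loss_const M * (1 + L)) <= 3^-1 ->
  (P [set w | (\sum_(i < n) truncated L X (Z i w) <= c)%R] <=
    (expR (l * c + n%:R * (- (l * D / 2) + l * (loss_const M * tail_const M * expR (- L)) +
        12 * l ^+ 2 * gap_remainder M J K)))%:E)%E.
Proof.
move=> n0 L0 K0 JK l0 lV lX.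
have mX := measurable_truncated L (measurable_excess_loss GsM GM M_ge0).
have mlX : measurable_fun [set: R] (fun z => l * truncated L X z) by exact: measurable_funM.
have bX z : `|l * truncated L X z| <= 3^-1 := norm_scaled_truncated_le GsM M_ge0 GM z L0 l0 lX.
have := obs_chernoff GsM mu_iid Z_normal (l * c) n0 mlX bX.
have -> : [set w | \sum_(i < n) l * truncated L X (Z i w) <= l * c] =
    [set w | \sum_(i < n) truncated L X (Z i w) <= c].
  by apply/seteqP; split => w /=; rewrite -mulr_sumr ler_pM2l.
move=> H; apply: (le_trans H); rewrite lee_fin expRD ler_wpM2l ?expR_ge0//.
rewrite expRM_natl lerXn2r// ?nnegrE ?expR_ge0//.
  by apply: joint_ge0 => w; exact: expR_ge0.
exact: truncated_excess_mgf.
Qed.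

End single_deviation.

(** * A finite net of laws *)

Section finite_net.
Context {R : realType} (M : R).
Hypothesis M_ge0 : 0 <= M.
Local Notation A := (4 * M + 1).
Variables (L r N q : nat) (e : R).
Hypotheses (e_gt0 : 0 < e) (rA : 4 * A <= r%:R) (qM : 2 * M / e < q.+1%:R).

Let A1 : 1 <= A. Proof. by rewrite lerDr mulr_ge0. Qed.
Let A0 : 0 < A. Proof. exact: lt_le_trans A1. Qed.

Definition net_point (i : nat) : R := i%:R / r%:R - L%:R.

(** Derivatives are rescaled to lie in [[-M, M]] and shifted by [M], so that
rounding can use natural numbers. *)
Definition net_value (H : law R) i j : R :=
  post_cumulant H j (net_point i) / (j`!%:R * A ^+ j) + M.

(** The net is made of the fibres of this map: no approximating laws are built,
only finitely many classes of laws whose posterior means are close. *)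
Definition net_code (H : law R) : {ffun 'I_(2 * L * r).+1 * 'I_N.+1 -> 'I_q.+1} :=
  [ffun p : 'I_(2 * L * r).+1 * 'I_N.+1 => inord (Num.truncn (net_value H p.1 p.2 / e))].

Let scale_gt0 j : 0 < j`!%:R * A ^+ j :> R.
Proof. by rewrite mulr_gt0 ?exprn_gt0// ltr0n fact_gt0. Qed.

Let net_value_bound H i j : supported_in M H -> 0 <= net_value H i j <= 2 * M.
Proof.
move=> HM; have : `|post_cumulant H j (net_point i) / (j`!%:R * A ^+ j)| <= M.
  rewrite normrM (gtr0_norm (_ : 0 < (j`!%:R * A ^+ j)^-1)) ?invr_gt0//.
  rewrite ler_pdivrMr// mulrA.
  by apply: norm_post_cumulant_le => //; rewrite lerDl.
rewrite /net_value ler_norml; lra.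
Qed.

Let code_close H1 H2 (i : 'I_(2 * L * r).+1) (j : 'I_N.+1) : supported_in M H1 -> supported_in M H2 ->
  net_code H1 = net_code H2 ->
  `|post_cumulant H1 j (net_point i) - post_cumulant H2 j (net_point i)| <= e * (j`!%:R * A ^+ j).
Proof.
move=> H1M H2M /ffunP/(_ (i, j)); rewrite !ffunE/= => /(congr1 val)/=.
have tr H : supported_in M H -> (Num.truncn (net_value H i j / e) < q.+1)%N.
  move=> HM; have /andP[v0 v1] := net_value_bound i j HM.
  rewrite -(ltr_nat R); apply: le_lt_trans qM.
  apply: le_trans (_ : net_value H i j / e <= _); last by rewrite ler_wpM2r// invr_ge0 ltW.
  by rewrite truncn_le// divr_ge0// ltW.
rewrite !inordK ?tr// => E.
have itv H : supported_in M H -> (Num.truncn (net_value H i j / e))%:R <= net_value H i j / e < (Num.truncn (net_value H i j / e)).+1%:R.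
  by move=> HM; apply: truncn_itv; have /andP[v0 _] := net_value_bound i j HM; rewrite divr_ge0// ltW.
have := itv _ H1M; have := itv _ H2M; rewrite E -natr1 => /andP[a1 a2] /andP[b1 b2].
have h : `|net_value H1 i j / e - net_value H2 i j / e| <= 1 by rewrite ler_norml; lra.
have -> : post_cumulant H1 j (net_point i) - post_cumulant H2 j (net_point i) =
   (net_value H1 i j / e - net_value H2 i j / e) * (e * (j`!%:R * A ^+ j)).
  by rewrite /net_value; field; rewrite !gt_eqF ?scale_gt0 ?exprn_gt0 ?ltr0n ?fact_gt0.
have es : 0 < e * (j`!%:R * A ^+ j) by rewrite mulr_gt0.
by rewrite normrM (gtr0_norm es) ler_piMl// ltW.
Qed.

Let net_cover z : `|z| <= L%:R -> exists i : 'I_(2 * L * r).+1, `|z - net_point i| <= (2 * (2 * A))^-1.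
Proof.
move=> zL; have r0 : 0 < r%:R :> R by apply: lt_le_trans rA; rewrite mulr_gt0.
have zL0 : 0 <= (z + L%:R) * r%:R.
  by move: zL; rewrite ler_norml => /andP[? ?]; rewrite mulr_ge0//; lra.
have /andP[h1 h2] := truncn_itv zL0.
have ti : (Num.truncn ((z + L%:R) * r%:R) < (2 * L * r).+1)%N.
  rewrite ltnS -(ler_nat R); apply: le_trans h1 _; rewrite !natrM ler_wpM2r//.
  by move: zL; rewrite ler_norml => /andP[? ?]; lra.
exists (Ordinal ti); rewrite /net_point/=.
set m := Num.truncn _ in h1 h2 *.
have -> : z - (m%:R / r%:R - L%:R) = ((z + L%:R) * r%:R - m%:R) / r%:R.
  by field; rewrite gt_eqF.
rewrite normrM (gtr0_norm (_ : 0 < r%:R^-1)) ?invr_gt0//.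
rewrite ger0_norm ?subr_ge0// ler_pdivrMr//.
apply: (@le_trans _ _ 1); first by move: h2; rewrite -natr1; lra.
have h8 : 0 < 2 * (2 * A) by rewrite !mulr_gt0.
rewrite mulrC ler_pdivlMr ?mul1r//. have h9 := rA; lra.
Qed.

(** Taylor expansion at the nearest net point. The rate is [2 * A] instead of
[A] in order to treat the first derivative as well: its jet gains a factor
[j + 1], which is at most [2^j]. *)
Lemma net_code_close H1 H2 z : supported_in M H1 -> supported_in M H2 ->
  net_code H1 = net_code H2 -> `|z| <= L%:R ->
  `|post_cumulant H1 0 z - post_cumulant H2 0 z| <= 2 * e + 2 * M * 2^-1 ^+ N /\
  `|post_cumulant H1 1 z - post_cumulant H2 1 z| <= A * (2 * e + 2 * M * 2^-1 ^+ N).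
Proof.
move=> H1M H2M HE zL; have [i zi] := net_cover zL.
pose f j := post_cumulant H1 j - post_cumulant H2 j.
have fJ : jet f by apply: jetB; exact: (jet_post_cumulant M_ge0).
have A20 : 0 < 2 * A by rewrite mulr_gt0.
have fc j : (j < N.+1)%N -> `|f j (net_point i)| <= e * (j`!%:R * A ^+ j).
  by move=> jN; exact: (@code_close H1 H2 i (Ordinal jN)).
have fb j t : `|f j t| <= 2 * M * (j`!%:R * A ^+ j).
  rewrite /f !fctE; apply: le_trans (ler_normB _ _) _.
  have h4 : 4 * M <= A by rewrite lerDl.
  have := norm_post_cumulant_le H1M M_ge0 j t h4.
  have := norm_post_cumulant_le H2M M_ge0 j t h4.
  rewrite -!mulrA; lra.
have pow2 j : A ^+ j <= (2 * A) ^+ j.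
  by rewrite lerXn2r ?nnegrE ?(ltW A0) ?(ltW A20)//; have := ltW A0; lra.
have fact2 j : j.+1`!%:R * A ^+ j.+1 <= A * (j`!%:R * (2 * A) ^+ j).
  rewrite factS natrM exprS exprMn.
  have -> : j.+1%:R * j`!%:R * (A * A ^+ j) = j.+1%:R * (A * (j`!%:R * A ^+ j)) by ring.
  have -> : A * (j`!%:R * (2 ^+ j * A ^+ j)) = 2 ^+ j * (A * (j`!%:R * A ^+ j)) by ring.
  rewrite ler_wpM2r ?mulr_ge0 ?exprn_ge0 ?(ltW A0)//.
  by rewrite -natrX ler_nat ltn_expl.
split.
  apply: (jet_bound fJ A20 (ltW e_gt0) _ _ _ zi); first by rewrite mulr_ge0.
  - move=> j jN; apply: le_trans (fc j (ltnW jN)) _.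
    by rewrite -mulrA ler_wpM2l ?(ltW e_gt0)// ler_wpM2l.
  - by move=> t; apply: le_trans (fb N t) _; rewrite -[leRHS]mulrA ler_wpM2l ?mulr_ge0// ler_wpM2l.
have -> : A * (2 * e + 2 * M * 2^-1 ^+ N) = 2 * (e * A) + 2 * M * A * 2^-1 ^+ N by ring.
apply: (jet_bound (jet_shift fJ) A20 _ _ _ _ zi).
- by rewrite mulr_ge0 ?(ltW e_gt0) ?(ltW A0).
- by rewrite !mulr_ge0 ?(ltW A0).
- move=> j jN; apply: le_trans (fc j.+1 jN) _.
  by rewrite -!mulrA ler_wpM2l ?(ltW e_gt0)//; exact: fact2.
- move=> t; apply: le_trans (fb N.+1 t) _.
  by rewrite -[leRHS]mulrA -[leRHS]mulrA ler_wpM2l ?mulr_ge0//; exact: fact2.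
Qed.

(** The gap to [Gs] drops out: the difference factors through the differences of
the posterior means of [H1] and [H2] and of their derivatives. *)
Lemma excess_loss_close (Gs H1 H2 : law R) z : supported_in M Gs ->
  supported_in M H1 -> supported_in M H2 ->
  net_code H1 = net_code H2 -> `|z| <= L%:R ->
  `|excess_loss Gs H1 z - excess_loss Gs H2 z| <=
   (6 * M + 2 * A + 2 * L%:R) * (2 * e + 2 * M * 2^-1 ^+ N).
Proof.
move=> GsM H1M H2M HE zL.
have [] := net_code_close H1M H2M HE zL.
set eta := 2 * e + _; rewrite /excess_loss /cumulant_gap !fctE.
have := post_cumulant0_le M_ge0 z H1M; have := post_cumulant0_le M_ge0 z H2M.
have := post_cumulant0_le M_ge0 z GsM.
set a := post_cumulant H1 0 z; set b := post_cumulant H2 0 z; set v := post_cumulant Gs 0 z.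
set a' := post_cumulant H1 1 z; set b' := post_cumulant H2 1 z; set v' := post_cumulant Gs 1 z.
move=> vM bM aM d0 d1.
have -> : (a - v) ^+ 2 + 2 * ((a - v) * (v - z)) + 2 * (a' - v') -
   ((b - v) ^+ 2 + 2 * ((b - v) * (v - z)) + 2 * (b' - v')) =
   (a - b) * (a + b - 2 * z) + 2 * (a' - b') by ring.
apply: le_trans (ler_normD _ _) _.
have h : `|a + b - 2 * z| <= 2 * M + 2 * L%:R.
  apply: le_trans (ler_normB _ _) _; rewrite normrM (ger0_norm (ler0n _ 2)).
  have := ler_normD a b; lra.
have eta0 : 0 <= eta by apply: le_trans d0.
have h1 : `|(a - b) * (a + b - 2 * z)| <= eta * (2 * M + 2 * L%:R) by rewrite normrM ler_pM.
have h2 : `|2 * (a' - b')| <= 2 * (A * eta) by rewrite normrM (ger0_norm (ler0n _ 2)) ler_wpM2l.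
have h3 : 0 <= M * eta by rewrite mulr_ge0.
rewrite (_ : (6 * M + 2 * A + 2 * L%:R) * eta = eta * (2 * M + 2 * L%:R) + 2 * (A * eta) + 4 * (M * eta)); last by ring.
lra.
Qed.

End finite_net.

(** * The uniform bound *)

(** All parameters are functions of [M] and of an integer [k] with [n <= 2^k]. *)
Section parameters.
Context {R : realType} (M : R).
Hypothesis M_ge0 : 0 <= M.
Local Notation A := (4 * M + 1).
Local Notation cT := (tail_const M).
Local Notation cX := (loss_const M).

Lemma two_le_expR1 : 2 <= expR 1 :> R.
Proof. by have := expR_ge1Dx (1 : R); rewrite -natr1. Qed.

Lemma pow2_le_expR m : 2 ^+ m <= expR m%:R :> R.
Proof.
rewrite -[m%:R]mulr1 expRM_natl lerXn2r ?nnegrE ?expR_ge0//.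
exact: two_le_expR1.
Qed.

Lemma fact_le_pow m j : (j <= m)%N -> (j`! <= m ^ j)%N.
Proof.
elim: j => [|j IH] jm //; rewrite factS expnS leq_mul//.
by apply: IH; exact: ltnW.
Qed.

(** The half-width of the window is [window_rate * k]: the summand [3] makes
[expR (- window_rate * k)] smaller than [8^-k], that is [4^-k] after the union
over [n <= 2^k] observations, and the other one absorbs [tail_const]. *)
Definition window_rate : nat := ((Num.truncn (2 * cT)).+1 + 3)%N.
Local Notation a := window_rate.

(** With [J = k] the remainder of the interpolation involves
[((k + 1)! A^(k + 1))^2], at most [((k + 1) A)^(2k + 2)]; the level is [16] times
[((k + 1) A)^2], so that this growth is cancelled, up to a factor of order [k^2], and [8^-k]
remains, enough to pay for [n <= 2^k]. *)
Definition interpolation_level (k : nat) : R := 16 * A ^+ 2 * k.+1%:R ^+ 2.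

(** The parameter [l] of Chernoff's bound has to satisfy the two smallness
conditions of [truncated_excess_mgf]; the summands correspond to them, with
[768 = 12 * 16 * 4] coming from [interpolation_level] and [(k + 1)^2 <= 4 k^2]. *)
Definition temperature_const : R :=
  2 * (12 * M ^+ 2 + 12 * (M + a%:R) ^+ 2 + 768 * A ^+ 2) + 3 * (cX * (1 + a%:R)) + 1.

Definition temperature (k : nat) : R := (temperature_const * k%:R ^+ 2)^-1.

Let A1 : 1 <= A. Proof. by rewrite lerDr mulr_ge0. Qed.
Let A0 : 0 < A. Proof. exact: lt_le_trans A1. Qed.

Lemma temperature_const_ge1 : 1 <= temperature_const.
Proof.
have cX0 := loss_const_ge0 M_ge0; have a0 : 0 <= a%:R :> R by [].
have h1 := sqr_ge0 M; have h2 := sqr_ge0 (M + a%:R); have h3 := sqr_ge0 A.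
have h4 : 0 <= cX * (1 + a%:R) by rewrite mulr_ge0// addr_ge0.
rewrite /temperature_const; lra.
Qed.

Variable k : nat.
Hypothesis k_gt0 : (0 < k)%N.

Let k1 : 1 <= k%:R :> R. Proof. by rewrite ler1n. Qed.
Let k21 : 1 <= k%:R ^+ 2 :> R. Proof. by rewrite exprn_ege1. Qed.

Let tk0 : 0 < temperature_const * k%:R ^+ 2.
Proof. by rewrite mulr_gt0 ?exprn_gt0// (lt_le_trans _ temperature_const_ge1, lt_le_trans _ k1). Qed.

Lemma temperature_gt0 : 0 < temperature k.
Proof. by rewrite invr_gt0. Qed.

Lemma temperature_le1 : temperature k <= 1.
Proof.
rewrite invf_le1//; apply: le_trans (k21) _.
by rewrite ler_peMl ?temperature_const_ge1// exprn_ge0.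
Qed.

Lemma interpolation_level_ge : 2 * k.+1%:R <= interpolation_level k.
Proof.
rewrite /interpolation_level.
have h1 : 1 <= A ^+ 2 by rewrite exprn_ege1.
have h2 : 1 <= k.+1%:R :> R by rewrite ler1n.
have h3 : k.+1%:R <= k.+1%:R ^+ 2 :> R by rewrite expr2 ler_peMl.
have h4 : k.+1%:R ^+ 2 <= A ^+ 2 * k.+1%:R ^+ 2 by rewrite ler_peMl// exprn_ge0.
rewrite -mulrA; lra.
Qed.

Lemma temperature_var :
  temperature k * loss_var M (a * k)%:R (interpolation_level k) <= 2^-1.
Proof.
rewrite mulrC ler_pdivrMr// /loss_var /interpolation_level natrM.
have h1 : M ^+ 2 <= M ^+ 2 * k%:R ^+ 2 by rewrite ler_peMr ?sqr_ge0.
have h2 : (M + a%:R * k%:R) ^+ 2 <= (M + a%:R) ^+ 2 * k%:R ^+ 2.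
  rewrite -exprMn lerXn2r ?nnegrE ?addr_ge0 ?mulr_ge0 ?addr_ge0//.
  by rewrite mulrDl lerD2r ler_peMr.
have h3 : k.+1%:R ^+ 2 <= 4 * k%:R ^+ 2 :> R.
  rewrite (_ : 4 * k%:R ^+ 2 = (2 * k%:R) ^+ 2); last by ring.
  by rewrite lerXn2r ?nnegrE ?mulr_ge0// -natr1; have := k1; lra.
have h4 : A ^+ 2 * k.+1%:R ^+ 2 <= A ^+ 2 * (4 * k%:R ^+ 2) by rewrite ler_wpM2l ?sqr_ge0.
have cX0 : 0 <= cX * (1 + a%:R) * k%:R ^+ 2 by rewrite !mulr_ge0 ?loss_const_ge0 ?addr_ge0 ?sqr_ge0.
rewrite /temperature_const.
have -> : 12 * (16 * A ^+ 2 * k.+1%:R ^+ 2) = 192 * (A ^+ 2 * k.+1%:R ^+ 2) by ring.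
rewrite -subr_ge0.
set x := _ - _.
have -> : x = 12 * (M ^+ 2 * k%:R ^+ 2 - M ^+ 2) + 12 * ((M + a%:R) ^+ 2 * k%:R ^+ 2 - (M + a%:R * k%:R) ^+ 2)
  + 192 * (A ^+ 2 * (4 * k%:R ^+ 2) - A ^+ 2 * k.+1%:R ^+ 2) + 3 / 2 * (cX * (1 + a%:R) * k%:R ^+ 2) + k%:R ^+ 2 / 2.
  by rewrite /x; field.
have := k21; lra.
Qed.

Lemma temperature_loss :
  temperature k * (cX * (1 + (a * k)%:R)) <= 3^-1.
Proof.
rewrite mulrC ler_pdivrMr// natrM.
have cX0 := loss_const_ge0 M_ge0.
have h0 : 1 + a%:R * k%:R <= (1 + a%:R) * k%:R ^+ 2 :> R.
  rewrite mulrDl mul1r lerD// ler_wpM2l// expr2 ler_peMl//.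
have h1 := ler_wpM2l cX0 h0.
have h2 := sqr_ge0 M; have h3 := sqr_ge0 (M + a%:R); have h4 := sqr_ge0 A.
have h5 : 0 <= (2 * (12 * M ^+ 2 + 12 * (M + a%:R) ^+ 2 + 768 * A ^+ 2) + 1) * k%:R ^+ 2.
  by apply: mulr_ge0; [lra|exact: sqr_ge0].
have -> : 3^-1 * (temperature_const * k%:R ^+ 2) =
   3^-1 * ((2 * (12 * M ^+ 2 + 12 * (M + a%:R) ^+ 2 + 768 * A ^+ 2) + 1) * k%:R ^+ 2) +
   cX * ((1 + a%:R) * k%:R ^+ 2).
  by rewrite /temperature_const; field.
lra.
Qed.

Lemma gap_remainder_le : 2 ^+ k * gap_remainder M k (interpolation_level k) <= 4 * M ^+ 2 * A ^+ 2.
Proof.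
rewrite /gap_remainder /interpolation_level.
pose B : R := k.+1%:R * A.
have B0 : 0 < B by rewrite mulr_gt0 ?ltr0n.
have hf : (k.+1)`!%:R * A ^+ k.+1 <= B ^+ k.+1.
  rewrite exprMn ler_wpM2r ?exprn_ge0 ?(ltW A0)// -natrX ler_nat.
  exact: fact_le_pow.
have -> : 2 / (16 * A ^+ 2 * k.+1%:R ^+ 2) = (8 * B ^+ 2)^-1.
  by rewrite /B; field; rewrite ?gt_eqF ?ltr0n.
apply: (@le_trans _ _ (2 ^+ k * ((2 * M * B ^+ k.+1) ^+ 2 * (8 * B ^+ 2)^-1 ^+ k))).
  have f0 : 0 <= (k.+1)`!%:R * A ^+ k.+1 by rewrite mulr_ge0// exprn_ge0 ?(ltW A0).
  have hs : (2 * M * (k.+1)`!%:R * A ^+ k.+1) ^+ 2 <= (2 * M * B ^+ k.+1) ^+ 2.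
    have M20 : 0 <= 2 * M by rewrite mulr_ge0.
    by rewrite -mulrA lerXn2r ?nnegrE ?(mulr_ge0 M20)// ?exprn_ge0 ?(ltW B0)// ler_wpM2l.
  have h8 : 0 <= (8 * B ^+ 2)^-1 ^+ k by rewrite exprn_ge0// invr_ge0 mulr_ge0// sqr_ge0.
  by rewrite ler_wpM2l ?exprn_ge0// ler_wpM2r.
have -> : 2 ^+ k * ((2 * M * B ^+ k.+1) ^+ 2 * (8 * B ^+ 2)^-1 ^+ k) =
    4 * M ^+ 2 * (B ^+ 2 / 4 ^+ k).
  have -> : (8 * B ^+ 2)^-1 ^+ k = (2 ^+ k * 4 ^+ k * (B ^+ k) ^+ 2)^-1.
    by rewrite exprVn (_ : 8 * B ^+ 2 = 2 * 4 * B ^+ 2) ?(exprAC B k 2) ?exprMn//; ring.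
  by rewrite [B ^+ k.+1]exprS; field; rewrite !expf_neq0 ?gt_eqF.
have : B ^+ 2 / 4 ^+ k <= A ^+ 2.
  rewrite ler_pdivrMr ?exprn_gt0// /B exprMn mulrC ler_wpM2l ?sqr_ge0//.
  have -> : 4 ^+ k = (2 ^+ k) ^+ 2 :> R by rewrite -exprM mulnC exprM; congr (_ ^+ _); ring.
  by rewrite lerXn2r ?nnegrE ?exprn_ge0// -natrX ler_nat ltn_expl.
by move=> h; rewrite -[leRHS]mulrA -[leLHS]mulrA ler_wpM2l// ler_wpM2l ?sqr_ge0.
Qed.

Lemma expR_window_le : 2 ^+ k * expR (- (a * k)%:R) <= 1 :> R.
Proof.
rewrite expRN ler_pdivrMr ?expR_gt0// mul1r.
apply: le_trans (pow2_le_expR k) _; rewrite ler_expR ler_nat.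
by rewrite leq_pmull// /window_rate addn3.
Qed.

Lemma tail_window_le : 2 ^+ k * (cT * expR (- (a * k)%:R)) <= 2^-1 * 4^-1 ^+ k.
Proof.
set b := (Num.truncn (2 * cT)).+1.
have cTb : 2 * cT <= 2 ^+ b.
  apply: (@le_trans _ _ b%:R); first exact/ltW/truncnS_gt.
  by rewrite -natrX ler_nat ltnW// ltn_expl.
have h : 2 ^+ k * 2 ^+ b * 4 ^+ k <= expR (a * k)%:R :> R.
  apply: le_trans (pow2_le_expR (a * k)).
  have -> : 4 ^+ k = 2 ^+ (2 * k) :> R by rewrite exprM; congr (_ ^+ _); ring.
  rewrite -!exprD ler_eXn2l// ?ltr1n//.
  rewrite /window_rate -/b mulnDl.
  have : (b <= b * k)%N by rewrite leq_pmulr.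
  lia.
have p2 : 0 < 2 ^+ k :> R by rewrite exprn_gt0.
have p4 : 0 < 4 ^+ k :> R by rewrite exprn_gt0.
have cT0 : 0 <= cT := tail_const_ge0 M.
have E0 := expR_gt0 ((a * k)%:R : R); rewrite expRN exprVn.
move: h E0; set E := expR _ => h E0.
have key : 2 * cT * (2 ^+ k * 4 ^+ k) <= E.
  apply: le_trans h; rewrite (_ : 2 ^+ k * 2 ^+ b * 4 ^+ k = 2 ^+ b * (2 ^+ k * 4 ^+ k)); last by ring.
  by rewrite ler_wpM2r// mulr_ge0 ?(ltW p2) ?(ltW p4).
rewrite -subr_ge0 (_ : _ - _ = (E - 2 * cT * (2 ^+ k * 4 ^+ k)) / (2 * 4 ^+ k * E)).
  by rewrite divr_ge0 ?subr_ge0// !mulr_ge0 ?(ltW p4) ?(ltW E0).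
by field; rewrite !gt_eqF.
Qed.

End parameters.

Section uniform_deviation.
Context {R : realType} (M : R).
Hypothesis M_ge0 : 0 <= M.
Local Notation A := (4 * M + 1).
Local Notation cT := (tail_const M).
Local Notation cX := (loss_const M).
Local Notation a := (window_rate M).

(** The spacing of the net points is less than [1 / (4 A)], half of the radius
[1 / (2 A)] at which the jets in [net_code_close] are expanded. *)
Definition grid_rate : nat := (Num.truncn (4 * A)).+1.
Definition code_range : nat := (Num.truncn (2 * M)).+1.

(** With [e = 4^-k] and [N = 2 k] the excess losses of two laws with the same
code differ by at most a multiple of [k * 4^-k] on the window, hence in total by
a constant over [n <= 2^k] observations, as [k <= 2^k]. *)
Definition net_slack : R := (2 + 2 * M) * (6 * M + 2 * A + 2 * a%:R).
Definition entropy_const : nat := ((code_range + 2) * ((2 * a * grid_rate + 1) * 3))%N.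
(** The sum of the terms of the exponent in [excess_loss_deviation] that stay
bounded: the slack, the loss by truncation, and [12] times the bound of
[gap_remainder_le]. *)
Definition deviation_const : R := net_slack + cX * cT + 48 * (M ^+ 2 * A ^+ 2).
(** Chosen so that at the critical value [rate_const * k^5 / n] of the mean
square gap, half of [n * l] times it is exactly
[(entropy_const + deviation_const + 3) * k^3]; the last [3 * k^3] pays for the
probability [4^-k / 2] of the union bound. *)
Definition rate_const : R :=
  2 * temperature_const M * (entropy_const%:R + deviation_const + 3).

Let A1 : 1 <= A. Proof. by rewrite lerDr mulr_ge0. Qed.
Let A0 : 0 < A. Proof. exact: lt_le_trans A1. Qed.

Lemma net_slack_ge0 : 0 <= net_slack.
Proof.
have := M_ge0; have := ltW A0; rewrite /net_slack => h1 h2.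
have h3 : 0 <= a%:R :> R by [].
apply: mulr_ge0; lra.
Qed.

Lemma deviation_const_ge0 : 0 <= deviation_const.
Proof.
rewrite /deviation_const !addr_ge0 ?net_slack_ge0//.
  by rewrite mulr_ge0 ?loss_const_ge0 ?tail_const_ge0.
by rewrite mulr_ge0// mulr_ge0 ?sqr_ge0.
Qed.

Lemma rate_const_gt0 : 0 < rate_const.
Proof.
have h1 := temperature_const_ge1 M_ge0; have h2 := deviation_const_ge0.
have h3 : 0 <= entropy_const%:R :> R by [].
by rewrite /rate_const; apply: mulr_gt0; lra.
Qed.

Variable k : nat.
Hypothesis k_gt0 : (0 < k)%N.
Local Notation L := (a * k)%N.
Local Notation N := (2 * k)%N.
Local Notation q := (code_range * 4 ^ k)%N.
Local Notation e := (4^-1 ^+ k : R).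

(** A code consists of [O(k)] points times [O(k)] derivatives, with [O(k)] binary
digits each. *)
Lemma code_count :
  (#|{: {ffun 'I_(2 * L * grid_rate).+1 * 'I_N.+1 -> 'I_q.+1}}|%:R : R) <= expR (entropy_const * k ^ 3)%:R.
Proof.
apply: le_trans (pow2_le_expR _).
rewrite -natrX ler_nat card_ffun card_prod !card_ord.
have h1 : (q.+1 <= 2 ^ ((code_range + 2) * k))%N.
  have h : (code_range.+1 <= 2 ^ (code_range * k))%N.
    apply: (leq_trans (ltn_expl code_range (ltnSn 1))).
    by rewrite leq_exp2l// leq_pmulr.
  apply: (@leq_trans (code_range.+1 * 4 ^ k)%N).
    by rewrite mulSn -addn1 addnC leq_add2r expn_gt0.
  rewrite mulnDl expnD expnM; apply: (leq_mul _ _) => //.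
    by rewrite -expnM.
  by rewrite expnM.
have h2 : ((2 * L * grid_rate).+1 * N.+1 <= ((2 * a * grid_rate + 1) * 3) * k ^ 2)%N.
  have -> : (((2 * a * grid_rate + 1) * 3) * k ^ 2 = ((2 * a * grid_rate + 1) * k) * (3 * k))%N by ring.
  apply: leq_mul; last by lia.
  rewrite mulnDl mul1n -addn1 leq_add//.
  by rewrite (_ : 2 * L * grid_rate = 2 * a * grid_rate * k)%N//; ring.
apply: (@leq_trans ((2 ^ ((code_range + 2) * k)) ^ ((2 * L * grid_rate).+1 * N.+1))%N).
  by rewrite leq_exp2r// muln_gt0.
rewrite -expnM leq_exp2l// /entropy_const.
apply: (leq_trans (leq_mul (leqnn _) h2)).
by rewrite (_ : (code_range + 2) * k * ((2 * a * grid_rate + 1) * 3 * k ^ 2) = (code_range + 2) * ((2 * a * grid_rate + 1) * 3) * k ^ 3)%N//; ring.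
Qed.

Variables (Gs : law R) (d : measure_display) (T : measurableType d) (P : probability T R).
Hypothesis GsM : supported_in M Gs.
Variables (n : nat) (mu Z : 'I_n -> {RV P >-> R}).
Hypotheses (mu_iid : iid_from Gs mu) (Z_normal : normal_given mu Z).
Hypotheses (n_gt0 : (0 < n)%N) (nk : (n <= 2 ^ k)%N).

Let t : R := rate_const * k%:R ^+ 5 / n%:R.
Let nR : 0 < n%:R :> R. Proof. by rewrite ltr0n. Qed.
Let nk' : n%:R <= 2 ^+ k :> R. Proof. by rewrite -natrX ler_nat. Qed.
Let k1 : 1 <= k%:R :> R. Proof. by rewrite ler1n. Qed.

Let deviation G : supported_in M G -> t < mean_sq_gap Gs G ->
  (P [set w | (\sum_(i < n) truncated L%:R (excess_loss Gs G) (Z i w) <= net_slack)%R] <=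
   (expR (deviation_const - (entropy_const%:R + deviation_const + 3) * k%:R ^+ 3))%:E)%E.
Proof.
move=> GM tD.
have l0 := temperature_gt0 M_ge0 k_gt0; have l1 := temperature_le1 M_ge0 k_gt0.
have K2 := interpolation_level_ge M_ge0 k.
have K0 : 0 < interpolation_level M k by apply: lt_le_trans K2; rewrite mulr_gt0// ltr0n.
have lV := temperature_var M_ge0 k_gt0; have lX := temperature_loss M_ge0 k_gt0.
apply: (le_trans (excess_loss_deviation GsM GM M_ge0 mu_iid Z_normal net_slack n_gt0 (ler0n _ _) K0 K2 l0 lV lX)).
rewrite lee_fin ler_expR; set l := temperature M k in l0 l1 *.
have h1 : l * net_slack <= net_slack by rewrite ler_piMl// net_slack_ge0.
have g0 := gap_remainder_le M_ge0 k.
set tau := gap_remainder M k _ in g0 *.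
have tau0 : 0 <= tau.
  by rewrite /tau /gap_remainder mulr_ge0 ?sqr_ge0// exprn_ge0// divr_ge0// ltW.
have h2 : n%:R * tau <= 4 * M ^+ 2 * A ^+ 2.
  by apply: le_trans g0; rewrite ler_wpM2r.
set eps := expR (- L%:R).
have h3 : n%:R * eps <= 1.
  by apply: le_trans (expR_window_le M k); rewrite ler_wpM2r// expR_ge0.
have c0 : 0 <= cX * cT by rewrite mulr_ge0 ?loss_const_ge0 ?tail_const_ge0.
have h4 : l * (cX * cT) * (n%:R * eps) <= cX * cT.
  apply: (@le_trans _ _ (l * (cX * cT))); first by rewrite ler_piMr// mulr_ge0// ltW.
  by rewrite ler_piMl.
have h5 : l ^+ 2 * (n%:R * tau) <= 4 * M ^+ 2 * A ^+ 2.
  have l2 : l ^+ 2 <= 1 by rewrite exprn_ile1// ltW.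
  have nt : 0 <= n%:R * tau by rewrite mulr_ge0.
  exact: le_trans (ler_piMl nt l2) h2.
have h6 : (entropy_const%:R + deviation_const + 3) * k%:R ^+ 3 <= n%:R * (l * mean_sq_gap Gs G / 2).
  have -> : (entropy_const%:R + deviation_const + 3) * k%:R ^+ 3 = n%:R * (l * t / 2).
    have tc := temperature_const_ge1 M_ge0.
    rewrite /l /t /temperature /rate_const; field.
    by rewrite !gt_eqF//; [exact: lt_le_trans tc|exact: lt_le_trans k1].
  by rewrite ler_wpM2l// ler_wpM2r// ler_wpM2l// ltW.
rewrite -/eps mulrDr mulrDr.
have -> : n%:R * (l * (cX * cT * eps)) = l * (cX * cT) * (n%:R * eps) by ring.
have -> : n%:R * (12 * l ^+ 2 * tau) = 12 * (l ^+ 2 * (n%:R * tau)) by ring.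
move: h6; set Y := _ * k%:R ^+ 3 => h6; rewrite mulrN /deviation_const; lra.
Qed.

Let code (G : law R) := net_code M L grid_rate N q e G.

Let slack G H z : supported_in M G -> supported_in M H -> code G = code H -> `|z| <= L%:R ->
  n%:R * `|excess_loss Gs G z - excess_loss Gs H z| <= net_slack.
Proof.
move=> GM HM GH zL.
have e0 : 0 < e by rewrite exprn_gt0.
have rA : 4 * A <= grid_rate%:R by exact/ltW/truncnS_gt.
have qM : 2 * M / e < q.+1%:R.
  rewrite exprVn invrK; apply: (@lt_le_trans _ _ q%:R); last by rewrite ler_nat.
  by rewrite natrM natrX ltr_pM2r ?exprn_gt0// truncnS_gt.
have := excess_loss_close M_ge0 e0 rA qM GsM GM HM GH zL.
have -> : 2^-1 ^+ N = e.
  by rewrite exprM; congr (_ ^+ _); rewrite exprVn; congr (_^-1); ring.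
move=> h; apply: (le_trans (ler_wpM2l (ltW nR) h)).
have kk : k%:R <= 2 ^+ k :> R by rewrite -natrX ler_nat ltnW// ltn_expl.
have e2 : 2 ^+ k * (2 ^+ k * e) = 1.
  by rewrite mulrA -exprMn -exprMn (_ : 2 * 2 * 4^-1 = 1) ?expr1n//; field.
have p0 : 0 <= 6 * M + 2 * A + 2 * L%:R.
  have := M_ge0; have := ltW A0; have : 0 <= L%:R :> R by []; lra.
have p1 : 6 * M + 2 * A + 2 * L%:R <= (6 * M + 2 * A + 2 * a%:R) * 2 ^+ k.
  have p2 : 1 <= 2 ^+ k :> R by rewrite exprn_ege1// ler1n.
  rewrite [leRHS]mulrDl; apply: lerD.
    rewrite ler_peMr//; have := M_ge0; have := ltW A0; lra.
  by rewrite natrM mulrA ler_wpM2l.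
rewrite (_ : 2 * e + 2 * M * e = (2 + 2 * M) * e); last by ring.
have b0 : 0 <= (2 + 2 * M) * e.
  by apply: mulr_ge0; [have := M_ge0; lra|exact: ltW].
apply: (@le_trans _ _ (2 ^+ k * ((6 * M + 2 * A + 2 * a%:R) * 2 ^+ k * ((2 + 2 * M) * e)))).
  apply: ler_pM => //; first by rewrite mulr_ge0.
  by rewrite ler_wpM2r.
rewrite /net_slack (_ : 2 ^+ k * _ = (2 + 2 * M) * (6 * M + 2 * A + 2 * a%:R) * (2 ^+ k * (2 ^+ k * e))); last by ring.
by rewrite e2 mulr1.
Qed.

(** The exceptional event is indexed by codes, hence a finite union of measurable
events: each code shared by some law far from [Gs] is represented by one such
law, whose truncated empirical excess loss is unlikely to be below the slack. If
a far law [G] had a nonpositive empirical excess loss, then the representative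
of its code, equally far, would have one below the slack. *)
Lemma uniform_deviation : exists E : set T,
  [/\ measurable E, ((1 - 4^-1 ^+ k)%:E <= P E)%E &
   forall w, E w -> forall G, supported_in M G ->
     \sum_(i < n) excess_loss Gs G (Z i w) <= 0 ->
     mean_sq_gap Gs G <= rate_const * k%:R ^+ 5 / n%:R].
Proof.
pose far c G := [/\ supported_in M G, code G = c & t < mean_sq_gap Gs G].
pose dev G := [set w | \sum_(i < n) truncated L%:R (excess_loss Gs G) (Z i w) <= net_slack].
pose B c : set T := if pselect (exists G, far c G) is left ex then dev (projT1 (cid ex)) else set0.
pose p := expR (deviation_const - (entropy_const%:R + deviation_const + 3) * k%:R ^+ 3).
have mB c : measurable (B c).
  rewrite /B; case: pselect => // ex; case: (cid ex) => G [GM _ _] /=.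
  apply: measurable_obs_sum_le; apply: measurable_truncated.
  exact: (measurable_excess_loss GsM GM M_ge0).
have PB c : (P (B c) <= p%:E)%E.
  rewrite /B; case: pselect => [ex|_]; last by rewrite measure0 lee_fin expR_ge0.
  case: (cid ex) => G [GM _ tG] /=; exact: deviation.
have [mU PU] := finite_union_bound mB PB.
set U := \bigcup_(c in _) B c in mU PU.
pose W := [set w | forall i, window L%:R (Z i w)].
have mW : measurable W.
  rewrite (_ : W = \bigcap_(i in [set: 'I_n]) (Z i @^-1` window L%:R)).
    apply: fin_bigcap_measurable => // i _.
    by rewrite -[X in measurable X]setTI; apply: measurable_funP => //; exact: measurable_itv.
  by apply/seteqP; split => w /= H i => [_|]; apply: H.
exists (W `&` ~` U); split.
- by apply: measurableI => //; exact: measurableC.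
- have PW := obs_window_prob GsM mu_iid Z_normal L%:R.
  have sub : (P W <= P (W `&` ~` U) + P U)%E.
    apply: le_trans (measureU2 _ _ _) => //; last by apply: measurableI => //; exact: measurableC.
    apply: le_measure; rewrite ?inE//.
      by apply: measurableU => //; apply: measurableI => //; exact: measurableC.
    by move=> w Ww; have [Uw|Uw] := pselect (U w); [right|left].
  have fP S : measurable S -> P S = (fine (P S))%:E by move=> mS; rewrite fineK ?fin_num_measure.
  have mE : measurable (W `&` ~` U) by apply: measurableI => //; exact: measurableC.
  rewrite (fP _ mE) lee_fin.
  move: PW PU sub; rewrite (fP _ mE) (fP _ mW) (fP _ mU) -EFinD !lee_fin => PW PU sub.
  have h1 : n%:R * (cT * expR (- L%:R)) <= 2^-1 * e.
    apply: (@le_trans _ _ (2 ^+ k * (cT * expR (- L%:R)))); last exact: tail_window_le.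
    by rewrite ler_wpM2r// mulr_ge0 ?expR_ge0 ?tail_const_ge0.
  have h2 : #|{: {ffun 'I_(2 * L * grid_rate).+1 * 'I_N.+1 -> 'I_q.+1}}|%:R * p <= 2^-1 * e.
    have k3 : k%:R <= k%:R ^+ 3 :> R by rewrite -natrX ler_nat -[X in (X <= _)%N]expn1 leq_pexp2l.
    apply: (@le_trans _ _ (expR (- (1 + (2 * k)%:R)))).
      apply: (@le_trans _ _ (expR (entropy_const * k ^ 3)%:R * p)).
        by rewrite ler_wpM2r ?expR_ge0// code_count.
      rewrite /p -expRD ler_expR [(_ * k ^ 3)%:R]natrM [(k ^ 3)%:R]natrX [(2 * k)%:R]natrM.
      have := deviation_const_ge0; have := k1; set x := k%:R ^+ 3 in k3 *.
      set D0 := deviation_const => hk hD.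
      have : D0 <= D0 * x by rewrite ler_peMr//; lra.
      rewrite (_ : (_ + D0 + 3) * x = entropy_const%:R * x + D0 * x + 3 * x); last by ring.
      move: (entropy_const%:R * x) => y; lra.
    rewrite opprD expRD; apply: ler_pM; rewrite ?expR_ge0//.
      by rewrite expRN lef_pV2 ?posrE ?expR_gt0//; exact: two_le_expR1.
    have -> : e = (2 ^+ (2 * k))^-1 :> R by rewrite exprM exprVn; congr ((_ ^+ _)^-1); ring.
    by rewrite expRN lef_pV2 ?posrE ?expR_gt0 ?exprn_gt0//; exact: pow2_le_expR.
  lra.
move=> w [Ww Uw] G GM XG; rewrite leNgt; apply/negP => tG; apply: Uw.
exists (code G) => //; rewrite /B.
have ex : exists G', far (code G) G' by exists G.
case: pselect => // ex'; case: (cid ex') => H [HM HG tH] /=.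
have wz i : `|Z i w| <= L%:R by have := Ww i; rewrite -in_window inE.
rewrite /dev/=.
apply: (@le_trans _ _ (\sum_(i < n) (excess_loss Gs G (Z i w) + net_slack / n%:R))).
  apply: ler_sum => i _; rewrite truncated_in//.
  have := slack HM GM HG (wz i); rewrite mulrC -ler_pdivlMr//.
  by have := ler_norm (excess_loss Gs H (Z i w) - excess_loss Gs G (Z i w)); lra.
rewrite big_split/= sumr_const card_ord -[_ *+ n]mulr_natr divfK ?gt_eqF//.
lra.
Qed.

End uniform_deviation.

(** * Conclusion *)

Lemma ln2_ge_half (R : realType) : 2^-1 <= ln 2 :> R.
Proof.
rewrite -ler_expR lnK ?posrE//.
have h : 2^-1 <= expR (- 2^-1) :> R by apply: le_trans (expR_ge1Dx _); lra.
have := expR_gt0 (2^-1 : R); move: h; rewrite expRN => h h0.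
have := ler_wpM2r (ltW h0) h; rewrite mulVf ?gt_eqF//; lra.
Qed.

(** The factor is [4] because [ln 2] is at least [1 / 2] and rounding [log2 n] up
at most doubles it, as [n >= 2]. *)
Lemma sample_scale (R : realType) (n : nat) : (1 < n)%N -> exists k : nat,
  [/\ (0 < k)%N, (n <= 2 ^ k)%N & k%:R <= 4 * ln n%:R :> R].
Proof.
move=> n1; exists (trunc_log 2 n).+1; split => //.
  by apply: ltnW; exact: trunc_log_ltn.
have n0 : (0 < n)%N by apply: ltnW.
set m := trunc_log 2 n.
have m0 : (0 < m)%N by rewrite /m trunc_log_gt0.
have h : m%:R * ln 2 <= ln n%:R :> R.
  have -> : m%:R * ln 2 = ln (2 ^+ m) :> R by rewrite lnXn// mulr_natl.
  by rewrite ler_ln ?posrE ?exprn_gt0 ?ltr0n// -natrX ler_nat trunc_logP.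
have l2 := ln2_ge_half R.
have m1 : 1 <= m%:R :> R by rewrite ler1n.
have := ler_wpM2l (ler0n _ m : 0 <= m%:R :> R) l2.
rewrite -(natr1 m); lra.
Qed.

Theorem theorem3 (R : realType) (M : R) (M_gt0 : 0 < M) :
  exists C : R, 0 < C /\
  forall (n : nat) (n_gt0 : (0 < n)%N)
    (d : measure_display) (T : measurableType d) (P : probability T R)
    (Gstar : law R) (mu Z : 'I_n -> {RV P >-> R}) (Ghat : T -> law R),
    supported_in M Gstar ->
    iid_from Gstar mu ->
    normal_given mu Z ->
    (forall w : T, minimizes_over M (SURE (fun i => Z i w)) (Ghat w)) ->
    (forall (w : T) (G : law R),
       minimizes_over M (SURE (fun i => Z i w)) G <->
       minimizes_over M (SM (fun i => Z i w)) G) /\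
    exists A : set T,
      [/\ measurable A,
          ((1 - n%:R ^- 2)%:E <= P A)%E &
          forall w : T, A w ->
            regret Gstar (Ghat w) = fisher_divergence Gstar (Ghat w) /\
            (fisher_divergence Gstar (Ghat w)
               <= (C * (ln n%:R ^+ 6 / n%:R))%:E)%E].
Proof.
have M_ge0 := ltW M_gt0.
exists (rate_const M * 4 ^+ 6); split; first by rewrite mulr_gt0 ?rate_const_gt0 ?exprn_gt0.
move=> n n_gt0 d T P Gs mu Z Ghat GsM mu_iid Z_normal Gmin; split.
  move=> w G; have E H : SURE (fun i => Z i w) H = 1 + SM (fun i => Z i w) H by [].
  split; case=> GM H; split; try exact: GM; move=> G' G'M; move: (H G' G'M).
    by rewrite (E G) (E G') lerD2l.
  by move=> le; rewrite (E G) (E G') lerD2l.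
have [n1|n1] := leqP n 1.
  (* For one observation the logarithm vanishes, but so does the probability
     that is asked for. *)
  exists set0; split => //.
  have -> : n = 1%N by apply/eqP; rewrite eqn_leq n1.
  by rewrite expr1n invr1 subrr measure0.
have [k [k0 nk kn]] := sample_scale R n1.
have nR : 0 < n%:R :> R by rewrite ltr0n.
have [E [mE PE HE]] := uniform_deviation M_ge0 k0 GsM mu_iid Z_normal n_gt0 nk.
exists E; split => //.
  apply: le_trans PE; rewrite lee_fin lerD2l lerN2 exprVn lef_pV2 ?posrE ?exprn_gt0//.
  have -> : 4 ^+ k = (2 ^+ k) ^+ 2 :> R by rewrite -exprM mulnC exprM; congr (_ ^+ _); ring.
  by rewrite lerXn2r ?nnegrE ?exprn_ge0// -natrX ler_nat.
move=> w Ew; have [GM Gw] := Gmin w.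
rewrite (regretE GsM GM M_ge0); split => //.
rewrite (fisher_divergenceE GsM GM M_ge0) lee_fin.
(* The true law is a competitor of the minimizer. *)
apply: (le_trans (HE w Ew _ GM _)).
  have := Gw _ GsM; rewrite /SURE lerD2l ler_pM2l ?invr_gt0// -subr_le0 -sumrB.
  by under eq_bigr do rewrite -(excess_lossE GsM GM M_ge0).
rewrite (_ : rate_const M * 4 ^+ 6 * (ln n%:R ^+ 6 / n%:R) =
  rate_const M * (4 ^+ 6 * ln n%:R ^+ 6) / n%:R); last by rewrite !mulrA.
rewrite ler_wpM2r ?invr_ge0//.
rewrite ler_wpM2l ?(ltW (rate_const_gt0 M_ge0))//.
have k1 : 1 <= k%:R :> R by rewrite ler1n.
apply: (@le_trans _ _ (k%:R ^+ 6)).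
  by rewrite [leRHS]exprS ler_peMl// exprn_ge0.
rewrite -exprMn lerXn2r ?nnegrE// mulr_ge0// ln_ge0// ler1n.
exact: ltnW.
Qed.
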